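(* Let $X$ be a proper CAT$(-1)$ space and let $\Gamma\le\operatorname{Isom}(X)$ be finitely generated, non-elementary, and discrete, with $0<\delta_X(\Gamma)<\infty$. Fix a finite symmetric generating set $S$ of $\Gamma$, distinct points $A,B\in\Lambda_\Gamma$, a point $o$ on the geodesic $(A,B)$, constants $D,L$ as in the context, and a map $g\mapsto\xi_g$ from $\Gamma$ to $\partial X$ with $\xi_g\in\{gA,gB\}$ and $d(go,[o,\xi_g))\le D$ for all $g\in\Gamma$. (1) For every finite $Q\subset\Gamma$ and every $0<q\le1$, the nonempty component cluster sets $K_{Q,U}$, $U\in\mathscr U(Q)$, cover $\Lambda_\Gamma$, and $$\sum_{U\in\mathscr U(Q)}\operatorname{diam}(K_{Q,U})^q\le\mathcal W_{q,o}(Q;\xi);$$ moreover, for every $\varepsilon>0$, $$\mathcal W_{q,o}(Q;\xi)<\varepsilon^q\ \Longrightarrow\ c_\infty(Q)\ge\operatorname{pack}_\varepsilon(\Lambda_\Gamma,\rho_o).$$ (2) Let $0<q\le 1$ with $P_{\Gamma,o}(q)<\infty$. Then the function $$d^{\mathcal E}_{q,o,S}(\epsilon,\eta)=\begin{cases}0,&\epsilon=\eta,\\ \Theta_{q,o,S}(N_S(\epsilon,\eta))^{1/q},&\epsilon\neq\eta,\end{cases}$$ is an ultrametric on $\mathcal E(\Gamma)$ inducing the end topology. Let $\Pi_o:\mathcal E(\Gamma)\to\Lambda_\Gamma$ be the restriction to $\mathcal E(\Gamma)$ of the unique continuous $\Gamma$-equivariant extension $\Gamma\sqcup\mathcal E(\Gamma)\to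 X\sqcup\Lambda_\Gamma$ of the orbit map $g\mapsto go$ (which exists). Then $$\rho_o(\Pi_o\epsilon,\Pi_o\eta)\le d^{\mathcal E}_{q,o,S}(\epsilon,\eta)\qquad(\epsilon,\eta\in\mathcal E(\Gamma)),$$ and $\Pi_o:(\mathcal E(\Gamma),d^{\mathcal E}_{q,o,S})\to(\Lambda_\Gamma,\rho_o)$ is a surjective $1$-Lipschitz $\Gamma$-equivariant map, hence a topological quotient map.
   Context: $P_{\Gamma,o}(s)=\sum_{g\in\Gamma}e^{-s d(o,go)}$ and $\delta_X(\Gamma)=\inf\{s>0:P_{\Gamma,o}(s)<\infty\}$. $\Lambda_\Gamma\subseteq\partial X$ is the limit set. $\rho_o(\xi,\eta)=e^{-(\xi\mid\eta)_o}$ is the Bourdon metric on $\partial X$ (Gromov product based at $o$); diameters of subsets of $\Lambda_\Gamma$ are taken in $\rho_o$, and $\operatorname{diam}(\varnothing)=0$. $X\sqcup\Lambda_\Gamma$ carries the subspace topology from the visual compactification $X\sqcup\partial X$. Constants: $D$ is a thin-triangle constant for $X$ (in every geodesic triangle, ideal vertices allowed, each side lies in the $D$-neighbourhood of the union of the other two), and $L=\max_{s\in S}d(o,so)$. A map $g\mapsto\xi_g$ as required always exists. Cayley graph: $\operatorname{Cay}(\Gamma,S)$ has vertex set $\Gamma$ and undirected edges $\{g,gs\}$, $s\in S$; $|g|_S$ is word length; $B_S(n)=\{g:|g|_S\le n\}$ for $n\ge0$ and $B_S(-1)=\varnothing$. For finite $Q\subset\Gamma$, $\operatorname{Cay}(\Gamma,S)\setminus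 Q$ is the induced subgraph on $\Gamma\setminus Q$, $\mathscr U(Q)$ is its set of connected components, and $c_\infty(Q)$ is the number of infinite components. Cluster sets: for $U\in\mathscr U(Q)$, $K_{Q,U}=\bigcap_{F\subset U\text{ finite}}\overline{\{\xi_g:g\in U\setminus F\}}\subseteq\Lambda_\Gamma$ (closure in $\partial X$). Edge-weight sum: for an edge $e=\{g,gs\}$ set $w_o(e)=\rho_o(\xi_g,\xi_{gs})$, and $\mathcal W_{q,o}(Q;\xi)=\sum_{e}w_o(e)^q\in[0,\infty]$, over all undirected edges $e$ of $\operatorname{Cay}(\Gamma,S)\setminus Q$, each counted once. Packing number: $\operatorname{pack}_\varepsilon(Z,d)=\sup\{|E|:E\subseteq Z,\ d(x,y)\ge\varepsilon\text{ for all distinct }x,y\in E\}$. Ends: a ray is a one-way infinite simple edge path in $\operatorname{Cay}(\Gamma,S)$; two rays are equivalent if for every finite $Q$ they have tails in the same component of $\operatorname{Cay}(\Gamma,S)\setminus Q$; $\mathcal E(\Gamma)$ is the set of classes. For an infinite component $U$ of $\operatorname{Cay}(\Gamma,S)\setminus Q$, $\mathcal E(U)$ is the set of ends whose representing rays have a tail in $U$; the sets $\mathcal E(U)$ (all finite $Q$) form a basis of the end topology. On $\widehat\Gamma=\Gamma\sqcup\mathcal E(\Gamma)$ vertices are isolated and the sets $U\sqcup\mathcal E(U)$ are the basic neighbourhoods of ends. Tail function: $\Theta_{q,o,S}(n)=|S|\,e^{q(L+2D)}\sum_{|g|_S>n}e^{-q d(o,go)}$ for $n\ge-1$. For distinct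 ends $\epsilon,\eta$, $N_S(\epsilon,\eta)$ is the largest $n\ge-1$ such that $\epsilon,\eta\in\mathcal E(U)$ for one component $U$ of $\operatorname{Cay}(\Gamma,S)\setminus B_S(n)$. *)

(* Defs.v *)
From HB Require Import structures.
From mathcomp Require Import all_boot all_order all_algebra finmap.
From mathcomp Require Import all_classical all_reals all_analysis.

Set Implicit Arguments.
Unset Strict Implicit.
Unset Printing Implicit Defensive.

Import Order.TTheory GRing.Theory Num.Theory.
Import numFieldNormedType.Exports.

Local Open Scope classical_set_scope.
Local Open Scope ring_scope.

Section distances.
Context {R : realType} {T : choiceType}.
Implicit Types (d : T -> T -> R) (Z V : set T).

(* [sup] of the empty set is 0, so [diam d set0 = 0]. *)
Definition diam d Z : R := sup [set d x y | x in Z & y in Z].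

Definition pack d (e : R) Z : \bar R :=
  ereal_sup [set counting E | E in
    [set E : set T | E `<=` Z /\
       forall x y, E x -> E y -> x <> y -> e <= d x y]].

Definition dist_open d Z V : Prop :=
  V `<=` Z /\
  forall x, V x -> exists2 r : R, 0 < r & Z `&` [set y | d x y < r] `<=` V.

Definition is_ultrametric d : Prop :=
  [/\ forall x y, 0 <= d x y,
      forall x y, d x y = 0 <-> x = y,
      forall x y, d x y = d y x &
      forall x y z, d x z <= Num.max (d x y) (d y z)].

End distances.

Section hyperbolic_plane.
Context {R : realType}.

Definition arcosh (u : R) : R := ln (u + Num.sqrt (u ^+ 2 - 1)).

(* The upper half-plane model of the hyperbolic plane of curvature -1. *)
Definition H2 : set (R * R) := [set z | 0 < z.2].

Definition H2dist (z w : R * R) : R :=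
  arcosh (1 + ((z.1 - w.1) ^+ 2 + (z.2 - w.2) ^+ 2) / (2 * z.2 * w.2)).

End hyperbolic_plane.

Section geodesics.
Context {R : realType} {X : metricType R}.
Implicit Types (x y z p q r : X) (c : R -> X) (A : set X).

Definition geodesic_on (I : set R) c : Prop :=
  forall s t, I s -> I t -> mdist (c s) (c t) = `|s - t|.

Definition geodesic_segment x y c : Prop :=
  [/\ geodesic_on `[0, mdist x y] c, c 0 = x & c (mdist x y) = y].

Definition geodesic_ray c : Prop := geodesic_on `[0, +oo[ c.

Definition geodesic_line c : Prop := geodesic_on setT c.

(* Only the values at nonnegative times of a ray matter. *)
Definition asymptotic c c' : Prop :=
  exists K : R, forall t, 0 <= t -> mdist (c t) (c' t) <= K.

Definition dist_to_set x A : R := inf [set mdist x y | y in A].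

End geodesics.

Section spaces.
Context {R : realType}.
Variable X : metricType R.

Definition proper_space : Prop :=
  forall (x : X) (r : R), compact [set y | mdist x y <= r].

(* Comparison of the points at distance [s] and [t] from the vertex [p] on the
   sides [p, q] and [p, r]; [p'], [q'], [r'] is a comparison triangle, and [x'],
   [y'] are the comparison points. *)
Definition CAT_minus1 : Prop :=
  (forall x y : X, exists c, geodesic_segment x y c) /\
  forall (p q r : X) (c1 c2 : R -> X) (p' q' r' x' y' : R * R) (s t : R),
    geodesic_segment p q c1 -> geodesic_segment p r c2 ->
    H2 p' -> H2 q' -> H2 r' ->
    H2dist p' q' = mdist p q -> H2dist p' r' = mdist p r ->
    H2dist q' r' = mdist q r ->
    0 <= s <= mdist p q -> 0 <= t <= mdist p r ->
    H2 x' -> H2dist p' x' = s -> H2dist x' q' = mdist p q - s ->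
    H2 y' -> H2dist p' y' = t -> H2dist y' r' = mdist p r - t ->
    mdist (c1 s) (c2 t) <= H2dist x' y'.

Record boundary : Type := Boundary {
  bd_rays : set (R -> X);
  bd_raysP : exists2 c, geodesic_ray c &
    bd_rays = [set c' | geodesic_ray c' /\ asymptotic c c'] }.

HB.instance Definition _ := gen_eqMixin boundary.
HB.instance Definition _ := gen_choiceMixin boundary.

Definition bordification : Type := (X + boundary)%type.

HB.instance Definition _ := Choice.on bordification.

Definition geodesic_towards (p : X) (z : bordification) (c : R -> X) : Prop :=
  match z with
  | inl x => geodesic_segment p x c
  | inr xi => bd_rays xi c /\ c 0 = p
  end.

(* The set U(c, r, e) of the points of the bordification farther than [r] from
   [c 0] whose projection to the ball of radius [r] about [c 0] is [e]-close to
   [c r]. *)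
Definition cone_nbhs (c : R -> X) (r e : R) : set bordification :=
  [set z | (forall x, z = inl x -> r < mdist (c 0) x) /\
    exists2 c', geodesic_towards (c 0) z c' & mdist (c' r) (c r) < e].

(* The cone topology: generated by the open sets of [X] and the sets U(c, r, e)
   for all geodesic rays [c]. *)
Definition cone_subbase : set (set bordification) :=
  [set A | (exists2 V : set X, open V & A = inl @` V) \/
    exists c r e, [/\ geodesic_ray c, 0 < r, 0 < e & A = cone_nbhs c r e]].

HB.instance Definition _ :=
  isSubBaseTopological.Build bordification cone_subbase (@id (set bordification)).

HB.instance Definition _ :=
  Topological.copy boundary
    (initial_topology (inr : boundary -> bordification)).

Definition geodesic_side (a b : bordification) (A : set X) : Prop :=
  match a, b with
  | inl x, inl y =>
      exists2 c, geodesic_segment x y c & A = c @` `[0, mdist x y]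
  | inl x, inr xi | inr xi, inl x =>
      exists2 c, bd_rays xi c /\ c 0 = x & A = c @` `[0, +oo[
  | inr xi, inr eta =>
      exists2 c, [/\ geodesic_line c, bd_rays xi (c \o -%R) & bd_rays eta c]
               & A = range c
  end.

Definition thin_triangles (D : R) : Prop :=
  forall (a b c : bordification) (s1 s2 s3 : set X),
    geodesic_side a b s1 -> geodesic_side b c s2 -> geodesic_side a c s3 ->
    forall x, s1 x -> exists2 y, (s2 `|` s3) y & mdist x y <= D.

Definition gromov_product (o x y : X) : R :=
  (mdist x o + mdist y o - mdist x y) / 2.

(* In a proper CAT(-1) space the ray from [o] to [xi] exists and is unique. *)
Definition ray_from (o : X) (xi : boundary) : R -> X :=
  xget (cst o) [set c | bd_rays xi c /\ c 0 = o].

(* The boundary extension of the Gromov product, computed along the geodesic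
   rays from [o]; it is +oo exactly on the diagonal, where [bourdon] vanishes. *)
Definition gromov_product_bd (o : X) (xi eta : boundary) : \bar R :=
  lim ((gromov_product o (ray_from o xi t) (ray_from o eta t))%:E @[t --> +oo]).

Definition bourdon (o : X) (xi eta : boundary) : R :=
  fine (expeR (- gromov_product_bd o xi eta)%E).

Record isom : Type := Isom {
  isom_fun :> X -> X;
  isom_mdist : forall x y, mdist (isom_fun x) (isom_fun y) = mdist x y;
  isom_surj : forall y, exists x, isom_fun x = y }.

HB.instance Definition _ := gen_eqMixin isom.
HB.instance Definition _ := gen_choiceMixin isom.

Lemma isom_ext (f g : isom) : f =1 g -> f = g.
Proof.
case: f g => [f f1 f2] [g g1 g2] /= /funext fg; subst g.
by congr Isom; exact: Prop_irrelevance.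
Qed.

Lemma isom_inj (f : isom) : injective f.
Proof.
move=> x y fxy; apply: (@mdist_positivity R).
by rewrite -(isom_mdist f) fxy mdistxx.
Qed.

Definition isom_id : isom.
Proof. by exists id => // y; exists y. Defined.

Definition isom_comp (f g : isom) : isom.
Proof.
exists (f \o g) => [x y|y] /=; first by rewrite !isom_mdist.
by have [z <-] := isom_surj f y; have [x <-] := isom_surj g z; exists x.
Defined.

Definition isom_inv_fun (f : isom) (y : X) : X := sval (cid (isom_surj f y)).

Lemma isom_inv_funK (f : isom) : cancel (isom_inv_fun f) f.
Proof. by move=> y; rewrite /isom_inv_fun; case: cid. Qed.

Definition isom_inv (f : isom) : isom.
Proof.
exists (isom_inv_fun f) => [x y|y].
  by rewrite -(isom_mdist f) !isom_inv_funK.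
by exists (f y); apply: (@isom_inj f); rewrite isom_inv_funK.
Defined.

Lemma isom_compA : associative isom_comp.
Proof. by move=> f g h; apply: isom_ext. Qed.

Lemma isom_comp1f : left_id isom_id isom_comp.
Proof. by move=> f; apply: isom_ext. Qed.

Lemma isom_compf1 : right_id isom_id isom_comp.
Proof. by move=> f; apply: isom_ext. Qed.

Lemma isom_compVf : left_inverse isom_id isom_inv isom_comp.
Proof.
move=> f; apply: isom_ext => x /=.
by apply: (@isom_inj f); rewrite isom_inv_funK.
Qed.

Lemma isom_compfV : right_inverse isom_id isom_inv isom_comp.
Proof. by move=> f; apply: isom_ext => x /=; rewrite isom_inv_funK. Qed.

HB.instance Definition _ := isGroup.Build isom
  isom_compA isom_comp1f isom_compf1 isom_compVf isom_compfV.

Lemma isom_raysP (f : isom) (xi : boundary) : exists2 c, geodesic_ray c &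
  [set f \o c' | c' in bd_rays xi] =
  [set c' | geodesic_ray c' /\ asymptotic c c'].
Proof.
case: xi => E /= [c rc ->]; exists (f \o c) => [s t s0 t0 /=|].
  by rewrite isom_mdist; exact: rc.
apply/seteqP; split => [_ [c' [rc' [K cc']] <-]|c' [rc' [K fcc']]] /=.
  split => [s t s0 t0 /=|]; first by rewrite isom_mdist; exact: rc'.
  by exists K => t t0 /=; rewrite isom_mdist; exact: cc'.
exists (isom_inv f \o c'); last first.
  by apply/funext => t /=; rewrite isom_inv_funK.
split => [s t s0 t0 /=|].
  by rewrite (isom_mdist (isom_inv f)); exact: rc'.
exists K => t t0; rewrite -(isom_mdist f) /= isom_inv_funK; exact: fcc'.
Qed.

Definition isom_bd (f : isom) (xi : boundary) : boundary :=
  Boundary (isom_raysP f xi).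

Definition isom_bord (f : isom) (z : bordification) : bordification :=
  match z with inl x => inl (f x) | inr xi => inr (isom_bd f xi) end.

End spaces.

Section isometry_groups.
Context {R : realType} {X : metricType R}.
Context {Gam : {pred isom X}}.
Variable G : subGroupType Gam.

Definition discrete_isom_group : Prop :=
  forall g : G, \forall f \near ((val g : X -> X) : {compact-open, X -> X}),
    forall h : G, (val h : X -> X) = f -> h = g.

Definition limit_set : set (boundary X) :=
  [set xi | exists x : X, closure
     [set (inl ((val g : isom X) x) : bordification X) | g in [set: G]]
     (inr xi)].

Definition non_elementary : Prop :=
  ~ exists a b : boundary X, limit_set `<=` [set a; b].

Definition poincare_series (o : X) (s : R) : \bar R :=
  \esum_(g in [set: G]) (expR (- (s * mdist o ((val g : isom X) o))))%:E.

Definition critical_exponent (o : X) : \bar R :=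
  ereal_inf [set s%:E | s in
    [set s : R | 0 < s /\ (poincare_series o s < +oo)%E]].

End isometry_groups.

Section cayley.
Context {G : groupType}.
Variable S : {fset G}.
Implicit Types (g h : G) (Q U : set G) (r : nat -> G).

Definition symmetric_set : Prop := forall s, s \in S -> (s^-1)%g \in S.

Definition is_word (w : seq G) g : Prop :=
  all (mem S) w /\ g = \big[*%g/1%g]_(s <- w) s.

(* For symmetric [S], the subgroup generated by [S] consists of the products of
   elements of [S]. *)
Definition generating_set : Prop := forall g, exists w, is_word w g.

Definition cay_adj g h : bool := (g^-1 * h)%g \in S.

Definition cay_connected Q g h : Prop :=
  ~ Q g /\ exists2 p : seq G,
    path (fun x y => cay_adj x y && (y \notin Q)) g p & last g p = h.

Definition component Q U : Prop :=
  exists2 g, ~ Q g & U = [set h | cay_connected Q g h].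

Definition c_infty {R : realType} Q : \bar R :=
  counting [set U | component Q U /\ infinite_set U].

Definition cay_edges Q : set (set G) :=
  [set e | exists g s,
    [/\ s \in S, ~ Q g, ~ Q (g * s)%g & e = [set g; (g * s)%g]]].

Definition word_length g : nat :=
  xget 0%N [set n | (exists2 w, is_word w g & size w = n) /\
                    forall w, is_word w g -> (n <= size w)%N].

Definition word_ball (n : int) : set G := [set g | (word_length g)%:Z <= n].

Definition cay_ray r : Prop :=
  injective r /\ forall n, cay_adj (r n) (r n.+1).

Definition has_tail_in r U : Prop := exists n, forall m, (n <= m)%N -> U (r m).

Definition ray_equiv r r' : Prop :=
  forall Q, finite_set Q ->
    exists U, [/\ component Q U, has_tail_in r U & has_tail_in r' U].

Record ends : Type := Ends {
  end_rays : set (nat -> G);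
  end_raysP : exists2 r, cay_ray r &
    end_rays = [set r' | cay_ray r' /\ ray_equiv r r'] }.

HB.instance Definition _ := gen_eqMixin ends.
HB.instance Definition _ := gen_choiceMixin ends.

Definition ends_in U : set ends :=
  [set e | forall r, end_rays e r -> has_tail_in r U].

Definition ends_base : set (set ends) :=
  [set A | exists Q U,
    [/\ finite_set Q, component Q U, infinite_set U & A = ends_in U]].

HB.instance Definition _ :=
  isSubBaseTopological.Build ends ends_base (@id (set ends)).

Definition end_compactification : Type := (G + ends)%type.

HB.instance Definition _ := Choice.on end_compactification.

Definition end_compactification_base : set (set end_compactification) :=
  [set A | (exists g, A = [set inl g]) \/
    exists Q U, [/\ finite_set Q, component Q U, infinite_set U &
                    A = inl @` U `|` inr @` (ends_in U)]].

HB.instance Definition _ :=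
  isSubBaseTopological.Build end_compactification end_compactification_base
    (@id (set end_compactification)).

Lemma cay_adjM g x y : cay_adj (g * x)%g (g * y)%g = cay_adj x y.
Proof. by rewrite /cay_adj invgM -mulgA mulKg. Qed.

Lemma component_translate g Q U :
  component [set (g * x)%g | x in Q] U -> component Q [set x | U (g * x)%g].
Proof.
set gQ := [set _ | _ in _]; have gQE x : gQ (g * x)%g <-> Q x.
  by split=> [[y Qy /mulgI <-//]|Qx]; exists x.
have pathE x p :
    path (fun x y => cay_adj x y && (y \notin gQ)) (g * x)%g (map (fun z => g * z)%g p) =
    path (fun x y => cay_adj x y && (y \notin Q)) x p.
  elim: p x => //= y p IH x; rewrite IH cay_adjM; congr (_ && ~~ _ && _).
  by apply/idP/idP; rewrite !inE => /gQE.
case=> x gQx ->; exists (g^-1 * x)%g.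
  by move=> /gQE; rewrite mulVKg.
apply/seteqP; split => y [/= _ [p pp lp]]; split.
- by move=> /gQE; rewrite mulVKg.
- exists (map (fun z => g^-1 * z)%g p).
    by rewrite -pathE mulVKg -map_comp map_id_in// => z _ /=; rewrite mulVKg.
  by rewrite last_map lp mulKg.
- by [].
- exists (map (fun z => g * z)%g p); last by rewrite -[x in last x](mulVKg g) last_map lp.
  by rewrite -[x in path _ x](mulVKg g) pathE.
Qed.

Lemma ray_equiv_translate g r r' :
  ray_equiv r r' -> ray_equiv (fun n => g * r n)%g (fun n => g * r' n)%g.
Proof.
move=> rr' Q fQ.
have [U [cU [n rU] [n' rU']]] := rr' _ (finite_image (fun z => g^-1 * z)%g fQ).
exists [set x | U (g^-1 * x)%g]; split; first exact: component_translate.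
- by exists n => m nm /=; rewrite mulKg; exact: rU.
- by exists n' => m nm /=; rewrite mulKg; exact: rU'.
Qed.

Lemma cay_ray_translate g r : cay_ray r -> cay_ray (fun n => g * r n)%g.
Proof.
by case=> ri ra; split => [m n /mulgI/ri//|n]; rewrite cay_adjM.
Qed.

Lemma end_translateP g (e : ends) : exists2 r, cay_ray r &
  [set (fun n => g * r' n)%g | r' in end_rays e] =
  [set r' | cay_ray r' /\ ray_equiv r r'].
Proof.
case: e => E /= [r rr ->]; exists (fun n => g * r n)%g.
  exact: cay_ray_translate.
apply/seteqP; split => [_ [r' [rr' rer'] <-]|r' [rr' rer']] /=.
  by split; [exact: cay_ray_translate|exact: ray_equiv_translate].
exists (fun n => g^-1 * r' n)%g; last by apply/funext => n; rewrite mulVKg.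
split; first exact: cay_ray_translate.
have := ray_equiv_translate g^-1%g rer'.
by under [X in ray_equiv X]eq_fun do rewrite mulKg.
Qed.

Definition end_translate g (e : ends) : ends := Ends (end_translateP g e).

Definition end_compactification_translate g (z : end_compactification) :
    end_compactification :=
  match z with inl h => inl (g * h)%g | inr e => inr (end_translate g e) end.

Definition end_level (e e' : ends) : int :=
  let same n := -1 <= n /\
    exists U, [/\ component (word_ball n) U, ends_in U e & ends_in U e'] in
  xget (-1) [set n | same n /\ forall m, same m -> m <= n].

End cayley.

Section boundary_maps.
Context {R : realType} {X : metricType R}.
Context {Gam : {pred isom X}} {G : subGroupType Gam}.
Variables (S : {fset G}) (o : X).

Definition cluster_set (xi : G -> boundary X) (U : set G) : set (boundary X) :=
  \bigcap_(F in [set F | finite_set F /\ F `<=` U])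
    closure [set xi g | g in U `\` F].

(* An edge is the set of its two endpoints, so that undirected edges are counted
   once; [w] does not depend on the order of the endpoints. *)
Definition edge_weight (xi : G -> boundary X) (e : set G) : R :=
  xget 0 [set w | exists g h, e = [set g; h] /\ w = bourdon o (xi g) (xi h)].

Definition edge_weight_sum (q : R) (xi : G -> boundary X) (Q : set G) : \bar R :=
  \esum_(e in cay_edges S Q) (edge_weight xi e `^ q)%:E.

Definition max_displacement : R :=
  \big[Num.max/0]_(s <- S) mdist o ((val s : isom X) o).

Definition tail_function (q D : R) (n : int) : \bar R :=
  ((#|` S|%:R * expR (q * (max_displacement + 2 * D)))%:E *
   \esum_(g in [set g : G | (n < (word_length S g)%:Z)%R])
     (expR (- (q * mdist o ((val g : isom X) o))))%:E)%E.

Definition end_dist (q D : R) (e e' : ends S) : R :=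
  if e == e' then 0 else fine (tail_function q D (end_level e e')) `^ q^-1.

(* Since the union of [X] and the limit set has the subspace topology, continuity
   into it is continuity into the bordification with values in that union. *)
Definition is_orbit_extension
    (Phi : end_compactification S -> bordification X) : Prop :=
  [/\ forall z, (range inl `|` inr @` limit_set G) (Phi z),
      continuous Phi,
      forall g z, Phi (end_compactification_translate g z) =
                  isom_bord (val g) (Phi z) &
      forall g, Phi (inl g) = inl ((val g : isom X) o)].

End boundary_maps.

(* Main.v *)
Require Import Defs.
From mathcomp Require Import all_boot all_order all_algebra finmap ring lra zify.
From mathcomp Require Import all_classical all_reals all_analysis.

(** The orbit point [g o] lies within [D] of the ray from [o] to [xi g], so that
    [xi g] is a shadow of [g o] at infinity. For an edge [{g, g s}] the Gromov
    product of the two shadows is at least [d(o, g o) - L - 2 D], which bounds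
    their Bourdon distance by a constant times [exp (- d(o, g o))]
    ([adjacent_bourdon]). Since the Bourdon distance is a metric and its [q]-th
    power is still subadditive for [q <= 1], a simple path in a component [U] of
    the complement of [Q] bounds the distance between the shadows of its ends by
    the sum of the weights of its edges, which are distinct edges of [U]. Hence
    the diameter of the cluster set of [U] is controlled by the edges of [U]
    alone ([diam_cluster_powR]); distinct components have disjoint edges, there
    are finitely many components, and every limit point is approximated by the
    shadows of infinitely many [g], which gives the first part
    ([cluster_cover], [sum_diam_cluster_le], [pack_le_c_infty]).

    For the second part, the vertices of a path outside the ball [B(n)]
    contribute distinct terms of the tail of the Poincare series, so the shadows
    of all vertices of a component of the complement of [B(n)] are within
    [Theta(n)^(1/q)] of each other. As [n] grows these bounds tend to 0: the
    shadows converge along every ray, with a limit [Pi e] that depends only on the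
    end, and the limits of two ends that share a component at level [N] are
    within [Theta(N)^(1/q)] ([end_map_lipschitz]). The same estimate shows that
    orbit points deep in that component are close to [Pi e] in the cone
    topology, which yields continuity of the extension, hence its equivariance
    and uniqueness. Koenig's lemma in the tree of geodesic words
    ([geodesic_ray_through]) provides ends with a prescribed image, and replaces
    the compactness of the space of ends in the proof that [Pi] is a quotient
    map.

    The geometric input comes from one inequality. The comparison axiom implies
    Stewart's inequality ([stewart]) for the distance from a point to the points
    of a geodesic; from it follow the contraction of geodesics with large Gromov
    product ([geodesic_contraction]), hence uniqueness of rays and the agreement
    of the cone topology with the Bourdon metric, and, in the limit, the
    triangle inequality for the Bourdon metric ([gap_triangle]). Thin triangles
    are used to compare geodesics with different origins or nearby end points.
    Local finiteness of the orbit is read off from a convergent Poincare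
    series. *)

Set Implicit Arguments.
Unset Strict Implicit.
Unset Printing Implicit Defensive.

Import Order.TTheory GRing.Theory Num.Theory.
Import numFieldNormedType.Exports.

Local Open Scope classical_set_scope.
Local Open Scope ring_scope.

(** * Hyperbolic functions and comparison triangles *)

Section hyperbolic_functions.
Context {R : realType}.
Implicit Types x y u : R.

Definition cosh x : R := (expR x + expR (- x)) / 2.
Definition sinh x : R := (expR x - expR (- x)) / 2.

Lemma coshN x : cosh (- x) = cosh x.
Proof. by rewrite /cosh opprK addrC. Qed.

Lemma cosh0 : cosh 0 = 1.
Proof. by rewrite /cosh oppr0 expR0; field. Qed.

Lemma sinh0 : sinh 0 = 0.
Proof. by rewrite /sinh oppr0 expR0; field. Qed.

Lemma le_add_inv (F : realFieldType) (x y : F) :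
  0 < x -> x <= y -> 1 <= x * y -> x + x^-1 <= y + y^-1.
Proof.
move=> x0 xy xy1; have y0 : 0 < y by exact: lt_le_trans xy.
rewrite -subr_ge0 (_ : _ - _ = (y - x) * (x * y - 1) / (x * y)); last first.
  by field; rewrite !gt_eqF.
by rewrite divr_ge0 ?mulr_ge0 ?subr_ge0// ltW.
Qed.

Lemma le_cosh x y : 0 <= x -> x <= y -> cosh x <= cosh y.
Proof.
move=> x0 xy; rewrite /cosh ler_pM2r ?invr_gt0// !expRN le_add_inv ?expR_gt0 ?ler_expR//.
by rewrite -expRD -expR0 ler_expR addr_ge0// (le_trans x0).
Qed.

Lemma lt_cosh x y : 0 <= x -> x < y -> cosh x < cosh y.
Proof.
move=> x0 xy; rewrite /cosh ltr_pM2r ?invr_gt0// !expRN.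
have a1 : 1 <= expR x by rewrite -expR0 ler_expR.
have ab : expR x < expR y by rewrite ltr_expR.
move: (expR x) (expR y) a1 ab => a b a1 ab.
have a0 : 0 < a by lra.
have b0 : 0 < b by lra.
rewrite -subr_gt0 (_ : _ - _ = (b - a) * (a * b - 1) / (a * b)); last first.
  by field; rewrite !gt_eqF.
by rewrite divr_gt0 ?mulr_gt0 ?subr_gt0//; nra.
Qed.

Lemma cosh_le_inv x y : 0 <= y -> cosh x <= cosh y -> x <= y.
Proof. by move=> y0; apply: contraTT; rewrite -!ltNge => yx; exact: lt_cosh. Qed.

Lemma cosh_ge1 x : 1 <= cosh x.
Proof.
wlog x0 : x / 0 <= x => [H|]; last by rewrite -cosh0 le_cosh.
by have [/H//|/ltW x0] := leP 0 x; rewrite -coshN H// oppr_ge0.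
Qed.

Lemma sinh_ge0 x : 0 <= x -> 0 <= sinh x.
Proof. by move=> x0; rewrite divr_ge0// subr_ge0 ler_expR; lra. Qed.

Lemma sinh_gt0 x : 0 < x -> 0 < sinh x.
Proof. by move=> x0; rewrite divr_gt0// subr_gt0 ltr_expR; lra. Qed.

Lemma cosh_arcosh u : 1 <= u -> cosh (arcosh u) = u.
Proof.
move=> u1; rewrite /cosh /arcosh; set s := Num.sqrt _.
have s2 : s ^+ 2 = u ^+ 2 - 1 by rewrite sqr_sqrtr// subr_ge0; nra.
have s0 : 0 <= s by rewrite sqrtr_ge0.
rewrite expRN !lnK ?posrE; last by lra.
by rewrite (_ : (u + s)^-1 = u - s); [field|apply: (@mulfI _ (u + s)); [lra|rewrite divff; [nra|lra]]].
Qed.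

Lemma arcosh_ge0 u : 1 <= u -> 0 <= arcosh u.
Proof. by move=> u1; rewrite ln_ge0// (le_trans u1)// lerDl sqrtr_ge0. Qed.

Lemma cosh_inj x y : 0 <= x -> 0 <= y -> cosh x = cosh y -> x = y.
Proof.
by move=> x0 y0 xy; apply/le_anti/andP; split; apply: cosh_le_inv; rewrite // xy.
Qed.

Lemma arcosh_cosh x : 0 <= x -> arcosh (cosh x) = x.
Proof.
by move=> x0; apply: cosh_inj; rewrite ?arcosh_ge0 ?cosh_arcosh ?cosh_ge1.
Qed.

End hyperbolic_functions.

(** In the upper half-plane, [(u, v)] is the apex of a triangle with vertices
    [(0, 1)] and [(0, T)] at distances [ln a] and [ln b] from it. The equations
    are linear in [u^2 + v^2] and [v]; they determine [v], and the remaining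
    constraint [0 <= u^2] factors as a product of two nonnegative terms, one for
    each of the inequalities [cosh (t - a) <= cosh b <= cosh (t + a)]. *)
Lemma comparison_apex (R : rcfType) (T a b : R) :
  1 < T -> 1 <= a -> 1 <= b -> a <= b * T -> b <= a * T -> T <= a * b ->
  exists u v : R, [/\ 0 < v, u ^+ 2 + v ^+ 2 + 1 = v * (a + a^-1) &
    u ^+ 2 + v ^+ 2 + T ^+ 2 = v * T * (b + b^-1)].
Proof.
move=> T1 a1 b1 abT baT Tab.
have [T0 a0 b0] : [/\ 0 < T, 0 < a & 0 < b] by split; lra.
have aT0 : 0 < a * T by rewrite mulr_gt0.
have bT0 : 0 < b * T by rewrite mulr_gt0.
set p := a + a^-1; set r := b + b^-1; set W := T * r - p.
have W0 : 0 < W.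
  have pbT : p <= b * T + (b * T)^-1 by apply: le_add_inv => //; nra.
  have : (b * T)^-1 < T / b.
    by rewrite invfM mulrC ltr_pM2r ?invr_gt0// invf_plt ?posrE// (lt_trans _ T1)// invf_lt1.
  by rewrite /W /r; lra.
have rP : r <= a * T + (a * T)^-1 by apply: le_add_inv => //; nra.
have rM : a / T + (a / T)^-1 <= r.
  apply: le_add_inv; first by rewrite divr_gt0.
    by rewrite ler_pdivrMr.
  by rewrite mulrAC ler_pdivlMr// mul1r.
set v := (T ^+ 2 - 1) / W.
have v0 : 0 < v by rewrite divr_gt0// subr_gt0; nra.
have D0 : 0 <= v * p - 1 - v ^+ 2.
  rewrite (_ : _ - _ = T ^+ 2 * ((a * T + (a * T)^-1 - r) * (r - (a / T + (a / T)^-1))) / W ^+ 2).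
    by apply: divr_ge0; rewrite ?sqr_ge0// !mulr_ge0 ?subr_ge0// ltW.
  have W2 : W ^+ 2 != 0 by rewrite expf_neq0 ?gt_eqF.
  rewrite /v; apply: (mulIf W2).
  rewrite divfK//.
  transitivity ((T ^+ 2 - 1) * p * W - W ^+ 2 - (T ^+ 2 - 1) ^+ 2).
    by clearbody W p r; field; rewrite gt_eqF.
  by rewrite /W /p; field; rewrite !gt_eqF.
exists (Num.sqrt (v * p - 1 - v ^+ 2)), v; rewrite sqr_sqrtr//; split => //.
- by ring.
- have : v * W = T ^+ 2 - 1 by rewrite /v divfK// gt_eqF.
  by rewrite /W; lra.
Qed.

(** * Stewart's inequality and the divergence of geodesics *)

Section hyperbolic_identities.
Context {R : realType}.
Implicit Types x y t : R.

Lemma sinhB x y : sinh (x - y) = sinh x * cosh y - cosh x * sinh y.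
Proof.
rewrite /sinh /cosh opprB !expRD !expRN; field; rewrite ?gt_eqF ?expR_gt0//.
Qed.

Lemma cosh2E x : cosh x ^+ 2 = 1 + sinh x ^+ 2.
Proof. by rewrite /sinh /cosh !expRN; field; rewrite gt_eqF ?expR_gt0. Qed.

Lemma cosh_le_expR x : 0 <= x -> cosh x <= expR x.
Proof.
by move=> x0; rewrite /cosh; have : expR (- x) <= expR x; [rewrite ler_expR; lra|lra].
Qed.

Lemma expR_le_cosh x : expR x <= 2 * cosh x.
Proof. by rewrite /cosh; have := expR_gt0 (- x); lra. Qed.

Lemma expR_le_sinh t : 1 <= t -> expR t <= 4 * sinh t.
Proof.
move=> t1; rewrite /sinh expRN; have : 2 <= expR t.
  by apply: le_trans (expR_ge1Dx t); lra.
move: (expR t) => a a2; have : a^-1 <= 1 by rewrite invf_le1; lra.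
by lra.
Qed.

End hyperbolic_identities.

Section half_plane.
Context {R : realType}.
Implicit Types (u v h s t : R).

Lemma H2dist_axis u v h : 0 < h -> 0 < v ->
  H2dist (0, h) (u, v) = arcosh ((u ^+ 2 + v ^+ 2 + h ^+ 2) / (2 * v * h)).
Proof. by move=> h0 v0; congr arcosh => /=; field; rewrite !gt_eqF. Qed.

Lemma H2dist_vertical s t : H2dist (0, expR s) (0, expR t) = `|s - t|.
Proof.
rewrite H2dist_axis ?expR_gt0// (_ : _ / _ = cosh (s - t)); last first.
  by rewrite /cosh opprB !expRB; field; rewrite !gt_eqF ?expR_gt0.
have [st|st] := leP 0 (s - t); first by rewrite arcosh_cosh ?ger0_norm.
by rewrite -coshN arcosh_cosh ?oppr_ge0 ?ltr0_norm// ltW.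
Qed.

End half_plane.

Section geodesics.
Context {R : realType} {X : metricType R}.
Implicit Types (x y z p o : X) (c : R -> X) (s t : R).

Lemma geodesic_onS (I J : set R) c : I `<=` J -> geodesic_on J c -> geodesic_on I c.
Proof. by move=> IJ gc s t /IJ Js /IJ; exact: gc. Qed.

Lemma geodesic_on0 c t : 0 <= t -> geodesic_on `[0, t] c -> mdist (c 0) (c t) = t.
Proof.
by move=> t0 gc; rewrite gc//= ?in_itv/= ?lexx ?t0// sub0r normrN ger0_norm.
Qed.

Lemma geodesic_on_segment c t : 0 <= t -> geodesic_on `[0, t] c ->
  geodesic_segment (c 0) (c t) c.
Proof. by move=> t0 gc; split => //; rewrite geodesic_on0. Qed.

Lemma geodesic_ray_on c t : geodesic_ray c -> geodesic_on `[0, t] c.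
Proof. by apply: geodesic_onS => s /=; rewrite !in_itv/= => /andP[-> _]. Qed.

Lemma geodesic_rayE c s t : geodesic_ray c -> 0 <= s -> 0 <= t ->
  mdist (c s) (c t) = `|s - t|.
Proof. by move=> gc s0 t0; apply: gc; rewrite /= in_itv/= ?s0 ?t0. Qed.

Lemma geodesic_segment_dist o y c s : geodesic_segment o y c ->
  0 <= s <= mdist o y -> mdist o (c s) = s /\ mdist (c s) y = mdist o y - s.
Proof.
move=> [gc c0 cd] /andP[s0 sd].
have := gc 0 s; have := gc s (mdist o y); rewrite c0 cd /= !in_itv/= s0 sd !lexx mdist_ge0.
move=> /(_ isT isT) -> /(_ isT isT) ->.
by rewrite sub0r normrN ger0_norm// distrC ger0_norm// subr_ge0.
Qed.

End geodesics.

Section cat_minus1.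
Context {R : realType} {X : metricType R}.
Hypothesis X_cat : CAT_minus1 X.
Implicit Types (x y z p o : X) (c : R -> X) (r s t e : R).

(** Stewart's theorem: in the hyperbolic plane [cosh d(x, -)] restricted to a
    geodesic solves [f'' = f], so its value at an interior point is the stated
    combination of the values at the endpoints; the comparison inequality makes
    the distance in [X] smaller. *)
Lemma stewart x o y c s : geodesic_segment o y c -> 0 <= s <= mdist o y ->
  cosh (mdist x (c s)) * sinh (mdist o y) <=
  sinh (mdist o y - s) * cosh (mdist o x) + sinh s * cosh (mdist x y).
Proof.
move=> oyc sd; set t := mdist o y; set a := mdist o x; set b := mdist x y.
have [os sy] := geodesic_segment_dist oyc sd.
have t0 : 0 <= t := mdist_ge0 o y; have a0 : 0 <= a := mdist_ge0 o x.
have b0 : 0 <= b := mdist_ge0 x y.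
move: t0; rewrite le_eqVlt => /predU1P[t0|t0].
  move: sd; rewrite -/t -t0 -eq_le => /eqP s0.
  by rewrite -s0 subr0 sinh0 mulr0 !mul0r addr0.
have tri1 : a <= b + t by rewrite /a /b /t (metric_sym o x) (metric_sym o y) metric_triangle.
have tri2 : b <= a + t by rewrite /a /b /t (metric_sym o x) metric_triangle.
have tri3 : t <= a + b by exact: metric_triangle.
have e1 w : 0 <= w -> 1 <= expR w by rewrite -expR0 ler_expR.
have [] := @comparison_apex _ (expR t) (expR a) (expR b);
  rewrite -?expRD ?expR_gt1 ?e1 ?ler_expR//.
move=> u [v [v0 E1 E2]].
have [_ cmp] := X_cat.
have [c2 oxc2] := X_cat.1 o x.
have apex_o : H2dist (0, expR 0) (u, v) = a.
  rewrite H2dist_axis ?expR_gt0// expR0 expr1n E1 -[RHS]arcosh_cosh//.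
  by congr arcosh; rewrite /cosh expRN; field; rewrite !gt_eqF ?expR_gt0.
have apex_y : H2dist (0, expR t) (u, v) = b.
  rewrite H2dist_axis ?expR_gt0// E2 -[RHS]arcosh_cosh//.
  by congr arcosh; rewrite /cosh expRN; field; rewrite !gt_eqF ?expR_gt0.
have := cmp o y x c c2 (0, expR 0) (0, expR t) (u, v) (0, expR s) (u, v) s a oyc oxc2.
case/andP: (sd) => s0 st.
case: (oxc2) => _ _ ->; rewrite !H2dist_vertical apex_o apex_y !sub0r !normrN.
rewrite (ger0_norm s0) (ger0_norm (ltW t0)) ler0_norm ?subr_le0// opprB subrr.
rewrite /H2 /= !expR_gt0 v0 s0 st lexx a0 (metric_sym y x) -/b -/t -/a.
have uu : H2dist (u, v) (u, v) = 0.
  rewrite /H2dist !subrr expr0n/= addr0 mul0r addr0 -[1]cosh0 arcosh_cosh//.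
rewrite uu; do !(move=> /(_ erefl)); rewrite (metric_sym _ x) => H.
have {}H : cosh (mdist x (c s)) <= (u ^+ 2 + v ^+ 2 + expR s ^+ 2) / (2 * v * expR s).
  have ge1 : 1 <= (u ^+ 2 + v ^+ 2 + expR s ^+ 2) / (2 * v * expR s).
    rewrite ler_pdivlMr ?mulr_gt0 ?expR_gt0//.
    by have := sqr_ge0 u; have := sqr_ge0 (v - expR s); nra.
  rewrite -(cosh_arcosh ge1) le_cosh ?mdist_ge0// (le_trans H)//.
  by rewrite H2dist_axis ?expR_gt0.
apply: (le_trans (ler_wpM2r (sinh_ge0 (ltW t0)) H)).
have -> : cosh a = (u ^+ 2 + v ^+ 2 + 1) / (2 * v).
  by rewrite E1 /cosh expRN; field; rewrite !gt_eqF ?expR_gt0.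
have -> : cosh b = (u ^+ 2 + v ^+ 2 + expR t ^+ 2) / (2 * v * expR t).
  by rewrite E2 /cosh expRN; field; rewrite !gt_eqF ?expR_gt0.
rewrite le_eqVlt; apply/orP; left; apply/eqP.
rewrite /sinh opprB !expRB !expRN; field; rewrite !gt_eqF ?expR_gt0//.
Qed.

(** Stewart's inequality for the point [c s] and the vertex [c' t], followed by
    the one for the point [c' s] and the vertex [c s]. Both are equalities in the
    hyperbolic plane, where the result says that the law of cosines gives the
    same angle at the common origin for the times [s] and [t]. *)
Lemma geodesic_divergence c c' s t : c 0 = c' 0 ->
  geodesic_on `[0, t] c -> geodesic_on `[0, t] c' -> 0 <= s <= t ->
  sinh t ^+ 2 * (cosh (mdist (c s) (c' s)) - 1) <=
  sinh s ^+ 2 * (cosh (mdist (c t) (c' t)) - 1).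
Proof.
move=> cc' gc gc' /andP[s0 st]; have t0 := le_trans s0 st.
have d1 := geodesic_on0 t0 gc; have d2 := geodesic_on0 t0 gc'.
have := @stewart (c' t) _ _ _ s (geodesic_on_segment t0 gc).
have := @stewart (c s) _ _ _ s (geodesic_on_segment t0 gc').
rewrite d1 d2 cc' d2 s0 st => /(_ isT) + /(_ isT).
rewrite -cc'; have [|-> _] := geodesic_segment_dist (geodesic_on_segment t0 gc) (s := s).
  by rewrite d1 s0.
rewrite (metric_sym (c' t) (c s)) (metric_sym (c' t) (c t)) sinhB.
have := cosh2E s; have := cosh2E t; have := sinh_ge0 s0; have := sinh_ge0 t0.
move: (sinh s) (sinh t) (cosh s) (cosh t) => S T C D T0 S0 D2 C2.
move: (cosh _) (cosh _) (cosh _) => Q P K h1 h2.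
have {h1} := ler_wpM2l T0 h1; have {h2} := ler_wpM2l S0 h2.
have E : (T * C - D * S) * (T * C + D * S) = T ^+ 2 - S ^+ 2.
  by rewrite -subr_sqr !exprMn D2 C2; ring.
by rewrite -subr_ge0 => h1; rewrite -subr_ge0 => h2; nra.
Qed.

Lemma geodesic_divergence_exp c c' s t : c 0 = c' 0 ->
  geodesic_on `[0, t] c -> geodesic_on `[0, t] c' -> 0 <= s <= t -> 1 <= t ->
  cosh (mdist (c s) (c' s)) - 1 <=
  16 * sinh s ^+ 2 * expR (mdist (c t) (c' t) / 2 - t) ^+ 2.
Proof.
move=> cc' gc gc' st t1; have h := geodesic_divergence cc' gc gc' st.
have := cosh_le_expR (mdist_ge0 (c t) (c' t)).
have := expR_le_sinh t1; have := expR_gt0 t.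
have -> : expR (mdist (c t) (c' t) / 2 - t) ^+ 2 = expR (mdist (c t) (c' t)) * expR t ^- 2.
  by rewrite expRB exprMn exprVn expr2 -expRD -splitr.
move=> e0 eS C.
move: (mdist (c t) _) (mdist (c s) _) (sinh t) (expR t) (sinh s) h e0 eS C.
move=> d e T E S h E0 ET C.
have T0 : 0 < T by lra.
have -> : 16 * S ^+ 2 * (expR d * E ^- 2) = (16 * S ^+ 2 * expR d) / E ^+ 2 by ring.
rewrite ler_pdivlMr ?exprn_gt0//.
have h1 : E ^+ 2 <= 16 * T ^+ 2 by nra.
have h2 := cosh_ge1 e.
have h3 : (cosh e - 1) * E ^+ 2 <= 16 * (T ^+ 2 * (cosh e - 1)) by nra.
have h4 : S ^+ 2 * (cosh d - 1) <= S ^+ 2 * expR d.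
  by rewrite ler_wpM2l ?sqr_ge0//; lra.
by nra.
Qed.

(** The quantity [expR (d / 2 - t)] is the exponential of minus the Gromov
    product of [c t] and [c' t]: a large Gromov product forces the geodesics to
    be close at every fixed time. *)
Lemma geodesic_contraction s e : 0 <= s -> 0 < e ->
  exists2 r, 0 < r & forall c c' t, c 0 = c' 0 ->
    geodesic_on `[0, t] c -> geodesic_on `[0, t] c' -> s <= t -> 1 <= t ->
    expR (mdist (c t) (c' t) / 2 - t) <= r -> mdist (c s) (c' s) < e.
Proof.
move=> s0 e0; have ce : 0 < cosh e - 1 by rewrite subr_gt0 -cosh0 lt_cosh.
set K := 16 * sinh s ^+ 2 + 1; have K0 : 0 < K by rewrite ltr_wpDl// mulr_ge0 ?sqr_ge0.
exists (Num.min 1 ((cosh e - 1) / (2 * K))) => [|c c' t cc gc gc' st t1].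
  by rewrite lt_min ltr01 divr_gt0// mulr_gt0.
rewrite le_min ler_pdivlMr ?mulr_gt0// => /andP[x1 xK].
have s0t : 0 <= s <= t by rewrite s0.
have := geodesic_divergence_exp cc gc gc' s0t t1.
move: (expR _) (expR_gt0 (mdist (c t) (c' t) / 2 - t)) x1 xK => x x0 x1 xK h.
rewrite ltNge; apply/negP => ed; have := le_cosh (ltW e0) ed.
have : 16 * sinh s ^+ 2 * x ^+ 2 <= K * x by rewrite /K; have := sqr_ge0 (sinh s); nra.
by nra.
Qed.

Lemma geodesic_unique_on c c' t : c 0 = c' 0 -> c t = c' t ->
  geodesic_on `[0, t] c -> geodesic_on `[0, t] c' -> forall s, 0 <= s <= t ->
  c s = c' s.
Proof.
move=> cc0 cct gc gc' s st; have /andP[s0 st'] := st.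
have := le_trans s0 st'; rewrite le_eqVlt => /predU1P[t0|t0].
  by have -> : s = t by apply/le_anti; rewrite st' -t0.
have := geodesic_divergence cc0 gc gc' st.
rewrite cct mdistxx cosh0 subrr mulr0 pmulr_rle0 ?exprn_gt0 ?sinh_gt0// subr_le0 -cosh0.
by move=> /(cosh_le_inv (lexx 0)) d0; apply: mdist_positivity; apply/le_anti; rewrite d0 mdist_ge0.
Qed.

Lemma asymptotic_rays_unique c c' : c 0 = c' 0 -> geodesic_ray c ->
  geodesic_ray c' -> asymptotic c c' -> forall s, 0 <= s -> c s = c' s.
Proof.
move=> cc0 gc gc' [K cK] s s0; apply: mdist_positivity; apply/le_anti.
rewrite mdist_ge0 andbT; apply/ler_addgt0Pl => e e0; rewrite addr0; apply/ltW.
have [r r0 H] := geodesic_contraction s0 e0.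
pose t := Num.max (K / 2 - ln r) (Num.max s 1).
have [t1 ts tK] : [/\ 1 <= t, s <= t & K / 2 - ln r <= t].
  by rewrite /t !le_max !lexx !orbT.
apply: (H c c' t) => //; [exact: geodesic_ray_on..|].
have K2 : mdist (c t) (c' t) <= K by apply: cK; lra.
by rewrite -[leRHS]lnK ?posrE// ler_expR; lra.
Qed.

End cat_minus1.

(** * Geodesic rays and thin triangles *)

Section topology_complements.

Lemma ultra_fmap (T U : Type) (f : T -> U) (F : set_system T) :
  UltraFilter F -> UltraFilter (f @ F).
Proof.
move=> FU; split; first exact: fmap_proper_filter.
move=> G GF FG; apply/seteqP; split => // A GA.
have [//|FnA] := in_ultra_setVsetC (f @^-1` A) FU.
have GnA : G (~` A) by exact: FG.
by have /filter_ex[? []] : G (A `&` ~` A) by exact: filterI.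
Qed.

(** It is enough to compare a decreasing sequence of sets with the sets of a
    subbase, since finite intersections are then controlled by a maximum of
    indices. *)
Lemma nbhs_subbase (T : topologicalType) (D : set (set T)) (x : T)
    (N : nat -> set T) :
  (forall V : set T, open V ->
     exists2 F, F `<=` finI_from D id & \bigcup_(A in F) A = V) ->
  (forall m n, (m <= n)%N -> N n `<=` N m) ->
  (forall A, D A -> A x -> exists n, N n `<=` A) ->
  forall V, nbhs x V -> exists n, N n `<=` V.
Proof.
move=> opD Ndec DN V; rewrite nbhsE => -[W [/opD[F FD <-] [A FA Ax]] WV].
have [E ED EA] := FD _ FA.
suff [n Nn] : exists n, forall B, B \in E -> N n `<=` B.
  exists n => y Ny; apply: WV; exists A => //; rewrite -EA => B /= BE.
  exact: Nn Ny.
have Ex B : B \in E -> B x by move=> BE; move: Ax; rewrite -EA; exact.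
have H0 B : B \in enum_fset E -> exists n, N n `<=` B.
  by move=> BE; apply: DN; [exact/set_mem/ED|exact: Ex].
change (exists n, forall B, B \in enum_fset E -> N n `<=` B).
elim: (enum_fset E) H0 => [|B s IH] H; first by exists 0%N.
have [|n Nn] := IH; first by move=> C Cs; apply: H; rewrite inE Cs orbT.
have [m Nm] := H B (mem_head _ _).
exists (maxn m n) => C; rewrite inE => /orP[/eqP ->|Cs].
  by apply: subset_trans Nm; apply: Ndec; rewrite leq_maxl.
by apply: subset_trans (Nn _ Cs); apply: Ndec; rewrite leq_maxr.
Qed.

Lemma subbase_open (T : topologicalType) (D : set (set T)) :
  (forall F, F `<=` finI_from D id -> open (\bigcup_(A in F) A)) ->
  forall A, D A -> open A.
Proof.
move=> H A DA; rewrite -(bigcup_set1 id A); apply: H => _ ->.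
exact: finI_from1.
Qed.

End topology_complements.

Section boundary_rays.
Context {R : realType} {X : metricType R}.
Implicit Types (x y p o : X) (z : bordification X) (c : R -> X) (s t : R)
  (xi eta : boundary X).

Lemma asymptotic_sym c c' : asymptotic c c' -> asymptotic c' c.
Proof. by case=> K cK; exists K => t /cK; rewrite metric_sym. Qed.

Lemma asymptotic_trans c c' c'' :
  asymptotic c c' -> asymptotic c' c'' -> asymptotic c c''.
Proof.
move=> [K cK] [K' cK']; exists (K + K') => t t0.
by rewrite (le_trans (metric_triangle _ (c' t) _))// lerD ?cK ?cK'.
Qed.

Lemma bd_rays_geodesic xi c : bd_rays xi c -> geodesic_ray c.
Proof. by case: xi => E /= [c0 _ ->] []. Qed.

Lemma bd_rays_asymptotic xi c c' : bd_rays xi c -> bd_rays xi c' -> asymptotic c c'.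
Proof.
case: xi => E /= [c0 _ ->] [_ cc0] [_]; apply: asymptotic_trans.
exact: asymptotic_sym.
Qed.

Lemma bd_rays_closed xi c c' : bd_rays xi c -> geodesic_ray c' ->
  asymptotic c c' -> bd_rays xi c'.
Proof.
by case: xi => E /= [c0 _ ->] [_ cc0] gc' cc'; split => //; exact: asymptotic_trans cc'.
Qed.

Lemma boundary_ext xi eta : bd_rays xi = bd_rays eta -> xi = eta.
Proof.
by case: xi eta => E EP [F FP] /= EF; subst F; congr Boundary; exact: Prop_irrelevance.
Qed.

Lemma bd_rays_inj xi eta c : bd_rays xi c -> bd_rays eta c -> xi = eta.
Proof.
move=> xc ec; apply: boundary_ext; apply/seteqP; split=> c' c'E.
  exact: bd_rays_closed ec (bd_rays_geodesic c'E) (bd_rays_asymptotic xc c'E).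
exact: bd_rays_closed xc (bd_rays_geodesic c'E) (bd_rays_asymptotic ec c'E).
Qed.

Lemma boundary_of_ray c : geodesic_ray c -> exists xi, bd_rays xi c.
Proof.
move=> gc; have P : exists2 c0, geodesic_ray c0 &
    [set c' | geodesic_ray c' /\ asymptotic c c'] =
    [set c' | geodesic_ray c' /\ asymptotic c0 c'] by exists c.
by exists (Boundary P); split => //; exists 0 => t; rewrite mdistxx.
Qed.

Lemma bd_rays_nonempty xi : exists c, bd_rays xi c.
Proof.
case: xi => E /= [c0 gc0 ->]; exists c0; split => //.
by exists 0 => t; rewrite mdistxx.
Qed.

(** A parametrized segment is constrained only up to its length, a ray at all
    nonnegative times. *)
Definition reaches p (z : bordification X) t : Prop :=
  forall x, z = inl x -> t <= mdist p x.

Lemma towards_geodesic p z c t : geodesic_towards p z c -> reaches p z t ->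
  geodesic_on `[0, t] c.
Proof.
case: z => [x [gc _ _] /(_ _ erefl) tx|xi [xic _] _].
  by apply: geodesic_onS gc => s /=; rewrite !in_itv/= => /andP[-> /le_trans]; exact.
exact/geodesic_ray_on/bd_rays_geodesic/xic.
Qed.

Lemma towards0 p z c : geodesic_towards p z c -> c 0 = p.
Proof. by case: z => [x []|xi []]. Qed.

Lemma towards_dist p z c s t : geodesic_towards p z c -> reaches p z s ->
  reaches p z t -> 0 <= s -> 0 <= t -> mdist (c s) (c t) = `|s - t|.
Proof.
move=> pzc ps pt s0 t0; have [st|/ltW ts] := leP s t.
  by apply: (towards_geodesic pzc pt); rewrite /= in_itv/= ?s0 ?t0 ?lexx.
by apply: (towards_geodesic pzc ps); rewrite /= in_itv/= ?s0 ?t0 ?lexx.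
Qed.

Lemma towards_dist0 p z c t : geodesic_towards p z c ->
  reaches p z t -> 0 <= t -> mdist p (c t) = t.
Proof.
move=> pzc pt t0; rewrite -(towards0 pzc) geodesic_on0//.
exact: towards_geodesic pzc pt.
Qed.

Definition geodesic_image p z c : set X :=
  match z with inl x => c @` `[0, mdist p x] | inr _ => c @` `[0, +oo[ end.

Lemma geodesic_image_side p z c : geodesic_towards p z c ->
  geodesic_side (inl p) z (geodesic_image p z c).
Proof. by case: z => [x|xi] pzc; exists c. Qed.

Lemma geodesic_imageP p z c y : geodesic_image p z c y ->
  exists s, [/\ 0 <= s, reaches p z s & y = c s].
Proof.
case: z => [x|xi] /= [s]; rewrite /= in_itv/=.
  by move=> /andP[s0 sx] <-; exists s; split => // _ [<-].
by rewrite andbT => s0 <-; exists s; split.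
Qed.

Lemma mem_geodesic_image p z c s : 0 <= s -> reaches p z s ->
  geodesic_image p z c (c s).
Proof.
case: z => [x|xi] s0 ps; exists s; rewrite //= in_itv/= s0// andTb.
exact: ps.
Qed.

Lemma geodesic_segment_rev x y c : geodesic_segment x y c ->
  geodesic_segment y x (fun t => c (mdist x y - t)).
Proof.
case=> gc c0 cd; split; rewrite ?(metric_sym y x) ?subr0 ?subrr// => s t.
rewrite /= !in_itv/= => /andP[s0 sd] /andP[t0 td].
rewrite gc/= ?in_itv/= ?subr_ge0 ?sd ?td ?gerBl//.
by rewrite distrC; congr `|_|; ring.
Qed.

Lemma geodesic_side_rev (p : X) z A : geodesic_side (inl p) z A ->
  geodesic_side z (inl p) A.
Proof.
case: z => [x [c pxc ->]|//]; exists (fun t => c (mdist p x - t)).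
  exact: geodesic_segment_rev.
apply/seteqP; split => [_ [t tx <-]|_ [t tx <-]];
  exists (mdist p x - t); rewrite ?subKr//; move: tx;
  by rewrite /= !in_itv/= (metric_sym x p) subr_ge0 gerBl => /andP[-> ->].
Qed.

End boundary_rays.

Section thin.
Context {R : realType} {X : metricType R}.
Hypothesis X_cat : CAT_minus1 X.
Variable D : R.
Hypothesis D_thin : thin_triangles X D.
Implicit Types (x y p o : X) (z : bordification X) (c : R -> X) (s t : R).

(** By thinness [c t] is near a point of [c'], whose time differs from [t] by at
    most [D + d(o, p)], or near a point of the segment from [o] to [p], and then
    [t] itself is at most [D + d(o, p)]. *)
Lemma fellow_travel_base o p z c c' t :
  geodesic_towards o z c -> geodesic_towards p z c' ->
  0 <= t -> reaches o z t -> reaches p z t ->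
  mdist (c t) (c' t) <= 2 * D + 3 * mdist o p.
Proof.
move=> ozc pzc t0 ot pt; have [b opb] := X_cat.1 o p.
have [y yI yD] := D_thin (geodesic_image_side ozc)
  (geodesic_side_rev (geodesic_image_side pzc))
  (@geodesic_image_side _ _ _ (inl p) b opb) (mem_geodesic_image c t0 ot); case: yI.
- move=> /geodesic_imageP[s [s0 ps yE]]; subst y.
  have := towards_dist0 ozc ot t0; have := towards_dist0 pzc ps s0.
  have := towards_dist pzc ps pt s0 t0.
  have := metric_triangle o p (c' s); have := metric_triangle o (c' s) (c t).
  have := metric_triangle p o (c' s); have := metric_triangle o (c t) (c' s).
  have := metric_triangle (c t) (c' s) (c' t).
  have := mdist_ge0 o p.
  rewrite (metric_sym (c' s) (c t)) (metric_sym p o).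
  by have [h|h] := ger0P (s - t); lra.
- move=> /geodesic_imageP[s [s0 ps yE]]; subst y.
  have := towards_dist0 (z := inl p) opb ps s0; have := ps _ erefl.
  have := towards_dist0 ozc ot t0; have := towards_dist0 pzc pt t0.
  have := metric_triangle o (b s) (c t); have := metric_triangle (c t) o (c' t).
  have := metric_triangle o p (c' t).
  by rewrite (metric_sym (b s)) (metric_sym (c t) o); lra.
Qed.

(** By thinness [c t] is near a point of [c'], at nearly the same time, or near
    the segment from [x] to [y], and then both geodesics are about to end. *)
Lemma fellow_travel_end o x y c c' t :
  geodesic_segment o x c -> geodesic_segment o y c' ->
  0 <= t -> t <= mdist o x -> t <= mdist o y ->
  mdist (c t) (c' t) <= 2 * D + 4 * mdist x y.
Proof.
move=> oxc oyc t0 tx ty; have [b xyb] := X_cat.1 x y.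
have rx : reaches o (inl x) t by move=> _ [<-].
have ry : reaches o (inl y) t by move=> _ [<-].
have [w yI wD] := D_thin (@geodesic_image_side _ _ _ (inl x) _ oxc)
  (@geodesic_image_side _ _ _ (inl y) _ xyb)
  (@geodesic_image_side _ _ _ (inl y) _ oyc) (mem_geodesic_image c t0 rx); case: yI.
- move=> /geodesic_imageP[s [s0 ps wE]]; subst w.
  have := towards_dist0 (z := inl y) xyb ps s0; have := ps _ erefl.
  have := metric_triangle (c t) (b s) x; have := metric_triangle o x y.
  have := metric_triangle (c t) x (c' t); have := metric_triangle x y (c' t).
  have [|_] := geodesic_segment_dist oxc (s := t); first by rewrite t0.
  have [|_] := geodesic_segment_dist oyc (s := t); first by rewrite t0.
  by rewrite (metric_sym (b s) x) (metric_sym (c' t) y); lra.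
- move=> /geodesic_imageP[s [s0 ps wE]]; subst w.
  have := @towards_dist0 _ _ _ (inl x) _ _ oxc rx t0.
  have := @towards_dist0 _ _ _ (inl y) _ _ oyc ps s0.
  have := @towards_dist _ _ _ (inl y) _ _ _ oyc ps ry s0 t0.
  have := metric_triangle o (c' s) (c t); have := metric_triangle o (c t) (c' s).
  have := metric_triangle (c t) (c' s) (c' t); have := mdist_ge0 x y.
  by rewrite (metric_sym (c' s) (c t)); have [h|h] := ger0P (s - t); lra.
Qed.

End thin.

(** * The Bourdon metric *)

Section limit_ray.
Context {R : realType} {X : metricType R}.
Hypothesis X_proper : proper_space X.
Implicit Types (o x y p : X) (s t e : R).

(** Arzela-Ascoli for geodesics from a fixed point: in a proper space an
    ultrafilter on the indices makes the sequence converge at all times at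
    once. *)
Lemma limit_ray o (c : nat -> R -> X) :
  (forall n, c n 0 = o) ->
  (forall t, exists N, forall n, (N <= n)%N -> geodesic_on `[0, t] (c n)) ->
  exists c', [/\ geodesic_ray c', c' 0 = o &
    forall t e N, 0 <= t -> 0 < e ->
      exists2 n, (N <= n)%N & mdist (c n t) (c' t) < e].
Proof.
move=> c0 gc; have [U [UU FU]] := ultraFilterLemma eventually_filter.
have Uge N : U [set n | (N <= n)%N] by apply: FU; exists N.
have /choice[c' c'P] t : exists x, 0 <= t -> forall e, 0 < e ->
    U [set n | mdist (c n t) x < e].
  have [t0|] := boolP (0 <= t); last by exists o.
  have [N gN] := gc t.
  have := @X_proper o t; rewrite compact_ultra.
  move=> /(_ ((fun n => c n t) @ U) (ultra_fmap _ UU)) [|x [_ xlim]].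
    change (U [set n | mdist o (c n t) <= t]).
    apply: filterS (Uge N) => n /gN gn /=.
    by rewrite -(c0 n) geodesic_on0.
  exists x => _ e e0; have : U [set n | ball x e (c n t)].
    exact: xlim _ (nbhsx_ballx x e e0).
  by apply: filterS => n; rewrite /= ballEmdist/= metric_sym.
exists c'; split.
- move=> s t; rewrite /= !in_itv/= !andbT => s0 t0.
  apply/eqP; rewrite -subr_eq0 -normr_le0; apply/ler_addgt0Pl => e e0.
  rewrite addr0; have [N gN] := gc (Num.max s t).
  have e2 : 0 < e / 2 by rewrite divr_gt0.
  have [n [/gN gn [/= ds dt]]] := filter_ex (filterI (Uge N)
    (filterI (c'P s s0 _ e2) (c'P t t0 _ e2))).
  have := gn s t; rewrite /= !in_itv/= s0 t0 !le_max !lexx orbT => /(_ isT isT) <-.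
  have := metric_triangle (c' s) (c n s) (c' t).
  have := metric_triangle (c n s) (c n t) (c' t).
  have := metric_triangle (c n s) (c' s) (c n t).
  have := metric_triangle (c' s) (c' t) (c n t).
  rewrite (metric_sym (c' t) (c n t)) (metric_sym (c' s) (c n s)).
  by rewrite ler_norml; lra.
- apply/esym/mdist_positivity/le_anti; rewrite mdist_ge0 andbT.
  apply/ler_addgt0Pl => e e0; rewrite addr0.
  by have [n /=] := filter_ex (c'P 0 (lexx _) _ e0); rewrite c0 => /ltW.
- move=> t e N t0 e0.
  by have [n []] := filter_ex (filterI (Uge N) (c'P t t0 _ e0)); exists n.
Qed.

End limit_ray.

Section bourdon_metric.
Context {R : realType} {X : metricType R}.
Hypotheses (X_proper : proper_space X) (X_cat : CAT_minus1 X).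
Variable D : R.
Hypothesis D_thin : thin_triangles X D.
Variable o : X.
Implicit Types (x y p : X) (z : bordification X) (c : R -> X) (s t e r : R)
  (xi eta zeta : boundary X).

(** Segments from [p] to the points of a given ray subconverge to a ray, which
    is asymptotic to the given one because the segments fellow travel with it. *)
Lemma exists_ray p xi : exists c, bd_rays xi c /\ c 0 = p.
Proof.
have [c0 xic0] := bd_rays_nonempty xi; have gc0 := bd_rays_geodesic xic0.
have /choice[c cP] n := X_cat.1 p (c0 n%:R).
have len n : n%:R - mdist p (c0 0) <= mdist p (c0 n%:R).
  have := metric_triangle (c0 0) p (c0 n%:R); rewrite (metric_sym _ p).
  by rewrite geodesic_on0 ?ler0n//; [lra|exact: geodesic_ray_on].
have long t : exists N, forall n, (N <= n)%N -> t <= n%:R /\ t <= mdist p (c0 n%:R).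
  exists (Num.truncn (t + mdist p (c0 0))).+1 => n Nn.
  have := truncnS_gt (t + mdist p (c0 0)); have := len n.
  have : (Num.truncn (t + mdist p (c0 0))).+1%:R <= n%:R :> R by rewrite ler_nat.
  by have := mdist_ge0 p (c0 0); lra.
have [||c' [gc' c'0 c'lim]] := @limit_ray _ _ X_proper p c.
- by move=> n; have [] := cP n.
- move=> t; have [N NP] := long t; exists N => n /NP[_ tn].
  have [+ _ _] := cP n; apply: geodesic_onS => s /=.
  by rewrite !in_itv/= => /andP[-> /le_trans]; exact.
exists c'; split => //; apply: bd_rays_closed xic0 gc' _.
exists (2 * D + 3 * mdist (c0 0) p + 1) => t t0; have [N NP] := long t.
have [n /NP[tn tpn] dn] := c'lim t 1 N t0 ltr01.
apply: (le_trans (metric_triangle _ (c n t) _)); apply: lerD (ltW dn).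
have c0n : mdist (c0 0) (c0 n%:R) = n%:R.
  by rewrite geodesic_on0 ?ler0n//; exact: geodesic_ray_on.
apply: (fellow_travel_base X_cat D_thin (z := inl (c0 n%:R))) => //.
- by split; rewrite ?c0n//; exact: geodesic_ray_on.
- exact: cP.
- by move=> _ [<-]; rewrite c0n.
- by move=> _ [<-].
Qed.

Lemma ray_fromP p xi : bd_rays xi (ray_from p xi) /\ ray_from p xi 0 = p.
Proof.
by have [c cP] := exists_ray p xi; rewrite /ray_from; case: xgetP => [_ _ //|/(_ c)].
Qed.

Lemma ray_from_geodesic p xi : geodesic_ray (ray_from p xi).
Proof. exact: bd_rays_geodesic (ray_fromP p xi).1. Qed.

Lemma ray_from_on p xi t : geodesic_on `[0, t] (ray_from p xi).
Proof. exact/geodesic_ray_on/ray_from_geodesic. Qed.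

Lemma ray_fromE p xi c t : bd_rays xi c -> c 0 = p -> 0 <= t -> c t = ray_from p xi t.
Proof.
move=> xic c0 t0; have [xir r0] := ray_fromP p xi.
apply: (asymptotic_rays_unique X_cat) => //; rewrite ?r0//.
- exact: bd_rays_geodesic xic.
- exact: ray_from_geodesic.
- exact: bd_rays_asymptotic xic xir.
Qed.

Lemma ray_from_dist0 p xi t : 0 <= t -> mdist p (ray_from p xi t) = t.
Proof.
move=> t0; have [_ r0] := ray_fromP p xi.
by rewrite -{1}r0 geodesic_on0//; exact: ray_from_on.
Qed.

Lemma towards_unique p z c c' t : geodesic_towards p z c ->
  geodesic_towards p z c' -> 0 <= t -> reaches p z t -> c t = c' t.
Proof.
case: z => [x [gc c0 cd] [gc' c'0 c'd] t0 /(_ _ erefl) tx|xi [xic c0] [xic' c'0] t0 _].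
  by apply: (geodesic_unique_on X_cat _ _ gc gc'); rewrite ?c0 ?c'0 ?cd ?c'd ?t0.
by rewrite (ray_fromE xic c0)// (ray_fromE xic' c'0).
Qed.

Lemma exists_towards p z : exists c, geodesic_towards p z c.
Proof. by case: z => [x|xi]; [exact: X_cat.1|exact: exists_ray]. Qed.

Local Notation ray := (ray_from o).
Local Notation gap xi eta t := (expR (mdist (ray xi t) (ray eta t) / 2 - t)).

Lemma gap_nonincreasing xi eta s t : 0 <= s -> s <= t -> gap xi eta t <= gap xi eta s.
Proof.
move=> s0 st; have t0 := le_trans s0 st; rewrite ler_expR.
have := geodesic_rayE (ray_from_geodesic o xi) s0 t0.
have := geodesic_rayE (ray_from_geodesic o eta) s0 t0.
rewrite ler0_norm ?subr_le0//.
have := metric_triangle (ray xi t) (ray xi s) (ray eta t).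
have := metric_triangle (ray xi s) (ray eta s) (ray eta t).
by rewrite (metric_sym (ray xi t) (ray xi s)); lra.
Qed.

(** The Bourdon distance is the infimum of the nonincreasing function [gap];
    only this lemma and the next three refer to its definition. *)
Lemma gromov_product_bd_sup xi eta : gromov_product_bd o xi eta =
  ereal_sup [set (- ln (gap xi eta (Num.max 0 t)))%:E | t in [set: R]].
Proof.
have gpE t : 0 <= t -> gromov_product o (ray xi t) (ray eta t) = - ln (gap xi eta t).
  move=> t0; rewrite expRK /gromov_product !(metric_sym _ o) !ray_from_dist0//.
  by field.
have m0 t : 0 <= Num.max 0 t by rewrite le_max lexx.
have nd : nondecreasing_fun (fun t => (- ln (gap xi eta (Num.max 0 t)))%:E).
  move=> s t st; rewrite lee_fin lerN2 ler_ln ?posrE ?expR_gt0//.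
  by apply: gap_nonincreasing; rewrite ?m0// ge_max !le_max lexx st orbT.
apply/cvg_lim => //; apply: cvg_trans (nondecreasing_cvge nd).
apply: near_eq_cvg; near=> t; have t0 : 0 <= t by near: t; exact: nbhs_pinfty_ge.
by rewrite gpE// max_r.
Unshelve. all: by end_near. Qed.

Lemma bourdon_ge0 xi eta : 0 <= bourdon o xi eta.
Proof. by rewrite /bourdon fine_ge0// expeR_ge0. Qed.

Lemma bourdon_le_gap xi eta t : 0 <= t -> bourdon o xi eta <= gap xi eta t.
Proof.
move=> t0; rewrite /bourdon gromov_product_bd_sup; set S := (X in ereal_sup X).
have : ((- ln (gap xi eta t))%:E <= ereal_sup S)%E.
  by apply: ereal_sup_ubound; exists t => //; rewrite max_r.
case: (ereal_sup S) => [l| |] //=; rewrite ?expR_ge0// lee_fin => h.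
by rewrite -[leRHS]lnK ?posrE ?expR_gt0// ler_expR lerNl.
Qed.

Lemma gap_lt xi eta r : bourdon o xi eta < r ->
  exists2 T, 0 <= T & forall t, T <= t -> gap xi eta t < r.
Proof.
move=> br; have r0 := le_lt_trans (bourdon_ge0 xi eta) br.
suff [T T0 Tr] : exists2 T, 0 <= T & gap xi eta T < r.
  exists T => // t Tt; exact: le_lt_trans (gap_nonincreasing _ _ T0 Tt) Tr.
move: br; rewrite /bourdon gromov_product_bd_sup; set S := (X in ereal_sup X) => br.
have : ((- ln r)%:E < ereal_sup S)%E.
  have : ((- ln (gap xi eta (Num.max 0 0)))%:E <= ereal_sup S)%E.
    by apply: ereal_sup_ubound; exists 0.
  move: br; case: (ereal_sup S) => [l| |] //=; rewrite ?ltry// => lr _.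
  by rewrite lte_fin ltrNl -ltr_expR lnK.
move=> /ereal_sup_gt[_ [t _ <-]]; rewrite lte_fin ltrN2 ltr_ln ?posrE ?expR_gt0// => h.
by exists (Num.max 0 t) => //; rewrite le_max lexx.
Qed.

Lemma bourdon_le1 xi eta : bourdon o xi eta <= 1.
Proof.
apply: le_trans (bourdon_le_gap _ _ (lexx 0)) _.
by rewrite !(ray_fromP o _).2 mdistxx mul0r subrr expR0.
Qed.

Lemma bourdon_sym xi eta : bourdon o xi eta = bourdon o eta xi.
Proof.
suff H : forall xi eta, bourdon o xi eta <= bourdon o eta xi.
  by apply/le_anti; rewrite !H.
move=> {}xi {}eta; apply/ler_addgt0Pl => e e0.
have [|T T0 /(_ _ (lexx _))/ltW h] := @gap_lt eta xi (e + bourdon o eta xi).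
  by rewrite ltrDr.
by rewrite (le_trans _ h)// metric_sym bourdon_le_gap.
Qed.

Lemma bourdon_xx xi : bourdon o xi xi = 0.
Proof.
apply/le_anti; rewrite bourdon_ge0 andbT; apply/ler_addgt0Pl => e e0; rewrite addr0.
have t0 : 0 <= Num.max 0 (- ln e) by rewrite le_max lexx.
apply: le_trans (bourdon_le_gap _ _ t0) _.
rewrite mdistxx mul0r sub0r -[leRHS]lnK ?posrE// ler_expR lerNl le_max lexx.
by rewrite orbT.
Qed.

Lemma bourdon_near s e : 0 <= s -> 0 < e -> exists2 r, 0 < r &
  forall xi eta, bourdon o xi eta < r -> mdist (ray xi s) (ray eta s) < e.
Proof.
move=> s0 e0; have [r r0 H] := geodesic_contraction X_cat s0 e0.
exists r => // xi eta /gap_lt[T T0 TP].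
pose t := Num.max T (Num.max s 1).
have [tT ts t1] : [/\ T <= t, s <= t & 1 <= t] by rewrite /t !le_max !lexx !orbT.
apply: (H _ _ t) => //; rewrite ?(ray_fromP o _).2//; try exact: ray_from_on.
exact/ltW/TP.
Qed.

Lemma bourdon_eq0 xi eta : bourdon o xi eta = 0 -> xi = eta.
Proof.
move=> b0; have [xir _] := ray_fromP o xi; have [etar _] := ray_fromP o eta.
apply: (bd_rays_inj xir); apply: bd_rays_closed etar (ray_from_geodesic o xi) _.
exists 1 => t t0; have [r r0 H] := bourdon_near t0 ltr01.
by apply/ltW/H; rewrite bourdon_sym b0.
Qed.

(** Put [e = expR (- s)] and [k = e^-1 - e]. Stewart's inequality on [y], as [t]
    goes to infinity, bounds [expR (d(x t, y s) - t)] by [e + k a^2] and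
    [expR (d(z t, y s) - t)] by [e + k b^2], so that the broken geodesic from
    [x t] to [z t] through [y s] gives [w^2 <= (e + k a^2) (e + k b^2)]. For
    [e^2 = a b] the right-hand side is at most [(a + b)^2]. *)
Lemma gap_triangle (x y z : R -> X) (a b w T : R) :
  geodesic_ray x -> geodesic_ray y -> geodesic_ray z ->
  x 0 = y 0 -> z 0 = y 0 -> 0 < a -> 0 < b -> a + b < 1 -> 0 <= w ->
  (forall t, T <= t -> expR (mdist (x t) (y t) / 2 - t) <= a) ->
  (forall t, T <= t -> expR (mdist (z t) (y t) / 2 - t) <= b) ->
  (forall t, T <= t -> w <= expR (mdist (x t) (z t) / 2 - t)) -> w <= a + b.
Proof.
move=> gx gy gz xy0 zy0 a0 b0 ab1 w0 xya zyb xzw.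
(* The minimum of the product of the two bounds over [e] is at
   [e^2 = a b / sqrt ((1 - a^2) (1 - b^2))] up to lower order; dropping the
   square root keeps enough precision and makes the final identity polynomial. *)
pose e : R := Num.sqrt (a * b).
have e2 : e ^+ 2 = a * b by rewrite sqr_sqrtr// mulr_ge0// ltW.
have e0 : 0 < e by rewrite sqrtr_gt0 mulr_gt0.
have e1 : e < 1 by nra.
pose s : R := - ln e; have s0 : 0 <= s by rewrite oppr_ge0 ln_le0// ltW.
pose k : R := e^-1 - e; have k0 : 0 < k.
  by rewrite subr_gt0 (lt_trans e1)// invf_gt1.
have eE : expR s = e^-1 by rewrite expRN lnK.
clearbody s e.
have side (u : R -> X) (v t : R) : geodesic_ray u -> u 0 = y 0 -> 0 < v ->
    0 < t -> s <= t -> expR (mdist (u t) (y t) / 2 - t) <= v ->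
    expR (mdist (u t) (y s)) * (1 - expR (- t) ^+ 2) <=
    expR t * (e + k * (v ^+ 2 + expR (- t) ^+ 2)).
  move=> gu u0 v0 t0 st uv; have t0' := ltW t0.
  have dy := geodesic_on0 t0' (geodesic_ray_on gy).
  have du := geodesic_on0 t0' (geodesic_ray_on gu).
  have := @stewart _ _ X_cat (u t) _ _ _ s (geodesic_on_segment t0' (geodesic_ray_on gy)).
  rewrite dy -u0 du s0 st => /(_ isT).
  have : expR (mdist (u t) (y t)) <= (v * expR t) ^+ 2.
    rewrite -[mdist _ _](@divfK _ 2)// mulr_natr mulr2n expRD -expr2.
    rewrite lerXn2r ?nnegrE ?expR_ge0 ?mulr_ge0 ?expR_ge0 ?(ltW v0)//.
    by rewrite -ler_pdivrMr ?expR_gt0// -expRB.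
  have := expR_le_cosh (mdist (u t) (y s)).
  have : cosh (mdist (u t) (y t)) <= (expR (mdist (u t) (y t)) + 1) / 2.
    by rewrite /cosh ler_pM2r// lerD2l -expR0 ler_expR oppr_le0 mdist_ge0.
  move: (cosh (mdist (u t) (y t))) (cosh (mdist (u t) (y s))) => C C'.
  move: (expR (mdist (u t) (y t))) (expR (mdist (u t) (y s))) => P P'.
  rewrite /sinh /cosh opprB !expRB eE !expRN eE invrK.
  have : 1 < expR t by rewrite expR_gt1.
  move: (expR t) => E E1 CP P'C PE h.
  have E0 : 0 < E by lra.
  have {h} : P' * ((E - E^-1) / 2) <=
      2 * ((E * e - e^-1 / E) / 2 * ((E + E^-1) / 2) + (e^-1 - e) / 2 * C).
    apply: le_trans (ler_wpM2l (ler0n R 2) h); rewrite [leRHS]mulrA ler_wpM2r//.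
    by rewrite divr_ge0// subr_ge0 (le_trans _ (ltW E1))// invf_le1// ltW.
  rewrite -/k.
  have -> : E * e - e^-1 / E = E * e - (e + k) * E^-1 by rewrite /k; congr (_ - _); ring.
  have : k * C <= k * (((v * E) ^+ 2 + 1) / 2).
    by rewrite ler_wpM2l// ?(ltW k0)//; lra.
  have : 0 < E^-1 by rewrite invr_gt0.
  have : E * E^-1 = 1 by rewrite divff// gt_eqF.
  move: (E^-1) => F EF F0 kC h.
  have -> : P' * (1 - F ^+ 2) = (P' * ((E - F) / 2)) * (2 * F) 
    by transitivity (P' * (E * F - F ^+ 2)); [rewrite EF|field].
  have F2 : 0 <= 2 * F by lra.
  apply: (le_trans (ler_wpM2r F2 h)).
  have -> : E * (e + k * (v ^+ 2 + F ^+ 2)) = (E ^+ 2 * e + k * ((v * E) ^+ 2 + 1)) * F.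
    transitivity (E * e + k * (v ^+ 2 * E + F)).
      transitivity (E * e + k * (v ^+ 2 * E + E * F * F)); first ring.
      by rewrite EF mul1r.
    transitivity (E * (E * F) * e + k * (v ^+ 2 * (E * (E * F)) + F)); last ring.
    by rewrite EF mulr1.
  rewrite (mulrA _ 2 F); apply: ler_wpM2r; first exact: ltW.
  have -> : (E * e - (e + k) * F) / 2 * ((E + F) / 2) =
    (E ^+ 2 * e + e * (E * F) - (e + k) * (E * F) - (e + k) * F ^+ 2) / 4.
    by field.
  rewrite EF; have : 0 <= (e + k) * F ^+ 2 by rewrite mulr_ge0 ?sqr_ge0//; lra.
  by lra.
have ab0 : 0 < a * b by rewrite mulr_gt0.
have ab1' : a * b < 1 by nra.
pose d t : R := expR (- t) ^+ 2.
(* The two bounds at a finite time [t], with error terms [d t = expR (- 2 t)]. *)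
have main t : T <= t -> s <= t -> 0 < t ->
    w ^+ 2 * (1 - d t) ^+ 2 <= (e + k * (a ^+ 2 + d t)) * (e + k * (b ^+ 2 + d t)).
  move=> Tt st t0.
  have h1 := side x a t gx xy0 a0 t0 st (xya t Tt).
  have h2 := side z b t gz zy0 b0 t0 st (zyb t Tt).
  have h3 : w ^+ 2 * expR t ^+ 2 <= expR (mdist (x t) (y s)) * expR (mdist (z t) (y s)).
    rewrite -exprMn -expRD (le_trans (y := expR (mdist (x t) (z t))))//.
      rewrite -[mdist (x t) (z t)](@divfK _ 2)// mulr_natr mulr2n expRD -expr2.
      rewrite lerXn2r ?nnegrE ?expR_ge0 ?mulr_ge0 ?expR_ge0//.
      by rewrite -ler_pdivlMr ?expR_gt0// -expRB xzw.
    by rewrite ler_expR (metric_sym (z t)) metric_triangle.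
  have d1 : 0 <= 1 - d t.
    by rewrite subr_ge0 expr_le1 ?expR_ge0 ?expR_le1 ?oppr_le0 ?(ltW t0).
  have := ler_pM (mulr_ge0 (expR_ge0 _) d1) (mulr_ge0 (expR_ge0 _) d1) h1 h2.
  rewrite -/(d t) mulrACA -[in X in _ <= X -> _]mulrACA -!expr2 => h4.
  have E0 : 0 < expR t ^+ 2 by rewrite exprn_gt0 ?expR_gt0.
  rewrite -(ler_pM2l E0); apply: le_trans h4.
  by rewrite mulrCA mulrA ler_wpM2r ?sqr_ge0.
rewrite leNgt; apply/negP => abw.
pose P := e + k * a ^+ 2; pose Q := e + k * b ^+ 2.
have PQ : P * Q <= (a + b) ^+ 2.
  rewrite -(ler_pM2l ab0) -{1}e2 expr2.
  have -> : e * e * (P * Q) = (e ^+ 2 + (1 - e ^+ 2) * a ^+ 2) * (e ^+ 2 + (1 - e ^+ 2) * b ^+ 2).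
    by rewrite /P /Q /k; field; rewrite gt_eqF.
  rewrite e2 -subr_ge0.
  have -> : a * b * (a + b) ^+ 2 - (a * b + (1 - a * b) * a ^+ 2) * (a * b + (1 - a * b) * b ^+ 2)
    = (a * b) ^+ 2 * (a ^+ 2 + b ^+ 2 + a * b * (2 - a * b)) by ring.
  by rewrite mulr_ge0 ?sqr_ge0// !addr_ge0 ?sqr_ge0// mulr_ge0 ?(ltW ab0)//; lra.
have g0 : 0 < w ^+ 2 - P * Q by nra.
pose C := 2 * w ^+ 2 + k * (P + Q) + k ^+ 2 + 1.
have P0 : 0 < P by rewrite ltr_pwDl// mulr_ge0 ?sqr_ge0// ltW.
have Q0 : 0 < Q by rewrite ltr_pwDl// mulr_ge0 ?sqr_ge0// ltW.
have C0 : 0 < C.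
  have := sqr_ge0 w; have := sqr_ge0 k.
  have : 0 < k * (P + Q) by rewrite mulr_gt0// addr_gt0.
  by rewrite /C; lra.
pose r := (w ^+ 2 - P * Q) / (2 * C); have r0 : 0 < r by rewrite divr_gt0 ?mulr_gt0.
pose t := Num.max T (Num.max s (Num.max 1 (- ln r))).
have [tT ts t1 tr] : [/\ T <= t, s <= t, 1 <= t & - ln r <= t].
  by rewrite /t !le_max !lexx !orbT.
have t0 : 0 < t by lra.
have := main t tT ts t0.
have d1 : expR (- t) < 1 by rewrite expR_lt1 oppr_lt0.
have dr : expR (- t) <= r by rewrite -[leRHS]lnK ?posrE// ler_expR lerNl.
have d0 := expR_gt0 (- t).
have {dr} dr : d t <= r by rewrite /d; nra.
have {d1} d1 : d t < 1 by rewrite /d; nra.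
have {d0} d0 : 0 < d t by rewrite exprn_gt0.
have rC : r * (2 * C) = w ^+ 2 - P * Q by rewrite divfK// gt_eqF// mulr_gt0.
move: (d t) dr d1 d0 => u ur u1 u0; apply/negP; rewrite -ltNge.
have -> : (e + k * (a ^+ 2 + u)) * (e + k * (b ^+ 2 + u)) =
  P * Q + k * (P + Q) * u + k ^+ 2 * (u * u) by rewrite /P /Q; ring.
have uu : u * u <= u by nra.
have kk : k ^+ 2 * (u * u) <= k ^+ 2 * u by rewrite ler_wpM2l ?sqr_ge0.
have uC : u * (2 * C) <= w ^+ 2 - P * Q.
  by rewrite -rC ler_wpM2r// mulr_ge0// ltW.
have Cu : 0 < C * u by rewrite mulr_gt0.
have ww : 0 <= w ^+ 2 * (u * u) by rewrite -expr2 -exprMn sqr_ge0.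
have CE : C * u = 2 * w ^+ 2 * u + k * (P + Q) * u + k ^+ 2 * u + u by rewrite /C; ring.
have -> : w ^+ 2 * (1 - u) ^+ 2 = w ^+ 2 - 2 * w ^+ 2 * u + w ^+ 2 * (u * u) by ring.
by lra.
Qed.

Lemma bourdon_triangle xi eta zeta :
  bourdon o xi zeta <= bourdon o xi eta + bourdon o eta zeta.
Proof.
have [|lt1] := leP 1 (bourdon o xi eta + bourdon o eta zeta).
  exact/le_trans/bourdon_le1.
apply/ler_addgt0Pl => e e0; rewrite addrC.
pose r := Num.min e ((1 - (bourdon o xi eta + bourdon o eta zeta)) / 2).
have r0 : 0 < r by rewrite lt_min e0 divr_gt0// subr_gt0.
have rr : r <= (1 - (bourdon o xi eta + bourdon o eta zeta)) / 2 by rewrite ge_min lexx orbT.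
have re : r <= e by rewrite ge_min lexx.
have := bourdon_ge0 xi eta; have := bourdon_ge0 eta zeta => b2 b1.
have [|T1 T10 H1] := @gap_lt xi eta (bourdon o xi eta + r / 2); first by lra.
have [|T2 T20 H2] := @gap_lt zeta eta (bourdon o eta zeta + r / 2).
  by rewrite bourdon_sym; lra.
apply: (@le_trans _ _ ((bourdon o xi eta + r / 2) + (bourdon o eta zeta + r / 2))); last by lra.
apply: (@gap_triangle (ray xi) (ray eta) (ray zeta) _ _ _ (Num.max T1 T2));
  rewrite ?(ray_fromP o _).2 ?bourdon_ge0//; try exact: ray_from_geodesic; try lra.
- by move=> t; rewrite ge_max => /andP[/H1/ltW].
- by move=> t; rewrite ge_max => /andP[_ /H2/ltW].
- by move=> t; rewrite ge_max => /andP[t1 _]; rewrite bourdon_le_gap// (le_trans T10).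
Qed.

End bourdon_metric.

(** * The cone topology seen from the base point *)

Section cone_topology.
Context {R : realType} {X : metricType R}.
Hypotheses (X_proper : proper_space X) (X_cat : CAT_minus1 X).
Variable D : R.
Hypothesis D_thin : thin_triangles X D.
Variable o : X.
Implicit Types (x y p : X) (z : bordification X) (c : R -> X) (s t e r K : R)
  (xi eta zeta : boundary X).

Local Notation ray := (ray_from o).

Let fromP p xi := ray_fromP X_proper X_cat D_thin p xi.
Let from_on p xi t : geodesic_on `[0, t] (ray_from p xi) :=
  ray_from_on X_proper X_cat D_thin p xi (t:=t).

Lemma geodesic_divergence_le c c' s t : c 0 = c' 0 ->
  geodesic_on `[0, t] c -> geodesic_on `[0, t] c' -> 0 <= s <= t ->
  mdist (c s) (c' s) <= mdist (c t) (c' t).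
Proof.
move=> cc0 gc gc' st; have /andP[s0 st'] := st.
have := le_trans s0 st'; rewrite le_eqVlt => /predU1P[t0|t0].
  by have -> : s = t by apply/le_anti; rewrite st' -t0.
apply: cosh_le_inv; first exact: mdist_ge0.
have := geodesic_divergence X_cat cc0 gc gc' st.
have S0 := sinh_ge0 s0; have T0 := sinh_gt0 t0.
have ST : sinh s <= sinh t.
  rewrite /sinh ler_pM2r// lerD ?lerN2 ?ler_expR//; lra.
have : 0 <= cosh (mdist (c t) (c' t)) - 1 by rewrite subr_ge0 cosh_ge1.
have SS : sinh s ^+ 2 <= sinh t ^+ 2 by rewrite lerXn2r ?nnegrE// ltW.
move=> /(ler_wpM2r)/(_ _ _ SS) h1 h2.
by have := le_trans h2 h1; rewrite ler_pM2l ?exprn_gt0// lerD2r.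
Qed.

Lemma open_cone_nbhs c r e : geodesic_ray c -> 0 < r -> 0 < e ->
  open (cone_nbhs c r e).
Proof.
move=> gc r0 e0; apply: (subbase_open (D := @cone_subbase _ X)).
  by move=> F FD; exists F.
by right; exists c, r, e.
Qed.

(** Neighbourhoods of [xi] based at [o], indexed by the natural numbers so that
    they decrease. *)
Definition cone_basis xi (n : nat) : set (bordification X) :=
  cone_nbhs (ray xi) n.+1%:R 1.

Lemma nbhs_cone_basis xi n : nbhs (inr xi : bordification X) (cone_basis xi n).
Proof.
apply: open_nbhs_nbhs; split.
  by apply: open_cone_nbhs => //; exact: (ray_from_geodesic X_proper X_cat D_thin).
split=> //; exists (ray xi); last by rewrite mdistxx.
by have [rxi r0] := fromP o xi; rewrite r0.
Qed.

Lemma cone_basisP xi n z : cone_basis xi n z <->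
  (forall x, z = inl x -> n.+1%:R < mdist o x) /\
  forall c, geodesic_towards o z c -> mdist (c n.+1%:R) (ray xi n.+1%:R) < 1.
Proof.
rewrite /cone_basis /cone_nbhs /= (fromP o xi).2; split=> -[zx H]; split => //.
  move=> c zc; have [c' zc' c'1] := H.
  rewrite (towards_unique X_proper X_cat D_thin zc zc')// => x /zx; exact: ltW.
have [c zc] := exists_towards X_proper X_cat D_thin o z.
by exists c => //; exact: H.
Qed.

Lemma cone_basis_dist xi n z c t : cone_basis xi n z -> geodesic_towards o z c ->
  0 <= t <= n.+1%:R -> mdist (c t) (ray xi t) < 1.
Proof.
move=> /cone_basisP[zx H] zc tn; apply: le_lt_trans (H _ zc).
apply: geodesic_divergence_le => //; first by rewrite (towards0 zc) (fromP o xi).2.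
by apply: towards_geodesic zc _ => x /zx/ltW.
Qed.

Lemma cone_basis_le xi m n : (m <= n)%N -> cone_basis xi n `<=` cone_basis xi m.
Proof.
move=> mn z zn; have mnR : m.+1%:R <= n.+1%:R :> R by rewrite ler_nat ltnS.
apply/cone_basisP; split=> [x zx|c zc].
  by have /cone_basisP[H _] := zn; exact: le_lt_trans (H _ zx).
by apply: cone_basis_dist zn zc _; rewrite mnR ler0n.
Qed.

(** Base change: geodesics from [o] and from [p] to a common end point fellow
    travel, and closeness at a late time forces closeness at a fixed time, so
    neighbourhoods with base point [p] contain ones with base point [o]. *)
Lemma nbhs_bordification xi (V : set (bordification X)) :
  nbhs (inr xi : bordification X) V -> exists n, cone_basis xi n `<=` V.
Proof.
apply: (nbhs_subbase (D := @cone_subbase _ X)).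
- by move=> W [F FD <-]; exists F.
- exact: cone_basis_le.
move=> W [[? _ ->] [x _ //]|[c [r [e [gc r0 e0 ->]]]] [_ [c' [xic' c'0] c'e]]].
set p := c 0 in c'0 *.
have e'0 : 0 < e - mdist (c' r) (c r) by rewrite subr_gt0.
have [d d0 H] := geodesic_contraction X_cat (ltW r0) e'0.
pose K := 2 * (2 * D + 3 * mdist o p) + 1.
pose M := Num.max (r + 1) (K / 2 - ln d).
have Mr : r + 1 <= M by rewrite le_max lexx.
have MK : K / 2 - ln d <= M by rewrite le_max lexx orbT.
pose n := Num.truncn (M + mdist o p).
have nM : M + mdist o p < n.+1%:R by exact: truncnS_gt.
have op0 := mdist_ge0 o p.
pose t := n.+1%:R - mdist o p.
have [t0 tM] : 0 <= t /\ M < t by rewrite /t; split; lra.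
have tn : 0 <= t <= n.+1%:R by rewrite t0 /t; lra.
exists n => z zn; have /cone_basisP[zx _] := zn.
have [c1 zc1] := exists_towards X_proper X_cat D_thin o z.
have [c2 zc2] := exists_towards X_proper X_cat D_thin p z.
have oz : reaches o z t.
  by move=> x /zx; rewrite /t; lra.
have pz : reaches p z t.
  by move=> x /zx; rewrite /t; have := metric_triangle o p x; lra.
have h1 := fellow_travel_base X_cat D_thin zc1 zc2 t0 oz pz.
have h2 := fellow_travel_base X_cat D_thin (z := inr xi) (fromP o xi)
  (conj xic' c'0) t0 (fun _ => ltac:(discriminate)) (fun _ => ltac:(discriminate)).
have h3 := cone_basis_dist zn zc1 tn.
have {h1 h2 h3} close : mdist (c2 t) (c' t) <= K.
  have := metric_triangle (c2 t) (c1 t) (c' t).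
  have := metric_triangle (c1 t) (ray xi t) (c' t).
  by rewrite (metric_sym (c2 t) (c1 t)) /K; lra.
split=> [x zE|]; first by have := pz _ zE; lra.
exists c2 => //.
have : mdist (c2 r) (c' r) < e - mdist (c' r) (c r).
  apply: (H c2 c' t); rewrite ?(towards0 zc2)//; try lra.
  - exact: towards_geodesic zc2 pz.
  - exact/geodesic_ray_on/bd_rays_geodesic/xic'.
  - by rewrite -[leRHS]lnK ?posrE// ler_expR; lra.
by have := metric_triangle (c2 r) (c' r) (c r); lra.
Qed.

Lemma cone_basis_boundary zeta n : exists2 r, 0 < r &
  forall eta, bourdon o zeta eta < r -> cone_basis zeta n (inr eta).
Proof.
have [r r0 H] := bourdon_near X_proper X_cat D_thin o (ler0n _ n.+1) (@ltr01 R).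
exists r => // eta xe; apply/cone_basisP; split => // c [etac c0].
rewrite (ray_fromE X_proper X_cat D_thin etac c0)// metric_sym; exact: H.
Qed.

Lemma nbhs_boundary xi (V : set (boundary X)) : nbhs xi V ->
  exists2 r, 0 < r & forall eta, bourdon o xi eta < r -> V eta.
Proof.
rewrite nbhsE => -[_ [[W oW <-] Wxi] WV].
have [n nW] : exists n, cone_basis xi n `<=` W.
  by apply: nbhs_bordification; apply: open_nbhs_nbhs.
have [r r0 H] := cone_basis_boundary xi n.
by exists r => // eta /H/nW/WV.
Qed.

Lemma nbhs_bourdon xi r : 0 < r -> nbhs xi [set eta | bourdon o xi eta < r].
Proof.
move=> r0; pose n := Num.truncn (Num.max 0 (1 / 2 - ln r)).
have nr : 1 / 2 - ln r < n.+1%:R.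
  by apply: le_lt_trans (truncnS_gt _); rewrite le_max lexx orbT.
have [W [oW Wxi] Wn] : exists2 W, open_nbhs (inr xi : bordification X) W &
    W `<=` cone_basis xi n.
  by have := nbhs_cone_basis xi n; rewrite nbhsE.
rewrite nbhsE; exists (inr @^-1` W); first by split => //; exists W.
move=> eta /Wn/cone_basisP[_ /(_ _ (fromP o eta)) h].
apply: le_lt_trans (bourdon_le_gap X_proper X_cat D_thin _ _ _ (ler0n _ n.+1)) _.
by rewrite -[ltRHS]lnK ?posrE// ltr_expR metric_sym; lra.
Qed.

Lemma isom_bord_cone_nbhs (f : isom X) (c : R -> X) (r d : R) (z : bordification X) :
  cone_nbhs (isom_inv f \o c) r d z -> cone_nbhs c r d (isom_bord f z).
Proof.
have fD x y : mdist (isom_inv f x) y = mdist x (f y).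
  by rewrite -(isom_mdist f) isom_inv_funK.
move=> [zx [c' zc' c'r]]; split.
  case: z zx {zc'} => [y /(_ _ erefl)|//] yr x [<-].
  by move: yr; rewrite /= fD.
exists (f \o c'); last by move: c'r; rewrite -(isom_mdist f) /= isom_inv_funK.
case: z zc' {zx} => [x [gc' c'0 c'x]|eta [etac c'0]] /=.
  split => /=; rewrite ?c'0 ?isom_inv_funK// -fD ?c'x//.
  by move=> s t s0 t0; rewrite isom_mdist; exact: gc'.
by split; [exists c'|rewrite /= c'0 isom_inv_funK].
Qed.

(** The preimage of a set of the subbase under an isometry is again a set of the
    subbase, with another base point. *)
Lemma isom_bord_cone_basis (f : isom X) zeta n : exists m, forall z,
  cone_basis zeta m z -> cone_basis (isom_bd f zeta) n (isom_bord f z).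
Proof.
have fK x : isom_inv_fun f (f x) = x by apply: (@isom_inj _ _ f); rewrite isom_inv_funK.
set c := ray (isom_bd f zeta).
have [[c' zc' c'E] c0] := fromP o (isom_bd f zeta).
have cc' : isom_inv f \o c = c' by rewrite /c -c'E; apply/funext => t /=; rewrite fK.
have gc' := bd_rays_geodesic zc'.
have nb : nbhs (inr zeta : bordification X) (cone_nbhs (isom_inv f \o c) n.+1%:R 1).
  apply: open_nbhs_nbhs; split; first by rewrite cc'; exact: open_cone_nbhs.
  by split=> //; exists c'; rewrite ?cc' ?mdistxx.
have [m mP] := nbhs_bordification nb.
by exists m => z /mP; exact: isom_bord_cone_nbhs.
Qed.

Lemma closure_bourdon (A : set (boundary X)) xi : closure A xi <->
  forall r, 0 < r -> exists2 eta, A eta & bourdon o xi eta < r.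
Proof.
split=> [clA r r0|H V /nbhs_boundary[r r0 rV]].
  by have [eta [Aeta h]] := clA _ (nbhs_bourdon xi r0); exists eta.
by have [eta Aeta /rV Veta] := H r r0; exists eta.
Qed.

Lemma bourdon_eq_small xi eta : (forall r, 0 < r -> bourdon o xi eta <= r) -> xi = eta.
Proof.
move=> H; apply: (bourdon_eq0 X_proper X_cat D_thin (o := o)); apply/le_anti.
by rewrite bourdon_ge0 andbT; apply/ler_addgt0Pl => e e0; rewrite addr0 H.
Qed.

Lemma expR_small (K e : R) : 0 < e -> exists n : nat, expR (K - n%:R) < e.
Proof.
move=> e0; exists (Num.truncn (Num.max 0 (K - ln e))).+1.
rewrite -[ltRHS]lnK ?posrE// ltr_expR.
have := truncnS_gt (Num.max 0 (K - ln e)).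
have : K - ln e <= Num.max 0 (K - ln e) by rewrite le_max lexx orbT.
by lra.
Qed.

(** At time [n + 1] a common point [z] shows that the rays to [xi] and [eta] are
    at distance less than 2, so that [bourdon o xi eta <= expR (1 - (n + 1))]. *)
Lemma cone_basis_separates xi eta :
  (forall n, exists2 z, cone_basis xi n z & cone_basis eta n z) -> xi = eta.
Proof.
move=> H; apply: bourdon_eq_small => r r0.
have [n nr] := expR_small 1 r0; have [z z1 z2] := H n.
have [c zc] := exists_towards X_proper X_cat D_thin o z.
have h1 := cone_basisP xi n z; have h2 := cone_basisP eta n z.
have /h1[_ /(_ _ zc) d1] := z1; have /h2[_ /(_ _ zc) d2] := z2.
apply: le_trans (ltW nr); apply: le_trans (bourdon_le_gap X_proper X_cat D_thin _ _ _ (ler0n _ n.+1)) _.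
rewrite ler_expR; have := metric_triangle (ray xi n.+1%:R) (c n.+1%:R) (ray eta n.+1%:R).
by rewrite (metric_sym (ray xi _) (c _)) -natr1 in d1 d2 *; lra.
Qed.

(** The rays of a Cauchy sequence subconverge to a ray, and two rays that are
    close at time [k] have end points at distance about [expR (- k)]. *)
Lemma bourdon_complete (xi : nat -> boundary X) :
  (forall e, 0 < e -> exists N, forall m n, (N <= m)%N -> (N <= n)%N ->
     bourdon o (xi m) (xi n) < e) ->
  exists eta, forall e, 0 < e -> exists N, forall n, (N <= n)%N ->
     bourdon o (xi n) eta < e.
Proof.
move=> cauchy.
have [||c [gc c0 clim]] := @limit_ray _ _ X_proper o (fun n => ray (xi n)).
- by move=> n; exact: (fromP o _).2.
- by move=> t; exists 0%N => n _; exact: from_on.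
have [eta etac] := boundary_of_ray gc; exists eta => e e0.
have [k ke] := expR_small 1 e0.
have [r r0 H] := bourdon_near X_proper X_cat D_thin o (ler0n _ k) (@ltr01 R).
have [N NP] := cauchy r r0; exists N => n Nn.
have [m Nm dm] := clim k%:R 1 N (ler0n _ k) ltr01.
apply: le_lt_trans ke.
apply: le_trans (bourdon_le_gap X_proper X_cat D_thin _ _ _ (ler0n _ k)) _.
rewrite ler_expR -(ray_fromE X_proper X_cat D_thin etac c0)//.
have := H _ _ (NP n m Nn Nm).
have := metric_triangle (ray (xi n) k%:R) (ray (xi m) k%:R) (c k%:R).
by lra.
Qed.

Lemma shadow x eta c w K t : geodesic_segment o x c -> 0 <= w ->
  mdist x (ray eta w) <= K -> 0 <= t <= mdist o x - K ->
  mdist (c t) (ray eta t) <= 2 * D + 4 * K.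
Proof.
move=> oxc w0 xK /andP[t0 tx]; have K0 := le_trans (mdist_ge0 _ _) xK.
have ow := ray_from_dist0 X_proper X_cat D_thin o eta w0.
have tw : t <= w.
  rewrite -ow; have := metric_triangle o (ray eta w) x.
  by rewrite (metric_sym (ray eta w)); lra.
have seg : geodesic_segment o (ray eta w) (ray eta).
  by split; rewrite ?ow// ?(fromP o eta).2//; exact: from_on.
apply: le_trans (fellow_travel_end X_cat D_thin oxc seg t0 _ _) _; rewrite ?ow//; lra.
Qed.

(** The segment from [o] to [x] fellow travels with the ray to [eta] until [K]
    before its end; when [x] is far from [o] this is late enough for the
    contraction property to bring them close at time [n + 1]. *)
Lemma shadow_cone_basis xi n K : exists r B, 0 < r /\
  forall x eta w, 0 <= w -> mdist x (ray eta w) <= K -> bourdon o eta xi < r ->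
    B <= mdist o x -> cone_basis xi n (inl x).
Proof.
have h2 : 0 < 1 / 2 :> R by lra.
have [r r0 Hr] := bourdon_near X_proper X_cat D_thin o (ler0n _ n.+1) h2.
have [d d0 Hd] := geodesic_contraction X_cat (ler0n _ n.+1) h2.
exists r, (K + Num.max (n.+1%:R + 1) ((2 * D + 4 * K) / 2 - ln d)); split => //.
move=> x eta w w0 xK exi Bx; have K0 := le_trans (mdist_ge0 _ _) xK.
move: Bx; set M := Num.max _ _ => Bx.
have [M1 M2] : n.+1%:R + 1 <= M /\ (2 * D + 4 * K) / 2 - ln d <= M.
  by rewrite /M !le_max !lexx orbT.
have n0 : 0 <= n.+1%:R :> R := ler0n _ _.
apply/cone_basisP; split=> [_ [<-]|c oxc]; first lra.
have tx : 0 <= mdist o x - K <= mdist o x - K by rewrite lexx; lra.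
have h := shadow oxc w0 xK tx.
have : mdist (c n.+1%:R) (ray eta n.+1%:R) < 1 / 2.
  apply: (Hd c (ray eta) (mdist o x - K)).
  - by rewrite (fromP o eta).2 (towards0 (z := inl x) oxc).
  - by apply: (towards_geodesic (z := inl x) oxc) => _ [<-]; lra.
  - exact: from_on.
  - by lra.
  - by lra.
  - by rewrite -[leRHS]lnK ?posrE// ler_expR; lra.
have := Hr _ _ exi.
have := metric_triangle (c n.+1%:R) (ray eta n.+1%:R) (ray xi n.+1%:R).
by lra.
Qed.

(** The rays to [eta] and to [xi] both fellow travel with the segment from [o]
    to [x] until about the time [n]. *)
Lemma cone_basis_shadow K e : 0 < e -> exists n, forall xi x eta w, 0 <= w ->
  mdist x (ray eta w) <= K -> cone_basis xi n (inl x) -> bourdon o eta xi < e.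
Proof.
move=> e0; have [n ne] := expR_small ((2 * D + 4 * K + 1) / 2 + K) e0.
pose j := Num.truncn (Num.max 0 K); exists (n + j)%N => xi x eta w w0 xK xN.
have K0 := le_trans (mdist_ge0 _ _) xK.
have /cone_basisP[/(_ _ erefl) nx _] := xN.
have [c oxc] := X_cat.1 o x.
have KK : K < j.+1%:R.
  by apply: le_lt_trans (truncnS_gt _); rewrite le_max lexx orbT.
move: nx xN; rewrite -?addnS natrD => nx xN; set k := j.+1 in KK nx.
pose t : R := (n + k)%:R - K.
have tE : t = n%:R + k%:R - K by rewrite /t natrD.
have n0 : 0 <= n%:R :> R := ler0n _ _.
have t0 : 0 <= t by rewrite tE; lra.
have tx : 0 <= t <= mdist o x - K by rewrite t0 tE; lra.
have h := shadow oxc w0 xK tx.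
have h' : mdist (c t) (ray xi t) < 1.
  apply: cone_basis_dist xN (oxc : geodesic_towards o (inl x) c) _.
  by rewrite t0 -addnS natrD -/k tE; lra.
apply: le_lt_trans ne.
apply: le_trans (bourdon_le_gap X_proper X_cat D_thin _ _ _ t0) _.
rewrite ler_expR; have := metric_triangle (ray eta t) (c t) (ray xi t).
by rewrite (metric_sym (ray eta t) (c t)); lra.
Qed.

End cone_topology.

(** * Words and connectivity in the Cayley graph *)

Section cayley_graph.
Context {G : groupType} (S : {fset G}).
Hypotheses (S_sym : symmetric_set S) (S_gen : generating_set S).
Implicit Types (g h x y : G) (Q U V : set G) (r : nat -> G) (m n : nat).

Local Notation wl := (word_length S).
Local Notation adj := (cay_adj S).
Local Notation conn := (cay_connected S).

Lemma cay_adjP g h : reflect (exists2 s, s \in S & h = (g * s)%g) (adj g h).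
Proof.
apply: (iffP idP) => [gh|[s sS ->]]; last by rewrite /cay_adj mulKg.
by exists (g^-1 * h)%g => //; rewrite mulVKg.
Qed.

Lemma cay_adj_sym g h : adj g h -> adj h g.
Proof. by move=> /S_sym; rewrite invgM invgK. Qed.

Lemma is_word_cat w w' g h : is_word S w g -> is_word S w' h ->
  is_word S (w ++ w') (g * h)%g.
Proof. by move=> [aw ->] [aw' ->]; split; rewrite ?all_cat ?aw// big_cat. Qed.

Lemma word_lengthP g : (exists2 w, is_word S w g & size w = wl g) /\
  forall w, is_word S w g -> (wl g <= size w)%N.
Proof.
rewrite /word_length; case: xgetP => [n _ []//|H]; exfalso.
have ex : exists n, `[< exists2 w, is_word S w g & size w = n >].
  by have [w wg] := S_gen g; exists (size w); apply/asboolP; exists w.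
have [n /asboolP nP nmin] := find_ex_minn ex.
by apply: (H n); split => // w wg; apply: nmin; apply/asboolP; exists w.
Qed.

Lemma word_lengthM g h : (wl (g * h)%g <= wl g + wl h)%N.
Proof.
have [[w wg <-] _] := word_lengthP g; have [[w' wh <-] _] := word_lengthP h.
have [_ min] := word_lengthP (g * h)%g.
by rewrite -size_cat; apply: min; exact: is_word_cat.
Qed.

Lemma word_length1 : wl 1%g = 0%N.
Proof.
apply/eqP; rewrite -leqn0; have [_ /(_ [::])] := word_lengthP 1%g; apply.
by split => //; rewrite big_nil.
Qed.

Lemma word_length_eq0 g : wl g = 0%N -> g = 1%g.
Proof.
have [[w [_ ->] <-] _] := word_lengthP g => /size0nil ->.
by rewrite big_nil.
Qed.

Lemma word_length_gen s : s \in S -> (wl s <= 1)%N.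
Proof.
move=> sS; have [_ /(_ [:: s])] := word_lengthP s; apply.
by split; rewrite ?big_seq1//= andbT.
Qed.

Lemma word_lengthMgen g s : s \in S -> (wl (g * s)%g <= (wl g).+1)%N.
Proof.
by move=> /word_length_gen s1; rewrite (leq_trans (word_lengthM _ _))// -addn1 leq_add2l.
Qed.

Lemma finite_word_ball_nat n : finite_set [set g | (wl g <= n)%N].
Proof.
elim: n => [|n IH].
  apply: (sub_finite_set (B := [set 1%g])); last exact: finite_set1.
  by move=> g /=; rewrite leqn0 => /eqP/word_length_eq0.
apply: (sub_finite_set (B := [set 1%g] `|`
    [set (x * s)%g | x in [set g | (wl g <= n)%N] & s in [set` S]])); last first.
  by rewrite finite_setU; split; [exact: finite_set1|exact: finite_image2].
move=> g /= gn; have [[w [aw gE] sw] _] := word_lengthP g.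
elim/last_ind: w aw gE sw => [|w s _] aw gE sw; first by left; rewrite gE big_nil.
right; move: aw; rewrite all_rcons => /andP[sS aw].
exists (\big[*%g/1%g]_(s <- w) s); last by exists s => //; rewrite gE big_rcons.
have [_ /(_ w (conj aw erefl))] := word_lengthP (\big[*%g/1%g]_(s <- w) s).
move: sw gn; rewrite size_rcons => sw gn h.
by apply: leq_trans h _; rewrite -ltnS sw.
Qed.

Lemma word_ballE n : word_ball S n%:Z = [set g | (wl g <= n)%N].
Proof. by apply/seteqP; split=> g; rewrite /word_ball/= lez_nat. Qed.

Lemma finite_word_ball (k : int) : finite_set (word_ball S k).
Proof.
apply: (sub_finite_set _ (finite_word_ball_nat `|k|)) => g.
by rewrite /word_ball/=; lia.
Qed.

Lemma finite_sub_word_ball Q : finite_set Q -> exists n, Q `<=` word_ball S n%:Z.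
Proof.
move=> fQ; exists (\max_(g <- fset_set Q) wl g)%N => g Qg.
rewrite word_ballE /= (big_rem g)/= ?leq_maxl//.
by rewrite in_fset_set// mem_set.
Qed.

Lemma word_ballS (k l : int) : k <= l -> word_ball S k `<=` word_ball S l.
Proof. by move=> kl g; rewrite /word_ball/=; lia. Qed.

Lemma conn_refl Q g : ~ Q g -> conn Q g g.
Proof. by move=> Qg; split => //; exists [::]. Qed.

Lemma conn_trans Q g h x : conn Q g h -> conn Q h x -> conn Q g x.
Proof.
move=> [Qg [p pp <-]] [Qh [p' pp' <-]]; split => //; exists (p ++ p').
  by rewrite cat_path pp.
by rewrite last_cat.
Qed.

Lemma conn_step Q g h : ~ Q g -> ~ Q h -> adj g h -> conn Q g h.
Proof.
move=> Qg Qh gh; split => //; exists [:: h] => //=.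
by rewrite gh andbT; apply/negP => /set_mem.
Qed.

Lemma conn_notin Q g h : conn Q g h -> ~ Q h.
Proof.
move=> [Qg [p + <-]]; elim: p g Qg => //= y p IH g Qg /andP[/andP[_ /negP yQ]].
by apply: IH => Qy; apply/yQ/mem_set.
Qed.

Lemma conn_sym Q g h : conn Q g h -> conn Q h g.
Proof.
move=> [Qg [p + <-]]; elim: p g Qg => [|y p IH] g Qg /=; first by move=> _; exact: conn_refl.
move=> /andP[/andP[gy /negP yQ] pp]; have Qy : ~ Q y by move=> Qy; apply/yQ/mem_set.
by apply: (conn_trans (IH _ Qy pp)); apply: conn_step => //; exact: cay_adj_sym.
Qed.

Lemma connS Q Q' g h : Q `<=` Q' -> conn Q' g h -> conn Q g h.
Proof.
move=> QQ' [Qg [p pp lp]]; split; first by move=> /QQ'.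
exists p => //; apply: sub_path pp => x y /andP[-> /negP yQ] /=.
by apply/negP => /set_mem/QQ'/mem_set.
Qed.

Lemma component_conn Q U g : component S Q U -> U g -> U = [set h | conn Q g h].
Proof.
move=> [x _ ->] xg; apply/seteqP; split => h /= H.
  exact: conn_trans (conn_sym xg) H.
exact: conn_trans xg H.
Qed.

Lemma component_of Q g : ~ Q g -> component S Q [set h | conn Q g h].
Proof. by exists g. Qed.

Lemma component_notin Q U g : component S Q U -> U g -> ~ Q g.
Proof. by move=> [x _ ->] /conn_notin. Qed.

Lemma component_nonempty Q U : component S Q U -> U !=set0.
Proof. by move=> [x Qx ->]; exists x; exact: conn_refl. Qed.

Lemma component_eq Q U V g : component S Q U -> component S Q V -> U g -> V g -> U = V.
Proof. by move=> cU cV Ug Vg; rewrite (component_conn cU Ug) (component_conn cV Vg). Qed.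

Lemma componentS Q Q' U V g : Q `<=` Q' -> component S Q U -> component S Q' V ->
  U g -> V g -> V `<=` U.
Proof.
move=> QQ' cU cV Ug Vg h; rewrite (component_conn cV Vg) (component_conn cU Ug).
exact: connS.
Qed.

(** Following a path from a component to the identity, one either never meets
    [Q] or leaves the component at a neighbour of a point of [Q]. *)
Lemma finite_components Q : finite_set Q -> finite_set (component S Q).
Proof.
move=> fQ; pose T := [set 1%g] `|` [set (q * s)%g | q in Q & s in [set` S]].
have fT : finite_set T.
  by rewrite finite_setU; split; [exact: finite_set1|exact: finite_image2].
apply: (sub_finite_set (B := (fun g => [set h | conn Q g h]) @` T)); last first.
  exact: finite_image.
move=> U cU; have [g Ug] := component_nonempty cU.
suff [t Tt gt] : exists2 t, T t & conn Q g t.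
  exists t => //; rewrite (component_conn cU (g := t))//.
  by rewrite (component_conn cU Ug).
have Qg := component_notin cU Ug.
have [w [+ gw]] := S_gen (g^-1)%g.
elim: w g gw Qg {U cU Ug} => [|s w IH] g.
  rewrite big_nil => /(congr1 (fun x => x^-1)%g); rewrite /= invgK invg1 => -> Q1 _.
  by exists 1%g; [left|exact: conn_refl].
rewrite big_cons /= => gw Qg /andP[sS aw].
have gs_adj : adj g (g * s)%g by apply/cay_adjP; exists s.
have [Qgs|Qgs] := pselect (Q (g * s)%g).
  exists g; last exact: conn_refl.
  right; exists (g * s)%g => //; exists (s^-1)%g; first exact: S_sym.
  by rewrite mulgK.
have [|t Tt gt] := IH (g * s)%g _ Qgs aw.
- by rewrite invgM gw mulKg.
- by exists t => //; apply: conn_trans gt; exact: conn_step.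
Qed.

Lemma conn_uniq_path Q g h : conn Q g h -> exists p,
  [/\ path (fun x y => adj x y) g p, last g p = h, uniq (g :: p) &
      forall x, x \in g :: p -> conn Q g x].
Proof.
move=> [Qg [p pp <-]]; case/shortenP: pp => p' pp' up' _.
exists p'; split => //; first by apply: sub_path pp' => x y /andP[].
move=> x; rewrite inE => /predU1P[->|xp']; first exact: conn_refl.
split => //; case/splitPr: xp' pp' {up'} => p1 p2.
rewrite cat_path /= => /and3P[pp1 xx _]; exists (rcons p1 x).
  by rewrite rcons_path pp1.
by rewrite last_rcons.
Qed.

(** The elements [h] such that some geodesic word for [h] passes through [g]. *)
Definition word_cone g : set G := [set h | wl h = (wl g + wl (g^-1 * h)%g)%N].

Lemma word_cone1 : word_cone 1%g = setT.
Proof.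
by apply/seteqP; split => // h _; rewrite /word_cone/= word_length1 invg1 mul1g.
Qed.

Lemma word_cone_step g h : word_cone g h -> h <> g ->
  exists s, [/\ s \in S, wl (g * s)%g = (wl g).+1, word_cone (g * s)%g h &
    (wl ((g * s)^-1 * h)%g < wl (g^-1 * h)%g)%N].
Proof.
rewrite /word_cone /= => gh hg.
have [[w [aw wE] ws] _] := word_lengthP (g^-1 * h)%g.
case: w aw wE ws => [|s w].
  by rewrite big_nil => _ wE; case: hg; rewrite -[h](mulVKg g) wE mulg1.
rewrite big_cons /= => /andP[sS aw] wE ws; exists s.
have E : ((g * s)^-1 * h)%g = \big[*%g/1%g]_(s <- w) s by rewrite invgM -mulgA wE mulKg.
have [_ /(_ w (conj aw E))] := word_lengthP ((g * s)^-1 * h)%g.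
have := word_lengthMgen g sS.
have := word_lengthM (g * s)%g ((g * s)^-1 * h)%g; rewrite mulVKg.
by move=> h1 h2 h3; split => //; lia.
Qed.

(** The word length increases along a geodesic word from [g] to [h]. *)
Lemma conn_word_cone Q g h : (forall x, (wl g <= wl x)%N -> ~ Q x) ->
  word_cone g h -> conn Q g h.
Proof.
have [k] := ubnP (wl (g^-1 * h)%g); elim: k g => // k IH g kh gQ gh.
have [->|/eqP hg] := eqVneq h g; first by apply: conn_refl; exact: gQ.
have [s [sS gs gsh lt]] := word_cone_step gh hg.
have Qg : ~ Q g by exact: gQ.
have Qgs : ~ Q (g * s)%g by apply: gQ; rewrite gs.
apply: (conn_trans (h := (g * s)%g)).
  by apply: conn_step => //; apply/cay_adjP; exists s.
apply: IH => //; first by rewrite (leq_trans lt).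
by move=> x; rewrite gs => /ltnW; exact: gQ.
Qed.

(** Koenig's lemma in the tree of geodesic words: if each of the finitely many
    children of [g] missed some [A k], then the word cone of [g] would miss the
    [A k] for the largest of these indices, taken at least [word_length S g] to
    exclude [g] itself. *)
Lemma geodesic_ray_through (A : nat -> set G) :
  (forall m n, (m <= n)%N -> A n `<=` A m) ->
  (forall n, A n !=set0) ->
  (forall n h, A n h -> (n < wl h)%N) ->
  exists r, [/\ cay_ray S r, forall n, wl (r n) = n &
    forall n k, (word_cone (r n) `&` A k) !=set0].
Proof.
move=> Adec An0 Awl; pose good g := forall k, (word_cone g `&` A k) !=set0.
have good1 : good 1%g by move=> k; have [h Ah] := An0 k; exists h; rewrite word_cone1.
have step g : good g -> exists s, [/\ s \in S, wl (g * s)%g = (wl g).+1 & good (g * s)%g].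
  move=> gg; apply: contrapT => /forallNP ns.
  have /choice[K KP] s : exists k, s \in S -> wl (g * s)%g = (wl g).+1 ->
      word_cone (g * s)%g `&` A k = set0.
    have [[sS gs]|H] := pselect (s \in S /\ wl (g * s)%g = (wl g).+1); last first.
      by exists 0%N => sS gs; exfalso; apply: H.
    have /existsNP[k /set0P/negP/negPn/eqP gk] : ~ good (g * s)%g.
      by move=> good_gs; apply: (ns s).
    by exists k.
  pose k := maxn (wl g) (\max_(s <- S) K s).
  have [h [gh kh]] := gg k.
  have hg : h <> g by move=> hg; have := Awl _ _ kh; rewrite hg ltnNge leq_maxl.
  have [s [sS gs gsh _]] := word_cone_step gh hg.
  suff : (word_cone (g * s)%g `&` A (K s)) h by rewrite KP.
  split => //; apply: Adec kh; rewrite leq_max; apply/orP; right.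
  by rewrite (big_rem s)//= leq_maxl.
have /choice[f fP] (u : {g | good g}) : exists v : {g | good g},
    adj (sval u) (sval v) /\ wl (sval v) = (wl (sval u)).+1.
  case: u => g gg; have [s [sS gs ggs]] := step g gg.
  by exists (exist _ _ ggs); split => //=; apply/cay_adjP; exists s.
pose r n := sval (iter n f (exist _ _ good1)).
have wr n : wl (r n) = n.
  elim: n => [|n IH]; first exact: word_length1.
  by rewrite /r iterS (fP _).2 -/(r n) IH.
exists r; split => //; last by move=> n; exact: svalP (iter n f _).
split=> [m n /(congr1 wl)|n]; first by rewrite !wr.
exact: (fP _).1.
Qed.

End cayley_graph.

(** * Ends of the Cayley graph *)

Section ends_of_cayley_graph.
Context {G : groupType} (S : {fset G}).
Hypotheses (S_sym : symmetric_set S) (S_gen : generating_set S).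
Implicit Types (g h x y : G) (Q U V : set G) (r : nat -> G) (m n : nat) (e : ends S).

Local Notation wl := (word_length S).
Local Notation conn := (cay_connected S).

Lemma ray_leaves r Q : injective r -> finite_set Q ->
  exists n, forall m, (n <= m)%N -> ~ Q (r m).
Proof.
move=> ri fQ.
have fr : finite_set (r @^-1` Q) by apply: finite_preimage => // m n _ _ /ri.
exists (\max_(k <- fset_set (r @^-1` Q)) k).+1 => m nm Qm.
move: nm; rewrite ltnNge => /negP; apply.
by rewrite (big_rem m)/= ?leq_maxl// in_fset_set// mem_set.
Qed.

Lemma ray_component r Q : cay_ray S r -> finite_set Q ->
  exists2 U, component S Q U & has_tail_in r U.
Proof.
move=> [ri ra] fQ; have [n rn] := ray_leaves ri fQ.
exists [set h | conn Q (r n) h]; first by apply: component_of; exact: rn.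
exists n => m /subnKC <-; elim: (m - n)%N => [|k IH].
  by rewrite addn0; apply: conn_refl; exact: rn.
apply: conn_trans IH _; rewrite addnS; apply: conn_step => //; apply: rn.
  by rewrite leq_addr.
by rewrite -addnS leq_addr.
Qed.

Lemma has_tail_eq r Q U V : component S Q U -> component S Q V ->
  has_tail_in r U -> has_tail_in r V -> U = V.
Proof.
move=> cU cV [m rU] [n rV]; apply: (component_eq S_sym cU cV (g := r (maxn m n))).
  by apply: rU; rewrite leq_maxl.
by apply: rV; rewrite leq_maxr.
Qed.

Lemma ray_equiv_refl r : cay_ray S r -> ray_equiv S r r.
Proof. by move=> rr Q fQ; have [U cU rU] := ray_component rr fQ; exists U. Qed.

Lemma ray_equiv_sym r r' : ray_equiv S r r' -> ray_equiv S r' r.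
Proof. by move=> rr' Q /rr'[U [cU rU r'U]]; exists U. Qed.

Lemma ray_equiv_trans r r' r'' :
  ray_equiv S r r' -> ray_equiv S r' r'' -> ray_equiv S r r''.
Proof.
move=> rr' r'r'' Q fQ; have [U [cU rU r'U]] := rr' Q fQ.
have [V [cV r'V r''V]] := r'r'' Q fQ.
by exists U; split=> //; rewrite (has_tail_eq cU cV r'U r'V).
Qed.

Lemma end_ray e : exists2 r, cay_ray S r & end_rays e r.
Proof.
case: e => E /= [r rr ->]; exists r => //; split => //; exact: ray_equiv_refl.
Qed.

Lemma end_rays_cay_ray e r : end_rays e r -> cay_ray S r.
Proof. by case: e => E /= [r0 rr ->] []. Qed.

Lemma end_rays_equiv e r r' : end_rays e r -> end_rays e r' -> ray_equiv S r r'.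
Proof.
case: e => E /= [r0 rr ->] [_ r0r] [_]; apply: ray_equiv_trans.
exact: ray_equiv_sym.
Qed.

Lemma end_rays_closed e r r' : end_rays e r -> cay_ray S r' -> ray_equiv S r r' ->
  end_rays e r'.
Proof.
by case: e => E /= [r0 rr ->] [_ r0r] r'r rr'; split => //; exact: ray_equiv_trans rr'.
Qed.

Lemma end_of_ray r : cay_ray S r -> exists e : ends S, end_rays e r.
Proof.
move=> rr; have P : exists2 r0, cay_ray S r0 &
    [set r' | cay_ray S r' /\ ray_equiv S r r'] =
    [set r' | cay_ray S r' /\ ray_equiv S r0 r'] by exists r.
by exists (Ends P); split => //; exact: ray_equiv_refl.
Qed.

Lemma ends_ext e e' : end_rays e = end_rays e' -> e = e'.
Proof.
by case: e e' => E EP [F FP] /= EF; subst F; congr Ends; exact: Prop_irrelevance.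
Qed.

Lemma ends_eq e e' r r' : end_rays e r -> end_rays e' r' -> ray_equiv S r r' -> e = e'.
Proof.
move=> er er' rr'; apply: ends_ext; apply/seteqP; split => r'' er''.
  apply: (end_rays_closed er' (end_rays_cay_ray er'')).
  exact: ray_equiv_trans (ray_equiv_sym rr') (end_rays_equiv er er'').
apply: (end_rays_closed er (end_rays_cay_ray er'')).
exact: ray_equiv_trans rr' (end_rays_equiv er' er'').
Qed.

(** For finite [Q] this is the component of the complement of [Q] that contains
    a tail of every ray of [e]. *)
Definition end_comp Q e : set G :=
  [set g | ~ Q g /\ ends_in [set h | conn Q g h] e].

Lemma ends_in_tail Q U e r : finite_set Q -> component S Q U -> end_rays e r ->
  has_tail_in r U -> ends_in U e.
Proof.
move=> fQ cU er rU r' er'; have [V [cV rV r'V]] := end_rays_equiv er er' fQ.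
by rewrite (has_tail_eq cU cV rU rV).
Qed.

Lemma ends_in_eq Q U V e : component S Q U -> component S Q V ->
  ends_in U e -> ends_in V e -> U = V.
Proof.
move=> cU cV eU eV; have [r _ er] := end_ray e.
exact: has_tail_eq cU cV (eU r er) (eV r er).
Qed.

Lemma end_compE Q U e : finite_set Q -> component S Q U -> ends_in U e ->
  end_comp Q e = U.
Proof.
move=> fQ cU eU; apply/seteqP; split => [g [Qg ge]|g Ug].
  rewrite -(ends_in_eq (component_of S Qg) cU ge eU); exact: conn_refl.
by split; [exact: component_notin cU Ug|rewrite -(component_conn S_sym cU Ug)].
Qed.

Lemma end_compP Q e : finite_set Q ->
  component S Q (end_comp Q e) /\ ends_in (end_comp Q e) e.
Proof.
move=> fQ; have [r rr er] := end_ray e; have [U cU rU] := ray_component rr fQ.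
have eU := ends_in_tail fQ cU er rU.
by rewrite (end_compE fQ cU eU).
Qed.

Lemma end_comp_tail Q e r : finite_set Q -> end_rays e r -> has_tail_in r (end_comp Q e).
Proof. by move=> fQ er; have [_ ] := end_compP e fQ; exact. Qed.

Lemma end_comp_infinite Q e : finite_set Q -> infinite_set (end_comp Q e).
Proof.
move=> fQ fU; have [r [ri _] er] := end_ray e.
have [n rn] := ray_leaves ri fU; have [m rm] := end_comp_tail fQ er.
by apply: (rn (maxn m n)); [rewrite leq_maxr|apply: rm; rewrite leq_maxl].
Qed.

Lemma end_compS Q Q' e : Q `<=` Q' -> finite_set Q' -> end_comp Q' e `<=` end_comp Q e.
Proof.
move=> QQ' fQ'; have fQ := sub_finite_set QQ' fQ'; have [r rr er] := end_ray e.
have [m rm] := end_comp_tail fQ er; have [n rn] := end_comp_tail fQ' er.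
apply: (componentS S_sym QQ' (end_compP e fQ).1 (end_compP e fQ').1 (g := r (maxn m n))).
  by apply: rm; rewrite leq_maxl.
by apply: rn; rewrite leq_maxr.
Qed.

Lemma ends_inP Q e e' : finite_set Q ->
  ends_in (end_comp Q e) e' <-> end_comp Q e = end_comp Q e'.
Proof.
move=> fQ; split=> [ee'|->]; last exact: (end_compP e' fQ).2.
by rewrite [RHS](end_compE fQ (end_compP e fQ).1 ee').
Qed.

Lemma end_comp_eqS Q Q' e e' : Q `<=` Q' -> finite_set Q' ->
  end_comp Q' e = end_comp Q' e' -> end_comp Q e = end_comp Q e'.
Proof.
move=> QQ' fQ' E; have fQ := sub_finite_set QQ' fQ'.
have [g gU] := component_nonempty (end_compP e fQ').1.
apply: (component_eq S_sym (end_compP e fQ).1 (end_compP e' fQ).1 (g := g)).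
  exact: end_compS gU.
by apply: (end_compS QQ' fQ'); rewrite -E.
Qed.

(** Every finite set is contained in a word ball. *)
Lemma ends_separated e e' :
  (forall n, end_comp (word_ball S n%:Z) e = end_comp (word_ball S n%:Z) e') -> e = e'.
Proof.
move=> H; have [r rr er] := end_ray e; have [r' rr' er'] := end_ray e'.
apply: (ends_eq er er') => Q fQ; have [n Qn] := finite_sub_word_ball S fQ.
exists (end_comp Q e); split; first exact: (end_compP e fQ).1.
- exact: end_comp_tail.
- rewrite (end_comp_eqS Qn (finite_word_ball S_gen _) (H n)); exact: end_comp_tail.
Qed.

Lemma end_comp_level (k : int) e e' :
  (exists U, [/\ component S (word_ball S k) U, ends_in U e & ends_in U e']) <->
  end_comp (word_ball S k) e = end_comp (word_ball S k) e'.
Proof.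
have fB := finite_word_ball S_gen k; split => [[U [cU eU e'U]]|E].
  by rewrite (end_compE fB cU eU) (end_compE fB cU e'U).
exists (end_comp (word_ball S k) e); have [cU eU] := end_compP e fB.
by split => //; rewrite E; exact: (end_compP e' fB).2.
Qed.

Lemma word_ballN1 : word_ball S (-1) = set0.
Proof. by apply/seteqP; split => // g; rewrite /word_ball/=; lia. Qed.

Lemma end_comp_ballN1 e e' : end_comp (word_ball S (-1)) e = end_comp (word_ball S (-1)) e'.
Proof.
have fB := finite_word_ball S_gen (-1).
apply: (component_eq S_sym (end_compP e fB).1 (end_compP e' fB).1 (g := 1%g)).
  have [g gU] := component_nonempty (end_compP e fB).1.
  rewrite (component_conn S_sym (end_compP e fB).1 gU) /=.
  apply: conn_sym => //; apply: (conn_word_cone S_gen); first by move=> x _; rewrite word_ballN1 => -[].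
  by rewrite word_cone1.
have [g gU] := component_nonempty (end_compP e' fB).1.
rewrite (component_conn S_sym (end_compP e' fB).1 gU) /=.
apply: conn_sym => //; apply: (conn_word_cone S_gen); first by move=> x _; rewrite word_ballN1 => -[].
by rewrite word_cone1.
Qed.

Lemma end_levelP e e' : e <> e' -> -1 <= end_level e e' /\
  forall k : int, -1 <= k ->
    (end_comp (word_ball S k) e = end_comp (word_ball S k) e' <-> k <= end_level e e').
Proof.
move=> ee'; have /existsNP[n0 n0P] : ~ forall n,
    end_comp (word_ball S n%:Z) e = end_comp (word_ball S n%:Z) e'.
  by move=> /ends_separated.
(* Levels start at -1; they are shifted to search a maximum among naturals. *)
pose P n := `[< end_comp (word_ball S (n%:Z - 1)) e = end_comp (word_ball S (n%:Z - 1)) e' >].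
have fB k := finite_word_ball S_gen k.
have exP : exists n, P n by exists 0%N; apply/asboolP; rewrite sub0r; exact: end_comp_ballN1.
have bP n : P n -> (n <= n0.+1)%N.
  move=> /asboolP Pn; rewrite leqNgt; apply/negP => lt; apply: n0P.
  apply: end_comp_eqS Pn => //; apply: word_ballS; lia.
case: (ex_maxnP exP bP) => N /asboolP PN maxN.
have same (k : int) : -1 <= k -> (end_comp (word_ball S k) e = end_comp (word_ball S k) e' <->
    k <= N%:Z - 1).
  move=> k1; split => [E|kN].
    have := maxN (absz (k + 1)); have -> : P (absz (k + 1)).
      by apply/asboolP; have -> : (absz (k + 1))%:Z - 1 = k by lia.
    by move=> /(_ isT); lia.
  apply: end_comp_eqS PN => //; exact: word_ballS.
rewrite /end_level; case: xgetP => [l _ [[l1 sl] lmax]|/(_ (N%:Z - 1))]; last first.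
  move=> []; split; first by split; [lia|apply/end_comp_level].
  by move=> k [k1 /end_comp_level/(same _ k1)].
suff -> : l = N%:Z - 1 by split => //; lia.
apply/le_anti; rewrite (same _ l1).1 ?lmax//; last exact/end_comp_level.
by split; [lia|exact/end_comp_level].
Qed.

Lemma end_level_sym e e' : end_level e e' = end_level e' e.
Proof.
rewrite /end_level; congr xget; apply/funext => n; apply/propext; split => -[[n1 [U [cU eU e'U]]] H];
  (split; first by split => //; exists U);
  by move=> m [m1 [V [cV eV e'V]]]; apply: H; split => //; exists V.
Qed.

Lemma open_ends_in Q U : finite_set Q -> component S Q U -> infinite_set U ->
  open (@ends_in G S U).
Proof.
move=> fQ cU iU; apply: (subbase_open (D := @ends_base _ S)); last by exists Q, U.
by move=> F FD; exists F.
Qed.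

Lemma nbhs_ends e (V : set (ends S)) : nbhs e V <->
  exists n, ends_in (end_comp (word_ball S n%:Z) e) `<=` V.
Proof.
split=> [|[n nV]].
  apply: (nbhs_subbase (D := @ends_base _ S)).
  - by move=> W [F FD <-]; exists F.
  - move=> m n mn e' /ends_inP-/(_ (finite_word_ball S_gen _)) E.
    apply/ends_inP; first exact: finite_word_ball.
    apply: end_comp_eqS E; last exact: finite_word_ball.
    by apply: word_ballS; rewrite lez_nat.
  move=> _ [Q [U [fQ cU _ ->]]] eU; have [n Qn] := finite_sub_word_ball S fQ.
  exists n => e' /ends_inP-/(_ (finite_word_ball S_gen _)) E.
  have := end_comp_eqS Qn (finite_word_ball S_gen _) E.
  by rewrite (end_compE fQ cU eU) => ->; exact: (end_compP e' fQ).2.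
have fB := finite_word_ball S_gen n; have [cU eU] := end_compP e fB.
apply: filterS nV _; apply: open_nbhs_nbhs; split => //.
by apply: (open_ends_in fB cU); exact: end_comp_infinite fB.
Qed.

Lemma nbhs_end_compactification_vertex g (V : set (end_compactification S)) :
  V (inl g) -> nbhs (inl g : end_compactification S) V.
Proof.
move=> Vg; apply: (filterS (P := [set inl g : end_compactification S])).
  by move=> _ ->.
apply: open_nbhs_nbhs; split => //.
apply: (subbase_open (D := @end_compactification_base _ S)).
  by move=> F FD; exists F.
by left; exists g.
Qed.

Definition end_nbhs e n : set (end_compactification S) :=
  inl @` end_comp (word_ball S n%:Z) e `|` inr @` ends_in (end_comp (word_ball S n%:Z) e).

Lemma nbhs_end_nbhs e n : nbhs (inr e : end_compactification S) (end_nbhs e n).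
Proof.
have fB := finite_word_ball S_gen n; have [cU eU] := end_compP e fB.
apply: open_nbhs_nbhs; split; last by right; exists e.
apply: (subbase_open (D := @end_compactification_base _ S)).
  by move=> F FD; exists F.
by right; exists (word_ball S n%:Z), (end_comp (word_ball S n%:Z) e); split => //; exact: (end_comp_infinite (e := e) fB).
Qed.

Lemma nbhs_end_compactification e (V : set (end_compactification S)) :
  nbhs (inr e : end_compactification S) V -> exists n, end_nbhs e n `<=` V.
Proof.
have fB k := finite_word_ball S_gen k.
apply: (nbhs_subbase (D := @end_compactification_base _ S)).
- by move=> W [F FD <-]; exists F.
- move=> m n mn.
  have mnB : word_ball S m%:Z `<=` word_ball S n%:Z by apply: word_ballS; rewrite lez_nat.
  move=> _ [[g gU <-]|[e' e'U <-]]; [left|right].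
    by exists g => //; exact: end_compS gU.
  exists e' => //; apply/ends_inP => //; move/ends_inP: e'U => /(_ (fB _)).
  exact: end_comp_eqS.
move=> W [[g ->] //|[Q [U [fQ cU _ ->]]]] [[? _ //]|[e1 eU [e1E]]].
subst e1.
have [n Qn] := finite_sub_word_ball S fQ; exists n.
have EU := end_compE fQ cU eU.
move=> _ [[g gU <-]|[e' e'U <-]]; [left|right].
  by exists g => //; rewrite -EU; exact: end_compS gU.
exists e' => //; rewrite -EU; apply/ends_inP => //; move/ends_inP: e'U => /(_ (fB _)).
exact: end_comp_eqS.
Qed.

(** The vertices [r m] with [m > n] stay out of the ball of radius [n], so
    [r n.+1] lies on the side of the end, and geodesic words starting there do
    not come back either. *)
Lemma word_cone_end_comp r e n : cay_ray S r -> (forall n, wl (r n) = n) ->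
  end_rays e r -> word_cone S (r n.+1) `<=` end_comp (word_ball S n%:Z) e.
Proof.
move=> rr wr er h hc; have fB := finite_word_ball S_gen n.
have far x : (wl (r n.+1) <= wl x)%N -> ~ word_ball S n%:Z x.
  by rewrite wr word_ballE /= => nx; apply/negP; rewrite -ltnNge.
have [cU _] := end_compP e fB.
have [m rm] := end_comp_tail fB er.
suff rU : end_comp (word_ball S n%:Z) e (r n.+1).
  by rewrite (component_conn S_sym cU rU); exact: conn_word_cone.
have rM : end_comp (word_ball S n%:Z) e (r (maxn m n.+1)) by apply: rm; rewrite leq_maxl.
rewrite (component_conn S_sym cU rM); apply: conn_sym => //.
have [k ->] : exists k, maxn m n.+1 = (n.+1 + k)%N.
  by exists (maxn m n.+1 - n.+1)%N; rewrite subnKC// leq_maxr.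
elim: k => [|k IH]; first by rewrite addn0; apply: conn_refl; apply: far.
apply: conn_trans IH _; rewrite addnS; apply: conn_step; last exact: rr.2.
  by apply: far; rewrite !wr leq_addr.
by apply: far; rewrite !wr -addnS leq_addr.
Qed.

End ends_of_cayley_graph.

(** * Sums along simple paths *)

Section sums.
Context {R : realType}.

Lemma powR_subadd (q a b : R) : 0 < q <= 1 -> 0 <= a -> 0 <= b ->
  (a + b) `^ q <= a `^ q + b `^ q.
Proof.
move=> /andP[q0 q1] a0 b0; have := addr_ge0 a0 b0.
rewrite le_eqVlt => /predU1P[<-|c0].
  by rewrite powR0 ?gt_eqF// addr_ge0// powR_ge0.
have frac x : 0 <= x -> x <= a + b -> x / (a + b) * (a + b) `^ q <= x `^ q.
  rewrite le_eqVlt => /predU1P[<- _|x0 xc]; first by rewrite !mul0r powR_ge0.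
  have xc0 : 0 < x / (a + b) by rewrite divr_gt0.
  rewrite -{2}(@divfK _ (a + b) _ x) ?gt_eqF// powRM ?(ltW xc0) ?(ltW c0)//.
  by rewrite ler_wpM2r ?powR_ge0// ger1_powR// xc0 ler_pdivrMr// mul1r.
apply: le_trans (lerD (frac a a0 _) (frac b b0 _)); rewrite ?lerDl ?lerDr//.
by rewrite -!mulrDl divff ?gt_eqF// mul1r.
Qed.

Lemma le_powRV (q a b : R) : 0 < q -> 0 <= a -> 0 <= b -> a `^ q <= b -> a <= b `^ q^-1.
Proof.
move=> q0 a0 b0 ab; have -> : a = (a `^ q) `^ q^-1.
  by rewrite -powRrM divff ?gt_eqF// powRr1.
by apply: ge0_ler_powR => //; rewrite ?nnegrE ?powR_ge0 ?invr_ge0 ?(ltW q0).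
Qed.

Lemma powR_le (q a b : R) : 0 < q -> 0 <= a -> 0 <= b -> a <= b `^ q^-1 -> a `^ q <= b.
Proof.
move=> q0 a0 b0 ab; have -> : b = (b `^ q^-1) `^ q.
  by rewrite -powRrM mulVf ?gt_eqF// powRr1.
by apply: ge0_ler_powR => //; rewrite ?nnegrE ?powR_ge0// (ltW q0).
Qed.

Lemma sum_le_esum (T : choiceType) (V : set T) (s : seq T) (F : T -> R) :
  uniq s -> (forall x, x \in s -> V x) ->
  ((\sum_(x <- s) F x)%:E <= \esum_(x in V) (F x)%:E)%E.
Proof.
move=> us sV; apply: esum_ge; exists [set` s].
  by split; [exact: finite_seq|move=> x /=; exact: sV].
by rewrite -fsbig_seq// sumEFin.
Qed.

Lemma le_esum_sub (T : choiceType) (U V : set T) (F : T -> \bar R) :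
  U `<=` V -> (forall x, 0 <= F x)%E ->
  (\esum_(x in U) F x <= \esum_(x in V) F x)%E.
Proof.
move=> UV F0; rewrite (esumID U V)// setIidr//.
by rewrite leeDl// esum_ge0.
Qed.

Lemma finite_superlevel (T : choiceType) (F : T -> R) (c : R) : 0 < c ->
  (forall x, 0 <= F x) ->
  (\esum_(x in [set: T]) (F x)%:E < +oo)%E -> finite_set [set x | c <= F x].
Proof.
move=> c0 F0 fin; apply: contrapT => inf.
set s := (X in (X < _)%E) in fin.
have [v vE] : exists v, s = v%:E.
  have s0 : (0 <= s)%E by apply: esum_ge0 => x _; rewrite lee_fin.
  by move: s s0 fin => [v| |]//; exists v.
have [B Bc nB] := infinite_set_fset (Num.truncn (v / c)).+1 inf.
have : (s < s)%E; last by rewrite ltxx.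
rewrite {1}vE; apply: (@lt_le_trans _ _ (\sum_(x <- enum_fset B) F x)%:E); last first.
  exact: sum_le_esum.
rewrite lte_fin; apply: (@lt_le_trans _ _ (\sum_(x <- enum_fset B) c)); last first.
  by rewrite big_seq [leRHS]big_seq ler_sum// => x /Bc.
rewrite big_const_seq count_predT iter_addr_0 -mulr_natr mulrC -ltr_pdivrMr//.
apply: lt_le_trans (truncnS_gt _) _; rewrite ler_nat.
by move: nB; rewrite cardfE cardE.
Qed.

Lemma esum_tail (T : choiceType) (F : T -> R) (e : R) : 0 < e ->
  (forall x, 0 <= F x) -> (\esum_(x in [set: T]) (F x)%:E < +oo)%E ->
  exists2 A : set T, finite_set A &
    forall V, V `&` A = set0 -> (\esum_(x in V) (F x)%:E < e%:E)%E.
Proof.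
move=> e0 F0 fin; have F0' x : (0 <= (F x)%:E)%E by rewrite lee_fin.
have fnum : \esum_(x in [set: T]) (F x)%:E \is a fin_num.
  by rewrite ge0_fin_numE// esum_ge0.
have [_ [A [fA _] <-] ltA] := ub_ereal_sup_adherent e0 fnum.
exists A => // V VA.
have AE : \esum_(x in A) (F x)%:E = \sum_(x \in A) (F x)%:E by rewrite esum_fset.
rewrite -AE in ltA.
have Afin : \esum_(x in A) (F x)%:E \is a fin_num.
  by rewrite ge0_fin_numE ?esum_ge0//; apply: le_lt_trans fin; exact: le_esum_sub.
have : (\esum_(x in A) (F x)%:E + \esum_(x in V) (F x)%:E <= \esum_(x in [set: T]) (F x)%:E)%E.
  rewrite (esumID A setT)// setTI leeD2l// setTI; apply: le_esum_sub => //.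
  by move=> x Vx Ax; have : set0 x by rewrite -VA.
have {}ltA : (\esum_(i in [set: T]) (F i)%:E - e%:E < \esum_(x in A) (F x)%:E)%E := ltA.
have Vfin : \esum_(x in V) (F x)%:E \is a fin_num.
  by rewrite ge0_fin_numE ?esum_ge0//; apply: le_lt_trans fin; exact: le_esum_sub.
move: fnum Afin Vfin ltA => /fineK <- /fineK <- /fineK <-.
by rewrite -!EFinD lee_fin !lte_fin; lra.
Qed.

Lemma inv_nat_small (r : R) : 0 < r -> exists n : nat, n.+1%:R^-1 < r.
Proof.
move=> r0; exists (Num.truncn r^-1).
by rewrite invf_plt ?posrE// truncnS_gt.
Qed.

Lemma inv_nat_le (m n : nat) : (m <= n)%N -> n.+1%:R^-1 <= m.+1%:R^-1 :> R.
Proof. by move=> mn; rewrite lef_pV2 ?posrE// ler_nat ltnS. Qed.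

Lemma finite_subset_bound (T : choiceType) (F : set T) (f : T -> R) : finite_set F ->
  exists B, forall g, F g -> f g <= B.
Proof.
move=> fF; exists (\big[Num.max/0]_(g <- fset_set F) f g) => g Fg.
by apply: (le_bigmax_seq 0 g xpredT f) => //; rewrite in_fset_set// mem_set.
Qed.

Lemma finite_uniform_pos (T : choiceType) (I : set T) (r : T -> R) : finite_set I ->
  (forall i, I i -> 0 < r i) -> exists2 r0, 0 < r0 & forall i, I i -> r0 <= r i.
Proof.
move=> fI rI; have : forall i, i \in enum_fset (fset_set I) -> 0 < r i.
  by move=> i iI; apply/rI/set_mem; rewrite -in_fset_set.
move=> rI'; have [r0 r00 r0P] : exists2 r0, 0 < r0 &
    forall i, i \in enum_fset (fset_set I) -> r0 <= r i.
  elim: (enum_fset _) rI' => [|i s IH] H; first by exists 1.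
  have [|r0 r00 r0P] := IH; first by move=> j js; apply: H; rewrite inE js orbT.
  exists (Num.min r0 (r i)); first by rewrite lt_min r00 H ?inE ?eqxx.
  by move=> j; rewrite inE ge_min => /predU1P[->|/r0P ->//]; rewrite lexx orbT.
exists r0 => // i Ii; apply: r0P; change (i \in fset_set I).
by rewrite in_fset_set// mem_set.
Qed.

End sums.

Section word_paths.
Context {R : realType} {G : groupType} (S : {fset G}).
Variable (d : G -> G -> R).
Hypotheses (dxx : forall x, d x x = 0)
  (d_triangle : forall x y z, d x z <= d x y + d y z).

Lemma path_vertex_sum (F : G -> R) (g : G) (p : seq G) :
  (forall x y, cay_adj S x y -> d x y <= F x) ->
  path (fun x y => cay_adj S x y) g p -> d g (last g p) <= \sum_(x <- belast g p) F x.
Proof.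
move=> dF; elim: p g => [|y p IH] g /=; first by rewrite dxx big_nil.
move=> /andP[gy pp]; rewrite big_cons.
by apply: le_trans (d_triangle _ y _) _; apply: lerD; [exact: dF|exact: IH].
Qed.

Lemma path_edge_sum (F : set G -> R) (g : G) (p : seq G) :
  (forall x y, cay_adj S x y -> d x y <= F [set x; y]) ->
  path (fun x y => cay_adj S x y) g p ->
  d g (last g p) <= \sum_(e <- pairmap (fun x y => [set x; y]) g p) F e.
Proof.
move=> dF; elim: p g => [|y p IH] g /=; first by rewrite dxx big_nil.
move=> /andP[gy pp]; rewrite big_cons.
by apply: le_trans (d_triangle _ y _) _; apply: lerD; [exact: dF|exact: IH].
Qed.

Lemma mem_path_edges (g : G) (p : seq G) e :
  path (fun x y => cay_adj S x y) g p ->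
  e \in pairmap (fun x y => [set x; y]) g p ->
  exists x y, [/\ e = [set x; y], cay_adj S x y, x \in g :: p & y \in p].
Proof.
elim: p g => // y p IH g /= /andP[gy pp]; rewrite inE => /predU1P[->|ep].
  by exists g, y; rewrite !inE !eqxx.
have [x [z [-> xz xp zp]]] := IH _ pp ep; exists x, z; split => //.
  by rewrite inE xp orbT.
by rewrite inE zp orbT.
Qed.

Lemma uniq_path_edges (g : G) (p : seq G) :
  path (fun x y => cay_adj S x y) g p -> uniq (g :: p) ->
  uniq (pairmap (fun x y => [set x; y]) g p).
Proof.
elim: p g => // y p IH g /= /andP[gy pp] /andP[gp up]; rewrite IH// andbT.
apply/negP => /(mem_path_edges pp)[x [z [E _ xp zp]]].
have : [set x; z] g by rewrite -E; left.
by case=> gE; move: gp; rewrite gE ?xp// inE zp orbT.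
Qed.

End word_paths.

(** * Orbit points and their shadows at infinity *)

Section orbit.
Context {R : realType} {X : metricType R}.
Context {Gam : {pred isom X}} {G : subGroupType Gam}.
Variables (S : {fset G}) (o : X) (D : R) (xi : G -> boundary X).
Hypotheses (X_proper : proper_space X) (X_cat : CAT_minus1 X).
Hypothesis D_thin : thin_triangles X D.
Hypotheses (S_sym : symmetric_set S) (S_gen : generating_set S).
Hypothesis xi_near : forall g l, geodesic_side (inl o) (inr (xi g)) l ->
  dist_to_set ((val g : isom X) o) l <= D.
Implicit Types (g h : G) (Q U V : set G).

Local Notation act g x := ((val g : isom X) x).
Local Notation ray := (ray_from o).
Local Notation rho := (bourdon o).
Local Notation L := (max_displacement S o).

Lemma actM g h x : act (g * h)%g x = act g (act h x).
Proof. by rewrite gmulfM. Qed.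

(** Each orbit point in a ball contributes at least a fixed positive amount to
    the Poincare series. *)
Lemma finite_orbit s r : 0 < s -> (poincare_series G o s < +oo)%E ->
  finite_set [set g : G | mdist o (act g o) <= r].
Proof.
move=> s0 sfin.
have fin := @finite_superlevel R G (fun g => expR (- (s * mdist o (act g o))))
  (expR (- (s * r))) (expR_gt0 _) (fun _ => expR_ge0 _) sfin.
apply: sub_finite_set fin => g /= gr.
by rewrite ler_expR lerN2 ler_wpM2l// ltW.
Qed.

Lemma xi_shadow g e : 0 < e ->
  exists2 w, 0 <= w & mdist (act g o) (ray (xi g) w) <= D + e.
Proof.
move=> e0; have := xi_near (geodesic_image_side (z := inr (xi g))
  (ray_fromP X_proper X_cat D_thin o (xi g))).
rewrite /dist_to_set; set E := (X in inf X) => dD.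
have infE : has_inf E.
  split; last by exists 0 => _ [y _ <-]; exact: mdist_ge0.
  exists (mdist (act g o) (ray (xi g) 0)), (ray (xi g) 0) => //.
  by exists 0; rewrite //= in_itv/= lexx.
have [_ [_ [w w0 <-] <-] lt] := inf_adherent e0 infE.
exists w; first by move: w0; rewrite /= in_itv/= andbT.
by rewrite (le_trans (ltW lt))// lerD2r.
Qed.

Lemma max_displacement_ge s : s \in S -> mdist o (act s o) <= L.
Proof. by move=> sS; exact: (le_bigmax_seq 0 s xpredT (fun s : G => mdist o (act s o))). Qed.

(** The Gromov product of [xi g] and [xi h] is at least that of the points of
    their rays near [g o] and [h o], where the three distances involved are
    known up to [D]. *)
Lemma adjacent_bourdon g h : cay_adj S g h ->
  rho (xi g) (xi h) <= expR (L + 2 * D - mdist o (act g o)).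
Proof.
move=> /cay_adjP[s sS hE]; have := bourdon_ge0 o (xi g) (xi h).
rewrite le_eqVlt => /predU1P[<-|b0]; first exact: expR_ge0.
rewrite -[leLHS]lnK ?posrE// ler_expR; apply/ler_addgt0Pl => e e0.
have e2 : 0 < e / 2 by rewrite divr_gt0.
have [w w0 wD] := xi_shadow g e2; have [v v0 vD] := xi_shadow h e2.
have gh : mdist (act g o) (act h o) <= L.
  by rewrite hE actM isom_mdist max_displacement_ge.
pose t := Num.max w v.
have [tw tv] : w <= t /\ v <= t by rewrite /t !le_max !lexx orbT.
have t0 := le_trans w0 tw.
rewrite -ler_expR lnK ?posrE//.
apply: le_trans (bourdon_le_gap X_proper X_cat D_thin _ _ _ t0) _.
rewrite ler_expR.
have gx := geodesic_rayE (ray_from_geodesic X_proper X_cat D_thin o (xi g)) w0 t0.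
have gy := geodesic_rayE (ray_from_geodesic X_proper X_cat D_thin o (xi h)) v0 t0.
have ow := ray_from_dist0 X_proper X_cat D_thin o (xi g) w0.
have ov := ray_from_dist0 X_proper X_cat D_thin o (xi h) v0.
move: gx gy; rewrite !ler0_norm ?subr_le0// => gx gy.
have := metric_triangle (ray (xi g) t) (ray (xi g) w) (ray (xi h) t).
have := metric_triangle (ray (xi g) w) (ray (xi h) v) (ray (xi h) t).
have := metric_triangle (ray (xi g) w) (act g o) (ray (xi h) v).
have := metric_triangle (act g o) (act h o) (ray (xi h) v).
have := metric_triangle o (ray (xi g) w) (act g o).
have := metric_triangle o (ray (xi h) v) (act h o).
have := metric_triangle o (act h o) (act g o).
rewrite (metric_sym (ray (xi h) v) (act h o)) (metric_sym (ray (xi g) w) (act g o)).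
rewrite (metric_sym (ray (xi g) t) (ray (xi g) w)) (metric_sym (act h o) (act g o)).
by lra.
Qed.

(** Since [d(g x, g o) = d(x, o)], the orbit of any point [x] accumulating at
    [zeta] is shadowed by the points [xi g] just as the orbit of [o] is. *)
Lemma limit_set_approx zeta (F : set G) e : limit_set G zeta -> finite_set F -> 0 < e ->
  exists2 g, ~ F g & rho (xi g) zeta < e.
Proof.
move=> [x xcl] fF e0; pose K := D + 1 + mdist o x.
have [n nP] := cone_basis_shadow X_proper X_cat D_thin o K e0.
have [B BP] := finite_subset_bound (fun g => mdist o (act g x)) fF.
pose m := maxn n (Num.truncn (Num.max 0 B)).
have [_ [[g _ <-] gm]] := xcl _ (nbhs_cone_basis X_proper X_cat D_thin o zeta m).
exists g.
  move=> /BP gB; have /(cone_basisP X_proper X_cat D_thin)[/(_ _ erefl) + _] := gm.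
  rewrite ltNge => /negP; apply; apply: le_trans gB _.
  have := truncnS_gt (Num.max 0 B); have : B <= Num.max 0 B by rewrite le_max lexx orbT.
  have : (Num.truncn (Num.max 0 B)).+1%:R <= m.+1%:R :> R by rewrite ler_nat ltnS leq_maxr.
  by lra.
have [w w0 wD] := xi_shadow g (@ltr01 R).
apply: (nP zeta (act g x) (xi g) w w0).
  have := metric_triangle (act g x) (act g o) (ray (xi g) w).
  by rewrite isom_mdist (metric_sym x o) /K; lra.
exact: (cone_basis_le X_proper X_cat D_thin (leq_maxl _ _) gm).
Qed.

Lemma orbit_cone_basis zeta n : exists r B, 0 < r /\
  forall g, rho (xi g) zeta < r -> B <= mdist o (act g o) ->
    cone_basis o zeta n (inl (act g o)).
Proof.
have [r [B [r0 H]]] := shadow_cone_basis X_proper X_cat D_thin o zeta n (D + 1).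
exists r, B; split => // g gr gB; have [w w0 wD] := xi_shadow g (@ltr01 R).
exact: H w0 wD gr gB.
Qed.

Section exponent.
Variable q : R.
Hypothesis q01 : 0 < q <= 1.

Let q0 : 0 < q. Proof. by have /andP[] := q01. Qed.

Let dq g h : R := rho (xi g) (xi h) `^ q.

Let dqxx g : dq g g = 0.
Proof. by rewrite /dq (bourdon_xx X_proper X_cat D_thin) powR0 ?gt_eqF. Qed.

Let dq_triangle x y z : dq x z <= dq x y + dq y z.
Proof.
apply: le_trans (powR_subadd q01 (bourdon_ge0 _ _ _) (bourdon_ge0 _ _ _)).
apply: ge0_ler_powR; rewrite ?nnegrE ?addr_ge0 ?bourdon_ge0 ?(ltW q0)//.
exact: (bourdon_triangle X_proper X_cat D_thin).
Qed.

Local Notation decay g := (expR (- (q * mdist o (act g o)))).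

Lemma adjacent_bourdon_powR g h : cay_adj S g h ->
  dq g h <= expR (q * (L + 2 * D)) * decay g.
Proof.
move=> /adjacent_bourdon gh; rewrite -expRD -mulrBr mulrC expRM.
by apply: ge0_ler_powR; rewrite ?nnegrE ?bourdon_ge0 ?expR_ge0 ?(ltW q0).
Qed.

Lemma tail_function_ge0 (n : int) : (0 <= tail_function S o q D n)%E.
Proof.
rewrite mule_ge0 ?lee_fin ?mulr_ge0 ?expR_ge0//.
by apply: esum_ge0 => g _; rewrite lee_fin expR_ge0.
Qed.

(** Consecutive vertices of a simple path contribute to distinct terms of the
    tail of the Poincare series. *)
Lemma connected_bourdon_tail (n : int) g h : cay_connected S (word_ball S n) g h ->
  ((rho (xi g) (xi h) `^ q)%:E <= tail_function S o q D n)%E.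
Proof.
move=> gh; have [p [pp lp up pQ]] := conn_uniq_path gh.
case: p => [|y p] in pp lp up pQ *.
  by rewrite -lp -/(dq g g) dqxx tail_function_ge0.
have S1 : 1 <= #|` S|%:R :> R.
  case/andP: (pp) => /cay_adjP[s sS _] _.
  by rewrite ler1n cardfs_gt0; apply/fset0Pn; exists s.
have := path_vertex_sum dqxx dq_triangle adjacent_bourdon_powR pp.
rewrite lp -mulr_sumr => le1.
rewrite /tail_function.
have le2 : ((\sum_(x <- belast g (y :: p)) decay x)%:E <=
    \esum_(x in [set x : G | (n < (word_length S x)%:Z)%R]) (decay x)%:E)%E.
  apply: sum_le_esum; first by move: up; rewrite lastI rcons_uniq => /andP[].
  move=> x xp; have /pQ/conn_notin : x \in g :: y :: p.
    by rewrite lastI mem_rcons inE xp orbT.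
  by rewrite /word_ball /= => /negP; rewrite -ltNge.
apply: le_trans (lee_pmul _ _ (lexx _) le2); rewrite ?lee_fin ?mulr_ge0 ?expR_ge0//; last first.
  by apply: sumr_ge0 => x _; exact: expR_ge0.
rewrite (le_trans le1)// ler_wpM2r//.
  by apply: sumr_ge0 => x _; exact: expR_ge0.
by rewrite ler_peMl ?expR_ge0.
Qed.

Lemma edge_weightE g h : edge_weight o xi [set g; h] = rho (xi g) (xi h).
Proof.
rewrite /edge_weight; case: xgetP => [_ _ [a [b [E ->]]]|/(_ (rho (xi g) (xi h)))]; last first.
  by move=> []; exists g, h.
have [ag ah] : [set g; h] a /\ [set g; h] b by rewrite E; split; [left|right].
have [ga ha] : [set a; b] g /\ [set a; b] h by rewrite -E; split; [left|right].
case: ag ah ga ha => [|] /= -> [|] /= -> //.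
- by move=> _ [] ->.
- by rewrite (bourdon_sym X_proper X_cat D_thin).
- by move=> [] ->.
Qed.

Definition component_edges Q U : set (set G) :=
  [set e | cay_edges S Q e /\ e `<=` U].

(** A simple path in [U] has distinct edges, and [t `^ q] is subadditive. *)
Lemma component_bourdon_edges Q U g h : component S Q U -> U g -> U h ->
  ((rho (xi g) (xi h) `^ q)%:E <=
   \esum_(e in component_edges Q U) (edge_weight o xi e `^ q)%:E)%E.
Proof.
move=> cU Ug Uh; have gh : cay_connected S Q g h.
  by move: Uh; rewrite (component_conn S_sym cU Ug).
have [p [pp lp up pQ]] := conn_uniq_path gh.
have pU x : x \in g :: p -> U x.
  by move=> /pQ gx; rewrite (component_conn S_sym cU Ug).
have dF x y : cay_adj S x y -> dq x y <= edge_weight o xi [set x; y] `^ q.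
  by rewrite edge_weightE.
have := path_edge_sum dqxx dq_triangle (F := fun e => edge_weight o xi e `^ q) dF pp.
rewrite lp => le1.
apply: (@le_trans _ _ (\sum_(e <- pairmap (fun x y => [set x; y]) g p)
  edge_weight o xi e `^ q)%:E); first by rewrite lee_fin.
apply: sum_le_esum; first exact: uniq_path_edges pp up.
move=> e /(mem_path_edges pp)[x [y [-> /cay_adjP[s sS yE] xp yp]]].
have Ux := pU _ xp; have Uy : U y by apply: pU; rewrite inE yp orbT.
split; last by move=> _ [|] /= ->.
exists x, s; split => //; first exact: component_notin cU Ux.
  by rewrite -yE; exact: component_notin cU Uy.
by rewrite yE.
Qed.

End exponent.

(** * Cluster sets of components *)

Lemma cluster_approx U zeta e : cluster_set xi U zeta -> 0 < e ->
  exists2 g, U g & rho zeta (xi g) < e.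
Proof.
move=> cl e0; have cl0 := cl set0 (conj (finite_set0 _) (@sub0set _ U)).
have /(closure_bourdon X_proper X_cat D_thin o)-/(_ e e0)[_ [g [Ug _] <-] lt] := cl0.
by exists g.
Qed.

Lemma cluster_bourdon_le U zeta zeta' b :
  (forall g h, U g -> U h -> rho (xi g) (xi h) <= b) ->
  cluster_set xi U zeta -> cluster_set xi U zeta' -> rho zeta zeta' <= b.
Proof.
move=> Ub cl cl'; apply/ler_addgt0Pl => e e0.
have e2 : 0 < e / 2 by rewrite divr_gt0.
have [g Ug lt] := cluster_approx cl e2; have [h Uh lt'] := cluster_approx cl' e2.
have := Ub g h Ug Uh.
have := bourdon_triangle X_proper X_cat D_thin o zeta (xi g) zeta'.
have := bourdon_triangle X_proper X_cat D_thin o (xi g) (xi h) zeta'.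
by rewrite (bourdon_sym X_proper X_cat D_thin _ (xi h)); lra.
Qed.

Lemma diam_le (d : boundary X -> boundary X -> R) (Z : set (boundary X)) b : 0 <= b ->
  (forall x y, Z x -> Z y -> d x y <= b) -> diam d Z <= b.
Proof.
move=> b0 Zb; rewrite /diam; set E := (X in sup X).
have [->|/set0P E0] := eqVneq E set0; first by rewrite sup0.
by apply: ge_sup => // _ [x Zx [y Zy <-]]; exact: Zb.
Qed.

Lemma le_diam_bourdon (Z : set (boundary X)) zeta zeta' : Z zeta -> Z zeta' ->
  rho zeta zeta' <= diam rho Z.
Proof.
move=> Zz Zz'; apply: ub_le_sup; last by exists zeta => //; exists zeta'.
by exists 1 => _ [x _ [y _ <-]]; exact: (bourdon_le1 X_proper X_cat D_thin).
Qed.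

Lemma diam_bourdon_ge0 (Z : set (boundary X)) : 0 <= diam rho Z.
Proof.
have [->|/set0P[z Zz]] := eqVneq Z set0.
  by rewrite /diam (_ : [set _ | _ in _ & _ in _] = set0) ?sup0// -subset0 => t [x []].
exact: le_trans (bourdon_ge0 _ _ _) (le_diam_bourdon Zz Zz).
Qed.

(** Otherwise, in each of the finitely many components, the [xi g] would stay
    away from [zeta] for all but finitely many [g], and [zeta] would not be
    approximated by the [xi g]. *)
Lemma cluster_cover Q zeta : finite_set Q -> limit_set G zeta ->
  exists2 U, component S Q U & cluster_set xi U zeta.
Proof.
move=> fQ zl; apply: contrapT => nU.
have /choice[F FP] U : exists F : set G, component S Q U -> finite_set F /\
    exists2 r, 0 < r & forall g, U g -> ~ F g -> r <= rho zeta (xi g).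
  have [cU|] := pselect (component S Q U); last by exists set0.
  have : ~ cluster_set xi U zeta by move=> cl; apply: nU; exists U.
  move=> /existsNP[F /not_implyP[[fF FU] ncl]]; exists F => _; split => //.
  move: ncl => /(closure_bourdon X_proper X_cat D_thin o)/existsNP[r /not_implyP[r0 H]].
  exists r => // g Ug Fg; rewrite leNgt; apply/negP => lt; apply: H.
  by exists (xi g) => //; exists g.
have /choice[r rP] U : exists r, component S Q U -> 0 < r /\
    forall g, U g -> ~ F U g -> r <= rho zeta (xi g).
  have [cU|] := pselect (component S Q U); last by exists 0.
  by have [_ [r r0 H]] := FP U cU; exists r.
have fC := finite_components S_sym S_gen fQ.
have [r0 r00 r0P] := @finite_uniform_pos _ _ _ r fC (fun U cU => (rP U cU).1).
have fA : finite_set (Q `|` \bigcup_(U in component S Q) F U).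
  by rewrite finite_setU; split => //; apply: bigcup_finite => // U /FP[].
have [g gA lt] := limit_set_approx zl fA r00.
have Qg : ~ Q g by move=> Qg; apply: gA; left.
pose U := [set h | cay_connected S Q g h].
have cU : component S Q U by exact: component_of.
move: lt; rewrite ltNge (bourdon_sym X_proper X_cat D_thin) => /negP; apply.
apply: le_trans (r0P U cU) _; apply: (rP U cU).2; first exact: conn_refl.
by move=> Fg; apply: gA; right; exists U.
Qed.

Lemma cluster_infinite Q U zeta : component S Q U -> cluster_set xi U zeta ->
  infinite_set U.
Proof.
move=> cU cl fU.
have /(closure_bourdon X_proper X_cat D_thin o)-/(_ 1 ltr01)[_ [g [Ug nUg] _] _] :=
  cl U (conj fU (@subset_refl _ U)).
exact: nUg.
Qed.

Lemma diam_cluster_powR Q U q : 0 < q <= 1 -> component S Q U ->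
  ((diam rho (cluster_set xi U) `^ q)%:E <=
   \esum_(e in component_edges Q U) (edge_weight o xi e `^ q)%:E)%E.
Proof.
move=> q01 cU; have /andP[q0 _] := q01.
have H g h : U g -> U h -> _ := component_bourdon_edges q01 cU.
move: H; set s := \esum_(_ in _) _.
have : (0 <= s)%E by apply: esum_ge0 => e _; rewrite lee_fin powR_ge0.
case: s => [v| |]// v0 H; last by rewrite leey.
rewrite lee_fin in v0; rewrite lee_fin; apply: powR_le => //; first exact: diam_bourdon_ge0.
apply: diam_le; first exact: powR_ge0.
move=> x y Ux Uy; apply: cluster_bourdon_le Ux Uy => g h Ug Uh.
by apply: le_powRV => //; [exact: bourdon_ge0|rewrite -lee_fin H].
Qed.

(** Distinct components have disjoint sets of edges. *)
Lemma sum_diam_cluster_le Q q : 0 < q <= 1 ->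
  (\esum_(U in component S Q) (diam rho (cluster_set xi U) `^ q)%:E <=
   edge_weight_sum S o q xi Q)%E.
Proof.
move=> q01; apply: (@le_trans _ _ (\esum_(U in component S Q)
  \esum_(e in component_edges Q U) (edge_weight o xi e `^ q)%:E)).
  by apply: le_esum => U cU; exact: diam_cluster_powR.
have w0 e : (0 <= (edge_weight o xi e `^ q)%:E)%E by rewrite lee_fin powR_ge0.
rewrite esum_esum//; pose P := component S Q `*`` component_edges Q.
rewrite -(esum_image P snd (fun e => (edge_weight o xi e `^ q)%:E)); last first.
  move=> [U e] [V e'] /set_mem[/= cU [ce eU]] /set_mem[/= cV [_ eV]] ee'.
  rewrite -ee' in eV *; congr (_, _).
  case: ce => g [s [_ _ _ E]]; apply: (component_eq S_sym cU cV (g := g)).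
    by apply: eU; rewrite E; left.
  by apply: eV; rewrite E; left.
by apply: le_esum_sub => // _ [[U e] [_ [ce _]] <-].
Qed.

(** Two [e]-separated points of the limit set cannot lie in the cluster set of
    one component, whose diameter is less than [e]. *)
Lemma pack_le_c_infty Q q e : finite_set Q -> 0 < q <= 1 -> 0 < e ->
  (edge_weight_sum S o q xi Q < (e `^ q)%:E)%E ->
  (pack rho e (limit_set G) <= c_infty S Q)%E.
Proof.
move=> fQ q01 e0 We; have /andP[q0 _] := q01.
apply: ge_ereal_sup => _ [E [EL Esep] <-].
have /choice[f fP] zeta : exists U, E zeta -> component S Q U /\ cluster_set xi U zeta.
  have [Ez|] := pselect (E zeta); last by exists set0.
  by have [U cU cl] := cluster_cover fQ (EL _ Ez); exists U.
have fI zeta zeta' : E zeta -> E zeta' -> f zeta = f zeta' -> zeta = zeta'.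
  move=> Ez Ez' ff; have [cU cl] := fP _ Ez; have [_] := fP _ Ez'.
  rewrite -ff => cl'; apply: contrapT => zz'.
  have := Esep _ _ Ez Ez' zz'; apply/negP; rewrite -ltNge.
  apply: le_lt_trans (le_diam_bourdon cl cl') _; rewrite ltNge; apply/negP => ed.
  move: We; apply/negP; rewrite -leNgt.
  apply: le_trans (sum_diam_cluster_le _ q01).
  have dcl0 := diam_bourdon_ge0 (cluster_set xi (f zeta)).
  apply: (@le_trans _ _ (diam rho (cluster_set xi (f zeta)) `^ q)%:E).
    by rewrite lee_fin; apply: ge0_ler_powR; rewrite ?nnegrE ?(ltW q0)// ltW.
  apply: esum_ge; exists [set f zeta]; last by rewrite fsbig_set1.
  by split => // _ ->.
rewrite /c_infty /counting; case: asboolP => [fE|nE]; case: asboolP => [fC|_]; rewrite ?leey//.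
- rewrite lee_fin ler_nat -(card_in_imfset (f := f) imfset_key (p := mem (fset_set E))) /=; last first.
    by move=> x y /=; rewrite !in_fset_set// => /set_mem Ex /set_mem Ey; exact: fI.
  apply: fsubset_leq_card; apply/fsubsetP => U /imfsetP[x /= xE ->].
  move: xE; rewrite !in_fset_set// => /set_mem Ex; apply/mem_set.
  by have [cU cl] := fP _ Ex; split => //; exact: cluster_infinite cU cl.
- exfalso; apply: nE.
  have fi : {in E &, injective f} by move=> x y /set_mem Ex /set_mem Ey; exact: fI.
  rewrite -(eq_finite_set (inj_card_eq fi)).
  apply: sub_finite_set fC => _ [x Ex <-]; have [cU cl] := fP _ Ex.
  by split => //; exact: cluster_infinite cU cl.
Qed.

(** * The ultrametric on the space of ends *)

Section summable_exponent.
Variable q : R.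
Hypotheses (q01 : 0 < q <= 1) (q_fin : (poincare_series G o q < +oo)%E).
Hypothesis G_inf : infinite_set [set: G].

Local Notation wball n := (word_ball S n).
Local Notation comp n e := (end_comp (word_ball S n) e).
Local Notation decay g := (expR (- (q * mdist o (act g o)))).
Local Notation T n := (tail_function S o q D n).
Local Notation dE := (end_dist o q D : ends S -> ends S -> R).
Implicit Types (e : ends S) (k l : int) (zeta eta : boundary X).

Let q0 : 0 < q. Proof. by have /andP[] := q01. Qed.

Let fB k : finite_set (wball k) := finite_word_ball S_gen k.

(** The value of [end_dist] on two ends that are separated exactly beyond the
    level [k]. *)
Definition level_bound k : R := fine (T k) `^ q^-1.

Local Notation theta := level_bound.

Lemma generators_gt0 : 0 < #|` S|%:R :> R.
Proof.
rewrite ltr0n cardfs_gt0; apply/negP => /eqP S0; apply: G_inf.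
apply: (sub_finite_set (B := [set 1%g])); last exact: finite_set1.
move=> g _; have [[|s w] [aw ->]] := S_gen g; first by rewrite /= big_nil.
have : s \in S by case/andP: aw.
by rewrite S0 inE.
Qed.

Lemma tail_sum_le k l : k <= l ->
  (\esum_(g in [set g : G | (l < (word_length S g)%:Z)%R]) (decay g)%:E <=
   \esum_(g in [set g : G | (k < (word_length S g)%:Z)%R]) (decay g)%:E)%E.
Proof.
move=> kl; apply: le_esum_sub => g; last by rewrite lee_fin expR_ge0.
by move=> /=; exact: le_lt_trans.
Qed.

Lemma tail_function_fin k : T k \is a fin_num.
Proof.
rewrite /tail_function fin_numM// ge0_fin_numE; last first.
  by apply: esum_ge0 => g _; rewrite lee_fin expR_ge0.
by apply: le_lt_trans q_fin; apply: le_esum_sub => // g; rewrite lee_fin expR_ge0.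
Qed.

Lemma tail_function_le k l : k <= l -> (T l <= T k)%E.
Proof.
move=> kl; apply: lee_wpmul2l; last exact: tail_sum_le.
by rewrite lee_fin mulr_ge0// expR_ge0.
Qed.

Lemma tail_function_gt0 k : (0 < T k)%E.
Proof.
rewrite /tail_function; apply: mule_gt0.
  by rewrite lte_fin mulr_gt0 ?expR_gt0 ?generators_gt0.
have [g kg] : exists g : G, (k < (word_length S g)%:Z)%R.
  apply: contrapT => nk; apply: G_inf; apply: sub_finite_set (fB k) => g _.
  by rewrite /word_ball /= leNgt; apply/negP => kg; apply: nk; exists g.
apply: (@lt_le_trans _ _ (decay g)%:E); first by rewrite lte_fin expR_gt0.
by apply: esum_ge; exists [set g]; [split => // _ ->|rewrite fsbig_set1].
Qed.

Lemma tail_function_cvg0 r : 0 < r -> exists n : nat, fine (T n%:Z) < r.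
Proof.
move=> r0; set C := #|` S|%:R * expR (q * (L + 2 * D)).
have C0 : 0 < C by rewrite mulr_gt0 ?expR_gt0 ?generators_gt0.
have rC : 0 < r / C by rewrite divr_gt0.
have [A fA AP] := @esum_tail R G (fun g => decay g) _ rC (fun _ => expR_ge0 _) q_fin.
have [n An] := finite_sub_word_ball S fA; exists n.
rewrite -lte_fin fineK ?tail_function_fin// /tail_function.
have -> : r = C * (r / C) by rewrite mulrC divfK// gt_eqF.
rewrite (EFinM C (r / C)) lte_pmul2l ?lte_fin//; apply: AP.
rewrite -subset0 => g [/= ng /An]; rewrite /word_ball/=; lia.
Qed.

Lemma level_bound_ge0 k : 0 <= theta k. Proof. exact: powR_ge0. Qed.

Lemma level_bound_gt0 k : 0 < theta k.
Proof. by apply: powR_gt0; rewrite fine_gt0// tail_function_gt0 ltey_eq tail_function_fin. Qed.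

Lemma level_bound_le k l : k <= l -> theta l <= theta k.
Proof.
move=> kl; apply: ge0_ler_powR; rewrite ?invr_ge0 ?(ltW q0)// ?nnegrE ?fine_ge0 ?tail_function_ge0//.
by rewrite fine_le ?tail_function_fin// tail_function_le.
Qed.

Lemma level_bound_cvg0 r : 0 < r -> exists n : nat, theta n%:Z < r.
Proof.
move=> r0; have [n nr] := tail_function_cvg0 (powR_gt0 q r0); exists n.
have -> : r = (r `^ q) `^ q^-1 by rewrite -powRrM divff ?gt_eqF// powRr1// ltW.
by apply: gt0_ltr_powR; rewrite ?invr_gt0// nnegrE ?powR_ge0// fine_ge0// tail_function_ge0.
Qed.

Lemma component_bourdon_le k U g h : component S (wball k) U -> U g -> U h ->
  rho (xi g) (xi h) <= theta k.
Proof.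
move=> cU Ug Uh; apply: le_powRV => //; rewrite ?bourdon_ge0// ?fine_ge0 ?tail_function_ge0//.
rewrite -lee_fin fineK ?tail_function_fin//; apply: connected_bourdon_tail => //.
by move: Uh; rewrite (component_conn S_sym cU Ug).
Qed.

Lemma end_dist_level e e' : e <> e' -> dE e e' = theta (end_level e e').
Proof. by move=> /eqP/negPf ee'; rewrite /end_dist ee'. Qed.

Lemma end_distxx e : dE e e = 0.
Proof. by rewrite /end_dist eqxx. Qed.

Lemma end_dist_le k e e' : -1 <= k -> comp k e = comp k e' -> dE e e' <= theta k.
Proof.
move=> k1 ke; have [->|/eqP ee'] := eqVneq e e'; first by rewrite end_distxx level_bound_ge0.
rewrite (end_dist_level ee'); apply: level_bound_le.
by have [_ /(_ k k1)[+ _]] := end_levelP S_sym S_gen ee'; exact.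
Qed.

Lemma end_dist_comp k e e' : -1 <= k -> dE e e' < theta k -> comp k e = comp k e'.
Proof.
move=> k1; have [->//|/eqP ee'] := eqVneq e e'; rewrite end_dist_level// => lt.
have [_ /(_ k k1)[_]] := end_levelP S_sym S_gen ee'; apply.
by rewrite leNgt; apply/negP => /ltW/level_bound_le; rewrite leNgt lt.
Qed.

Lemma end_dist_ultrametric : is_ultrametric dE.
Proof.
have dge0 x y : 0 <= dE x y.
  have [->|/eqP xy] := eqVneq x y; first by rewrite end_distxx.
  by rewrite (end_dist_level xy) level_bound_ge0.
split; first exact: dge0.
- move=> x y; split=> [|->]; last by rewrite end_distxx.
  have [->|/eqP xy] := eqVneq x y; first by [].
  rewrite (end_dist_level xy) => t0.
  by have := level_bound_gt0 (end_level x y); rewrite t0 ltxx.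
- move=> x y; have [->|/eqP xy] := eqVneq x y; first by [].
  by rewrite (end_dist_level xy) (end_dist_level (nesym xy)) end_level_sym.
- move=> x y z.
  have [->|/eqP xy] := eqVneq x y; first by rewrite le_max; apply/orP; right.
  have [->|/eqP yz] := eqVneq y z; first by rewrite le_max; apply/orP; left.
  have [xy1 xyP] := end_levelP S_sym S_gen xy.
  have [yz1 yzP] := end_levelP S_sym S_gen yz.
  rewrite le_max !(end_dist_level xy) !(end_dist_level yz).
  have [le|/ltW le] := leP (end_level x y) (end_level y z); apply/orP; [left|right].
    by apply: (end_dist_le xy1); rewrite ((xyP _ xy1).2 (lexx _)) ((yzP _ xy1).2 le).
  by apply: (end_dist_le yz1); rewrite ((xyP _ yz1).2 le) ((yzP _ yz1).2 (lexx _)).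
Qed.

Lemma open_end_dist (V : set (ends S)) : open V <-> dist_open dE setT V.
Proof.
rewrite openE; split=> [oV|[_ oV] e Ve].
  split => // e /oV/(nbhs_ends S_sym S_gen)[n nV].
  exists (theta n%:Z); first exact: level_bound_gt0.
  move=> e' [_ /= lt]; apply: nV; apply/(ends_inP S_sym) => //.
  by apply: end_dist_comp lt.
have [r r0 rV] := oV e Ve; have [n nr] := level_bound_cvg0 r0.
apply/(nbhs_ends S_sym S_gen); exists n => e' /(ends_inP S_sym)-/(_ (fB _)) ee'.
by apply: rV; split => //=; apply: le_lt_trans nr; exact: end_dist_le.
Qed.

(** * The map from the ends to the limit set *)

(** Along a ray of [e] the points [xi (r n)] form a Cauchy sequence, because
    the tails of the Poincare series tend to 0. *)
Lemma exists_end_point e : exists zeta, forall k g, comp k e g ->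
  rho (xi g) zeta <= theta k.
Proof.
have [r rr er] := end_ray e.
have tail k : exists N, forall m, (N <= m)%N -> comp k e (r m).
  by have [N NP] := end_comp_tail S_sym (fB k) er; exists N.
have cU k : component S (wball k) (comp k e) := (end_compP S_sym e (fB k)).1.
have [e0 e00|zeta zP] := bourdon_complete X_proper X_cat D_thin (o := o) (xi := xi \o r).
  have [n ne] := level_bound_cvg0 e00; have [N NP] := tail n%:Z.
  exists N => a b Na Nb; apply: le_lt_trans ne.
  by apply: component_bourdon_le (cU _) _ _; exact: NP.
exists zeta => k g kg; apply/ler_addgt0Pl => e0 e00.
have [N NP] := tail k; have [M MP] := zP e0 e00.
have := bourdon_triangle X_proper X_cat D_thin o (xi g) (xi (r (maxn M N))) zeta.
have := MP (maxn M N) (leq_maxl _ _).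
have := component_bourdon_le (cU k) kg (NP (maxn M N) (leq_maxr _ _)).
by move=> /=; lra.
Qed.

Section end_map.
Variable Pi : ends S -> boundary X.
Hypothesis PiP : forall e k g, comp k e g -> rho (xi g) (Pi e) <= theta k.

(** Let [U] be the last component that contains both ends. Deep vertices of [U]
    approximate both limits, and two vertices of [U] have boundary points at
    distance at most [theta (end_level e e')]. *)
Lemma end_map_lipschitz e e' : rho (Pi e) (Pi e') <= dE e e'.
Proof.
have [->|/eqP ee'] := eqVneq e e'; first by rewrite (bourdon_xx X_proper X_cat D_thin) end_distxx.
rewrite end_dist_level//; have [N1 /(_ _ N1)[_ /(_ (lexx _)) cE]] := end_levelP S_sym S_gen ee'.
set N := end_level e e' in N1 cE *.
apply/ler_addgt0Pl => r r0; have r2 : 0 < r / 2 by rewrite divr_gt0.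
have [n nr] := level_bound_cvg0 r2; pose m := Num.max N n%:Z.
have [Nm nm] : N <= m /\ n%:Z <= m by rewrite /m !le_max !lexx orbT.
have [g gm] := component_nonempty (end_compP S_sym e (fB m)).1.
have [h hm] := component_nonempty (end_compP S_sym e' (fB m)).1.
have gN := end_compS S_sym (word_ballS Nm) (fB m) gm.
have hN := end_compS S_sym (word_ballS Nm) (fB m) hm.
rewrite -cE in hN.
have h1 := component_bourdon_le (end_compP S_sym e (fB N)).1 gN hN.
have h2 := PiP gm; have h3 := PiP hm; have h4 := level_bound_le nm.
have h5 := bourdon_triangle X_proper X_cat D_thin o (Pi e) (xi g) (Pi e').
have h6 := bourdon_triangle X_proper X_cat D_thin o (xi g) (xi h) (Pi e').
move: h1 h2 h3 h4 h5 h6 nr.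
rewrite (bourdon_sym X_proper X_cat D_thin o (Pi e) (xi g)).
move: (theta N) (theta m) (theta n%:Z) (rho _ _) (rho _ _) (rho _ _) (rho _ _) (rho _ _).
by move=> *; lra.
Qed.

(** The candidate for the continuous extension of the orbit map. *)
Definition orbit_extension (z : end_compactification S) : bordification X :=
  match z with inl g => inl (act g o) | inr e => inr (Pi e) end.

Lemma orbit_extension_end_nbhs e n : exists m,
  forall z, end_nbhs e m z -> cone_basis o (Pi e) n (orbit_extension z).
Proof.
have [r [B [r0 H]]] := orbit_cone_basis (Pi e) n.
have [r' r'0 H'] := cone_basis_boundary X_proper X_cat D_thin o (Pi e) n.
have rr0 : 0 < Num.min r r' by rewrite lt_min r0.
have [m1 m1r] := level_bound_cvg0 rr0.
have [m2 m2B] := finite_sub_word_ball S (finite_orbit B q0 q_fin).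
pose m := maxn m1 m2; exists m.
have mr : theta m%:Z < Num.min r r'.
  by apply: le_lt_trans m1r; apply: level_bound_le; rewrite lez_nat leq_maxl.
move: mr; rewrite lt_min => /andP[mr mr'].
move=> _ [[g gm <-]|[e' e'm <-]] /=.
  apply: H; first exact: le_lt_trans (PiP gm) mr.
  rewrite leNgt; apply/negP => /ltW/m2B gB.
  apply: (component_notin (end_compP S_sym e (fB m%:Z)).1 gm).
  by apply: word_ballS gB; rewrite lez_nat leq_maxr.
apply: H'; apply: le_lt_trans (end_map_lipschitz _ _) _; apply: le_lt_trans mr'.
by apply: end_dist_le => //; apply/(ends_inP S_sym).
Qed.

Lemma orbit_extension_continuous : continuous orbit_extension.
Proof.
move=> [g|e] V nV /=.
  by apply: nbhs_end_compactification_vertex; exact: nbhs_singleton nV.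
have [n nP] := nbhs_bordification X_proper X_cat D_thin o nV.
have [m mP] := orbit_extension_end_nbhs e n.
by apply: filterS (nbhs_end_nbhs S_sym S_gen e m) => z /mP/nP.
Qed.

Lemma end_map_limit e : limit_set G (Pi e).
Proof.
exists o => V nV; have [n nP] := nbhs_bordification X_proper X_cat D_thin o nV.
have [m mP] := orbit_extension_end_nbhs e n.
have [g gm] := component_nonempty (end_compP S_sym e (fB m%:Z)).1.
by exists (inl (act g o)); split; [exists g|apply/nP/(mP (inl g)); left; exists g].
Qed.

(** Along a ray [r] of [e] the orbit points [(g * r n) o] tend to both sides. *)
Lemma end_map_equivariant g e : Pi (end_translate g e) = isom_bd (val g) (Pi e).
Proof.
apply: (cone_basis_separates X_proper X_cat D_thin (o := o)) => n.
have [m mP] := orbit_extension_end_nbhs (end_translate g e) n.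
have [j jP] := isom_bord_cone_basis X_proper X_cat D_thin o (val g) (Pi e) n.
have [m' m'P] := orbit_extension_end_nbhs e j.
have [r rr er] := end_ray e.
have ger : end_rays (end_translate g e) (fun i => g * r i)%g by exists r.
have [N NP] := end_comp_tail S_sym (fB m%:Z) ger.
have [N' N'P] := end_comp_tail S_sym (fB m'%:Z) er.
pose k := maxn N N'; exists (inl (act (g * r k)%g o)).
  apply: (mP (inl (g * r k)%g)); left; exists (g * r k)%g => //.
  by apply: NP; exact: leq_maxl.
rewrite actM; apply: (jP (inl (act (r k) o))); apply: (m'P (inl (r k))).
by left; exists (r k) => //; apply: N'P; exact: leq_maxr.
Qed.

Lemma orbit_extensionP : is_orbit_extension o orbit_extension.
Proof.
split => //.
- by move=> [g|e]; [left; exists (act g o)|right; exists (Pi e) => //; exact: end_map_limit].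
- exact: orbit_extension_continuous.
- move=> g [h|e] /=; first by rewrite actM.
  by rewrite end_map_equivariant.
Qed.

(** The vertices are dense and limits at infinity are unique; a value in [X] at
    an end is excluded because balls contain finitely many orbit points. *)
Lemma orbit_extension_unique Phi : is_orbit_extension o Phi -> orbit_extension = Phi.
Proof.
move=> [_ cPhi _ Phig]; apply/funext => -[g|e]; first by rewrite Phig.
rewrite /=; case E : (Phi (inr e)) => [x|eta].
  exfalso; have nb : nbhs (Phi (inr e)) (inl @` [set y : X | mdist x y < 1]).
    rewrite E; apply: open_nbhs_nbhs; split; last by exists x; rewrite //= mdistxx.
    apply: (subbase_open (D := @cone_subbase _ X)); first by move=> F FD; exists F.
    left; exists (interior (ball x 1)); first exact: open_interior.
    rewrite (_ : interior _ = [set y | mdist x y < 1])//; rewrite -ballEmdist.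
    apply/seteqP; split; first exact: interior_subset.
    move=> y; rewrite ballEmdist /= => xy.
    have d0 : 0 < 1 - mdist x y by rewrite subr_gt0.
    apply: filterS (nbhsx_ballx y _ d0) => w; rewrite !ballEmdist /=.
    by have := metric_triangle x y w; lra.
  have [n nP] := nbhs_end_compactification S_sym S_gen (cPhi (inr e) _ nb).
  apply: (end_comp_infinite S_sym (fB n%:Z) (e := e)).
  apply: sub_finite_set (finite_orbit (mdist o x + 1) q0 q_fin) => g gn.
  have [|y yx] := nP (inl g); first by left; exists g.
  rewrite Phig => -[yE]; rewrite yE /= in yx.
  by have := metric_triangle o x (act g o); move: yx => /=; lra.
congr inr; apply: (cone_basis_separates X_proper X_cat D_thin (o := o)) => n.
have [m mP] := orbit_extension_end_nbhs e n.
have nb : nbhs (Phi (inr e)) (cone_basis o eta n).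
  by rewrite E; exact: (nbhs_cone_basis X_proper X_cat D_thin).
have [m' m'P] := nbhs_end_compactification S_sym S_gen (cPhi (inr e) _ nb).
have [g gm] := component_nonempty (end_compP S_sym e (fB (maxn m m')%:Z)).1.
have le1 : m%:Z <= (maxn m m')%:Z by rewrite lez_nat leq_maxl.
have le2 : m'%:Z <= (maxn m m')%:Z by rewrite lez_nat leq_maxr.
exists (inl (act g o)).
  apply: (mP (inl g)); left; exists g => //.
  exact: (end_compS S_sym (word_ballS le1) (fB _) gm).
rewrite -Phig; apply: m'P; left; exists g => //.
exact: (end_compS S_sym (word_ballS le2) (fB _) gm).
Qed.

(** Koenig's lemma, for vertices whose boundary points approach [zeta], gives a
    ray with infinitely many of these vertices on the side of its end. *)
Lemma end_map_surj zeta : limit_set G zeta -> exists e, Pi e = zeta.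
Proof.
move=> zl.
pose A n := [set h : G | (n < word_length S h)%N /\ rho (xi h) zeta < n.+1%:R^-1].
have [|||r [rr wr rA]] := @geodesic_ray_through _ S S_gen A.
- move=> m n mn h [nh hz]; split; first exact: leq_ltn_trans mn nh.
  exact: lt_le_trans hz (inv_nat_le mn).
- move=> n; have n0 : 0 < n.+1%:R^-1 :> R by rewrite invr_gt0.
  have [g gB gz] := limit_set_approx zl (fB n%:Z) n0; exists g; split => //.
  by move: gB; rewrite word_ballE /= => /negP; rewrite -ltnNge.
- by move=> n h [].
have [e er] := end_of_ray rr; exists e.
apply: (bourdon_eq_small X_proper X_cat D_thin (o := o)) => d d0.
have d2 : 0 < d / 2 by rewrite divr_gt0.
have [n nd] := level_bound_cvg0 d2; have [j jd] := inv_nat_small d2.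
have [h [hc [_ hz]]] := rA n.+1 j.
have h1 := PiP (word_cone_end_comp S_sym S_gen rr wr er hc).
have h2 := bourdon_triangle X_proper X_cat D_thin o (Pi e) (xi h) zeta.
apply: le_trans h2 _; rewrite (bourdon_sym X_proper X_cat D_thin o (Pi e)) (splitr d).
by apply: lerD; [exact: le_trans h1 (ltW nd)|exact: le_trans (ltW hz) (ltW jd)].
Qed.

(** A continuous surjection from a compact space onto a Hausdorff space is a
    quotient map. Compactness of the space of ends enters through Koenig's
    lemma: if points outside of [V] approached [zeta] in [V], their preimages
    would accumulate at an end above [zeta]. *)
Lemma end_map_quotient (V : set (boundary X)) : V `<=` limit_set G ->
  dist_open rho (limit_set G) V <-> dist_open dE setT (Pi @^-1` V).
Proof.
move=> VL; split=> [[_ oV]|[_ oV]].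
  split => // e Ve; have [r r0 rV] := oV _ Ve; exists r => // e' [_ /= lt].
  apply: rV; split; first exact: end_map_limit.
  exact: le_lt_trans (end_map_lipschitz _ _) lt.
split => // zeta Vz; apply: contrapT => nr.
have near r : 0 < r -> exists e, rho zeta (Pi e) < r /\ ~ V (Pi e).
  move=> r0; apply: contrapT => ne; apply: nr; exists r => // eta [/end_map_surj[e <-] /= lt].
  by apply: contrapT => nV; apply: ne; exists e.
pose A n := [set h : G | (n < word_length S h)%N /\
  exists e, [/\ comp n%:Z e h, rho zeta (Pi e) < n.+1%:R^-1 & ~ V (Pi e)]].
have [|||r [rr wr rA]] := @geodesic_ray_through _ S S_gen A.
- move=> m n mn h [nh [e [eh ez eV]]]; split; first exact: leq_ltn_trans mn nh.
  exists e; split => //; last exact: lt_le_trans ez (inv_nat_le mn).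
  by apply: (end_compS S_sym _ (fB n%:Z) eh); apply: word_ballS; rewrite lez_nat.
- move=> n; have n0 : 0 < n.+1%:R^-1 :> R by rewrite invr_gt0.
  have [e [ez eV]] := near _ n0.
  have [h hn] := component_nonempty (end_compP S_sym e (fB n%:Z)).1.
  exists h; split; last by exists e.
  by have := component_notin (end_compP S_sym e (fB n%:Z)).1 hn; rewrite word_ballE /= => /negP; rewrite -ltnNge.
- by move=> n h [].
have [e er] := end_of_ray rr.
have close d : 0 < d -> exists e', [/\ dE e e' < d, rho zeta (Pi e') < d & ~ V (Pi e')].
  move=> d0; have [n nd] := level_bound_cvg0 d0; have [j jd] := inv_nat_small d0.
  have [h [hc [_ [e' [e'h e'z e'V]]]]] := rA (maxn n j).+1 (maxn n j).
  exists e'; split => //; last first.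
    by apply: lt_trans jd; apply: lt_le_trans e'z (inv_nat_le (leq_maxr _ _)).
  apply: le_lt_trans nd; apply: (@le_trans _ _ (theta (maxn n j)%:Z)); last first.
    by apply: level_bound_le; rewrite lez_nat leq_maxl.
  apply: end_dist_le => //.
  apply: (component_eq S_sym (end_compP S_sym e (fB _)).1 (end_compP S_sym e' (fB _)).1 _ e'h).
  exact: word_cone_end_comp er _ hc.
have zE : zeta = Pi e.
  apply: (bourdon_eq_small X_proper X_cat D_thin (o := o)) => d d0.
  have d2 : 0 < d / 2 by rewrite divr_gt0.
  have [e' [ee' ze' _]] := close _ d2.
  apply: le_trans (bourdon_triangle X_proper X_cat D_thin o zeta (Pi e') (Pi e)) _.
  rewrite (bourdon_sym X_proper X_cat D_thin o (Pi e') (Pi e)) (splitr d).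
  by apply: lerD (ltW ze') (le_trans (end_map_lipschitz e e') (ltW ee')).
have [|r0 r00 r0V] := oV e; first by rewrite /preimage /= -zE.
by have [e' [ee' _ nV]] := close _ r00; apply: nV; exact: (r0V e').
Qed.

End end_map.
End summable_exponent.

End orbit.

Theorem theorem1p2 (R : realType) (X : metricType R)
    (Gam : {pred isom X}) (G : subGroupType Gam) (S : {fset G})
    (A B : boundary X) (o : X) (D : R) (xi : G -> boundary X)
    (X_proper : proper_space X) (X_cat : CAT_minus1 X)
    (G_nonelem : non_elementary G) (G_discrete : discrete_isom_group G)
    (delta_gt0 : (0 < critical_exponent G o)%E)
    (delta_fin : (critical_exponent G o < +oo)%E)
    (S_sym : symmetric_set S) (S_gen : generating_set S)
    (A_lim : limit_set G A) (B_lim : limit_set G B) (A_neq_B : A <> B)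
    (o_AB : exists2 l, geodesic_side (inr A) (inr B) l & l o)
    (D_thin : thin_triangles X D)
    (xi_AB : forall g, xi g = isom_bd (val g) A \/ xi g = isom_bd (val g) B)
    (xi_near : forall g l, geodesic_side (inl o) (inr (xi g)) l ->
       dist_to_set ((val g : isom X) o) l <= D) :
  (forall (Q : set G) (q : R), finite_set Q -> 0 < q <= 1 ->
    [/\ limit_set G `<=` \bigcup_(U in [set U | component S Q U /\
                                       cluster_set xi U !=set0])
                           cluster_set xi U,
        (\esum_(U in component S Q)
           (diam (bourdon o) (cluster_set xi U) `^ q)%:E
         <= edge_weight_sum S o q xi Q)%E &
        forall e : R, 0 < e ->
          (edge_weight_sum S o q xi Q < (e `^ q)%:E)%E ->
          (pack (bourdon o) e (limit_set G) <= c_infty S Q)%E]) /\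
  (forall q : R, 0 < q <= 1 -> (poincare_series G o q < +oo)%E ->
    let dE : ends S -> ends S -> R := end_dist o q D in
    [/\ is_ultrametric dE,
        (forall V : set (ends S), open V <-> dist_open dE setT V) &
        exists Phi : end_compactification S -> bordification X,
        exists Pi : ends S -> boundary X,
          unique (is_orbit_extension o) Phi /\
          (forall e, Phi (inr e) = inr (Pi e)) /\
          [/\ forall e e', bourdon o (Pi e) (Pi e') <= dE e e',
              range Pi = limit_set G,
              (forall g e, Pi (end_translate g e) = isom_bd (val g) (Pi e)) &
              forall V : set (boundary X), V `<=` limit_set G ->
                (dist_open (bourdon o) (limit_set G) V <->
                 dist_open dE setT (Pi @^-1` V))]]).
Proof.
split=> [Q q fQ q01|q q01 q_fin dE].
  split.
  - move=> zeta zl; have [U cU cl] := cluster_cover X_proper X_cat D_thin S_sym S_gen xi_near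
      fQ zl.
    by exists U => //; split => //; exists zeta.
  - exact: (sum_diam_cluster_le o xi X_proper X_cat D_thin S_sym Q q01).
  - move=> e e0; exact: (pack_le_c_infty X_proper X_cat D_thin S_sym S_gen xi_near
      fQ q01 e0).
have G_inf : infinite_set [set: G].
  move=> fG; have [g []] := limit_set_approx X_proper X_cat D_thin xi_near
      A_lim fG ltr01.
  by [].
have /choice[Pi PiP] := exists_end_point X_proper X_cat D_thin S_sym S_gen xi_near
      q01 q_fin G_inf.
split; [exact: end_dist_ultrametric|exact: open_end_dist|].
exists (orbit_extension o Pi), Pi; split; last split => //.
  split; first exact: (orbit_extensionP X_proper X_cat D_thin S_sym S_gen xi_near
      q01 q_fin G_inf PiP).
  move=> Phi; exact: (orbit_extension_unique X_proper X_cat D_thin S_sym S_gen xi_near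
      q01 q_fin G_inf PiP).
split.
- exact: (end_map_lipschitz X_proper X_cat D_thin S_sym S_gen xi_near
      q01 q_fin G_inf PiP).
- apply/seteqP; split => [_ [e _ <-]|zeta zl].
    exact: (end_map_limit X_proper X_cat D_thin S_sym S_gen xi_near
      q01 q_fin G_inf PiP).
  have [e <-] := end_map_surj X_proper X_cat D_thin S_sym S_gen xi_near
      q01 q_fin G_inf PiP zl.
  by exists e.
- exact: (end_map_equivariant X_proper X_cat D_thin S_sym S_gen xi_near
      q01 q_fin G_inf PiP).
- move=> V; exact: (end_map_quotient X_proper X_cat D_thin S_sym S_gen xi_near
      q01 q_fin G_inf PiP).
Qed.
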